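(* Let $m$ be a positive integer and $0<\alpha<m$. Then there exists a constant $c>0$ such that for every $f\in\Lambda_\alpha$ and for an arbitrary unitary operator $U$ and an arbitrary bounded self-adjoint operator $A$ on Hilbert space the following inequality holds: $$\left\|\sum_{k=0}^m(-1)^k\binom mk f\big(e^{ikA}U\big)\right\|\le c\,\|f\|_{\Lambda_\alpha}\,\|A\|^\alpha .$$
   Context: Let $\mathbb T$ be the unit circle. For $\tau\in\mathbb T$ and a function $f$ on $\mathbb T$ put $(\Delta_\tau f)(\zeta)=f(\tau\zeta)-f(\zeta)$, $\zeta\in\mathbb T$, and let $\Delta_\tau^n$ denote the $n$-th power of $\Delta_\tau$. For $\alpha>0$ let $n$ be the integer with $n-1\le\alpha<n$. The Hölder–Zygmund class $\Lambda_\alpha$ consists of the continuous functions $f$ on $\mathbb T$ such that $$\|f\|_{\Lambda_\alpha}=\sup_{\tau\ne1,\;\zeta\in\mathbb T}\frac{|(\Delta_\tau^nf)(\zeta)|}{|1-\tau|^\alpha}<\infty .$$ *)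

(* Defs.v *)
From HB Require Import structures.
From mathcomp Require Import all_boot all_order all_algebra sesquilinear complex.
From mathcomp Require Import all_classical all_reals all_analysis.

Set Implicit Arguments.
Unset Strict Implicit.
Unset Printing Implicit Defensive.

Import Order.TTheory GRing.Theory Num.Theory.
Import numFieldNormedType.Exports.

Local Open Scope classical_set_scope.
Local Open Scope ring_scope.

(* Norms over R[i] take their values in R[i]; [rnorm] is the
   same norm seen as an element of R. *)
Definition rnorm (R : realType) (V : normedZmodType R[i]) (x : V) : R :=
  complex.Re `|x|.

Definition circle (R : realType) : set R[i] := [set z | `|z| = 1].
Arguments circle : clear implicits.

(* Functions on the circle are represented by functions on R[i], of which only
   the restriction to [circle R] is ever relevant; [R[i]^o] is the copy of R[i]
   carrying its norm topology. *)
Definition circle_continuous (R : realType) (f : R[i] -> R[i]) : Prop :=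
  {within (circle R : set R[i]^o), continuous (f : R[i]^o -> R[i]^o)}.

Definition rot_diff (R : realType) (tau : R[i]) (f : R[i] -> R[i]) : R[i] -> R[i] :=
  fun zeta => f (tau * zeta) - f zeta.

(* For [0 <= alpha], the unique integer n such that n - 1 <= alpha < n. *)
Definition zygmund_order (R : realType) (alpha : R) : nat := (Num.truncn alpha).+1.

Definition zygmund_norm (R : realType) (alpha : R) (f : R[i] -> R[i]) : \bar R :=
  ereal_sup [set e | exists tau zeta : R[i],
    [/\ circle R tau, tau != 1, circle R zeta &
        e = (rnorm (iter (zygmund_order alpha) (rot_diff tau) f zeta)
             / rnorm (1 - tau) `^ alpha)%:E]].

Definition zygmund_class (R : realType) (alpha : R) : set (R[i] -> R[i]) :=
  [set f | circle_continuous f /\ (zygmund_norm alpha f < +oo)%E].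

Record hilbertType (R : realType) := HilbertType {
  hilbert_space :> completeNormedModType R[i];
  inner : {dot hilbert_space for Num.conj};
  inner_normE : forall x : hilbert_space, inner x x = `|x| ^+ 2
}.

Section Operators.
Context {R : realType} {H : hilbertType R}.
Implicit Types (S T A U V : H -> H).

Definition bounded_operator T : Prop := linear T /\ continuous T.

Definition is_adjoint T S : Prop :=
  forall x y : H, inner H (T x) y = inner H x (S y).

Definition self_adjoint A : Prop := bounded_operator A /\ is_adjoint A A.

Definition unitary U : Prop :=
  bounded_operator U /\
  exists W : H -> H, [/\ is_adjoint U W, cancel U W & cancel W U].

Definition opnorm T : \bar R :=
  ereal_sup [set (rnorm (T x))%:E | x in [set x : H | `|x| <= 1]].

Definition op_exp T : H -> H :=
  fun x => limn (series (fun n => (n`!%:R : R[i])^-1 *: iter n T x)).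

(* [Phi] is a unital *-homomorphism from the C*-algebra of continuous functions
   on the circle to the bounded operators on [H], mapping the coordinate
   function to [V]. Such a [Phi] exists exactly when [V] is unitary, and its
   values on continuous functions are then uniquely determined. *)
Record functional_calculus V (Phi : (R[i] -> R[i]) -> (H -> H)) : Prop := {
  fc_bounded : forall f, circle_continuous f -> bounded_operator (Phi f);
  fc_ext : forall f g, circle_continuous f -> circle_continuous g ->
    {in circle R, f =1 g} -> Phi f = Phi g;
  fc_add : forall f g, circle_continuous f -> circle_continuous g ->
    Phi (fun z => f z + g z) = (fun x => Phi f x + Phi g x);
  fc_scale : forall (a : R[i]) f, circle_continuous f ->
    Phi (fun z => a * f z) = (fun x => a *: Phi f x);
  fc_mul : forall f g, circle_continuous f -> circle_continuous g ->
    Phi (fun z => f z * g z) = Phi f \o Phi g;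
  fc_one : Phi (fun=> 1) = id;
  fc_conj : forall f, circle_continuous f ->
    is_adjoint (Phi f) (Phi (fun z => (f z)^*));
  fc_coord : Phi id = V
}.

(* [fun_op f V] is the operator f(V). *)
Definition fun_op (f : R[i] -> R[i]) V : H -> H :=
  xget (id : H -> H) [set T | exists2 Phi, functional_calculus V Phi & T = Phi f].

End Operators.

(* Main.v *)
Require Import Defs.
From HB Require Import structures.
From mathcomp Require Import all_boot all_order all_algebra sesquilinear complex.
From mathcomp Require Import all_classical all_reals all_analysis.
From mathcomp Require Import ring lra zify.

(* Let [V_k = e^(ikA) U], [D g = \sum_k (-1)^k 'C(m, k) g(V_k)] and [s] the norm
   of [A].

   If [g] is a trigonometric polynomial of degree [d], then
   [t |-> g(e^(itA) U)] extends to an entire operator-valued function, and von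
   Neumann's inequality bounds it by a constant times
   [e^(3 d s |t|) * sup |g|]. Since [D] annihilates the Taylor coefficients of
   order less than [m], Cauchy's estimate on a circle of radius about [1 / (d s)]
   gives the Bernstein-type bound [|D g| <= C (d s)^m sup |g|].

   By Jackson's theorem, [f] lies within [C 2^(-i alpha) |f|] of a trigonometric
   polynomial [p_i] of degree at most [C 2^i], [p_0] being constant. For
   [2^I ~ 1 / s] the bound above, applied to [p_(i+1) - p_i] for [i < I], is
   summable to [C |f| s^alpha] because [alpha < m], while contractivity of the
   functional calculus takes care of [f - p_I].

   All averages over the circle are averages over roots of unity. Von Neumann's
   inequality is proved with a constant, from the positivity of the Toeplitz
   forms [\sum_(j, l) <T^(j - l) x_l, x_j>] of a contraction [T] (with
   [T^(-k)] read as the adjoint of [T^k]). It also yields the continuous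
   functional calculus of a unitary operator, as a limit of trigonometric
   polynomials in it. *)

Set Implicit Arguments.
Unset Strict Implicit.
Unset Printing Implicit Defensive.

Import Order.TTheory GRing.Theory Num.Theory.
Import numFieldNormedType.Exports.

Local Open Scope classical_set_scope.
Local Open Scope ring_scope.

(** * Real-valued norms, the circle and roots of unity *)

(** The operators [e^(ikA) U] do not commute in general, so no joint functional calculus reduces the
    alternating sum to a scalar estimate. What remains is analyticity in [t]. For its sake the
    negative powers of [e^(itA) U] are written with the inverse [U^(-1) e^(-itA)], since the adjoint
    would depend on the conjugate of [t]. Off the real axis [e^(itA) U] is only bounded by
    [e^(s |t|)], hence a von Neumann inequality for multiples of contractions; the radius
    [1 / (d s)] is the one at which this growth costs a mere constant.

    The order [n] of the differences defining the class and the order [m] of the theorem need not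
    agree: [n] enters only through Jackson's theorem, stated for every [n], while [m] also fixes the
    power of the kernel used there.

    Before Jackson's theorem [f] is replaced by a trigonometric polynomial [q] within an arbitrary
    [e > 0]. All later averages then act on finitely many coefficients, where sums over sufficiently
    many roots of unity are exact, and since the degree of [q] enters no bound, [e] can tend to
    0. *)

Section RealNorm.
Context {R : realType}.

Lemma rnormE (V : normedZmodType R[i]) (x : V) : `|x| = (rnorm x)%:C%C.
Proof. by rewrite /rnorm RRe_real // ger0_real. Qed.

Lemma rnorm_ge0 (V : normedZmodType R[i]) (x : V) : 0 <= rnorm x.
Proof. by rewrite -lecR -rnormE normr_ge0. Qed.

Lemma rnormD (V : normedZmodType R[i]) (x y : V) :
  rnorm (x + y) <= rnorm x + rnorm y.
Proof. by rewrite -lecR rmorphD /= -!rnormE ler_normD. Qed.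

Lemma rnormN (V : normedZmodType R[i]) (x : V) : rnorm (- x) = rnorm x.
Proof. by rewrite /rnorm normrN. Qed.

Lemma rnormC (V : normedZmodType R[i]) (x y : V) : rnorm (x - y) = rnorm (y - x).
Proof. by rewrite /rnorm distrC. Qed.

Lemma rnormB (V : normedZmodType R[i]) (x y : V) :
  rnorm (x - y) <= rnorm x + rnorm y.
Proof. by rewrite -(rnormN y) rnormD. Qed.

Lemma rnorm0 (V : normedZmodType R[i]) : rnorm (0 : V) = 0.
Proof. by rewrite /rnorm normr0. Qed.

Lemma rnorm_eq0 (V : normedZmodType R[i]) (x : V) : (rnorm x == 0) = (x == 0).
Proof. by rewrite -[RHS]normr_eq0 rnormE -(inj_eq (@complexI R)). Qed.

Lemma rnorm_sum (V : normedZmodType R[i]) (I : Type) (r : seq I) (P : pred I)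
    (F : I -> V) :
  rnorm (\sum_(i <- r | P i) F i) <= \sum_(i <- r | P i) rnorm (F i).
Proof.
elim/big_rec2: _ => [|i y x _ le_xy]; first by rewrite rnorm0.
by apply: le_trans (rnormD _ _) _; rewrite lerD2l.
Qed.

Lemma rnormZ (V : normedModType R[i]) (a : R[i]) (x : V) :
  rnorm (a *: x) = rnorm a * rnorm x.
Proof. by apply: (@complexI R); rewrite rmorphM /= -!rnormE normrZ. Qed.

Lemma rnormM (a b : R[i]) : rnorm (a * b) = rnorm a * rnorm b.
Proof. by apply: (@complexI R); rewrite rmorphM /= -!rnormE normrM. Qed.

Lemma rnorm1 : rnorm (1 : R[i]) = 1.
Proof. by rewrite /rnorm normr1. Qed.

Lemma rnormX (a : R[i]) n : rnorm (a ^+ n) = rnorm a ^+ n.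
Proof. by elim: n => [|n IH]; rewrite ?rnorm1 // !exprS rnormM IH. Qed.

Lemma rnormV (a : R[i]) : rnorm a^-1 = (rnorm a)^-1.
Proof. by apply: (@complexI R); rewrite -rnormE normfV rnormE fmorphV. Qed.

Lemma rnorm_real (a : R) : rnorm a%:C%C = `|a|.
Proof. by rewrite /rnorm normc_def /= expr0n /= addr0 sqrtr_sqr. Qed.

Lemma rnorm_nat n : rnorm (n%:R : R[i]) = n%:R.
Proof. by rewrite -[n%:R](rmorph_nat (real_complex R)) rnorm_real normr_nat. Qed.

Lemma rnorm_sign n : rnorm ((-1) ^+ n : R[i]) = 1.
Proof. by rewrite rnormX rnormN rnorm1 expr1n. Qed.

Lemma rnorm_conj (a : R[i]) : rnorm (a^* : R[i]) = rnorm a.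
Proof. by rewrite /rnorm norm_conjC. Qed.

Lemma rnorm_i : rnorm ('i : R[i]) = 1.
Proof. by rewrite /rnorm normCi. Qed.

Lemma mulC_conj (a : R[i]) : a * a^* = (rnorm a ^+ 2)%:C%C.
Proof. by rewrite -normCK rnormE rmorphXn. Qed.

Lemma rnorm_le_Re_Im (a : R[i]) : rnorm a <= `|complex.Re a| + `|complex.Im a|.
Proof.
rewrite {1}[a]complexE; apply: le_trans (rnormD _ _) _.
by rewrite rnormM !rnorm_real complexiE rnorm_i mul1r.
Qed.

Lemma circleP (z : R[i]) : circle R z <-> rnorm z = 1.
Proof.
rewrite /circle /= rnormE; split=> [/(congr1 (@complex.Re R))//|->//].
Qed.

Lemma circle_conj (z : R[i]) : circle R z -> circle R z^*.
Proof. by move=> /circleP zn; apply/circleP; rewrite rnorm_conj. Qed.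

Lemma circleX (z : R[i]) n : circle R z -> circle R (z ^+ n).
Proof. by move=> /circleP zn; apply/circleP; rewrite rnormX zn expr1n. Qed.

Lemma circleM (z w : R[i]) : circle R z -> circle R w -> circle R (z * w).
Proof.
by move=> /circleP zn /circleP wn; apply/circleP; rewrite rnormM zn wn mulr1.
Qed.

Lemma circle1 : circle R (1 : R[i]).
Proof. by apply/circleP; rewrite rnorm1. Qed.

Lemma circle_mulC (z : R[i]) : circle R z -> z * z^* = 1.
Proof. by move=> /circleP zn; rewrite mulC_conj zn expr1n. Qed.

End RealNorm.

Section RootsOfUnity.
Context {R : realType}.

(** Algebraic closedness supplies the root without trigonometry: [X^M - 1] is separable in
    characteristic 0, and [M] distinct [M]-th roots of unity include a primitive one. *)
Lemma prim_root_exists M : (0 < M)%N -> exists w : R[i], M.-primitive_root w.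
Proof.
move=> M_gt0; have [r Dp] := closed_field_poly_normal ('X^M - 1 : {poly R[i]}).
rewrite (monicP _) ?monicXnsubC // scale1r in Dp.
have rM : all M.-unity_root r by apply/allP=> z; rewrite -root_prod_XsubC -Dp.
have sz_r : (M < (size r).+1)%N.
  by rewrite -(size_prod_XsubC r id) -Dp size_XnsubC.
have [|z zr zP] := hasP (cyclic.has_prim_root M_gt0 rM _ sz_r); last by exists z.
rewrite -separable.separable_prod_XsubC -Dp.
by apply: cyclotomic.separable_Xn_sub_1; rewrite pnatr_eq0 -lt0n.
Qed.

Context {M : nat} {w : R[i]} (wP : M.-primitive_root w).

Lemma prim_root_circle : circle R w.
Proof.
apply/circleP; apply: (@pexpIrn _ M).
- exact: prim_order_gt0 wP.
- by rewrite nnegrE rnorm_ge0.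
- by rewrite nnegrE.
by rewrite -rnormX prim_expr_order // rnorm1 expr1n.
Qed.

(** Discrete orthogonality of characters, the substitute for integrals over the circle: a geometric
    sum of ratio [w^(a - b)], the conjugates carrying the negative exponents. *)
Lemma sum_prim_root a b :
  \sum_(i < M) (w ^+ i) ^+ a * ((w ^+ i)^*) ^+ b
  = if (a == b %[mod M])%N then M%:R else 0.
Proof.
pose x := w ^+ a * w^* ^+ b.
have -> : \sum_(i < M) (w ^+ i) ^+ a * ((w ^+ i)^*) ^+ b = \sum_(i < M) x ^+ i.
  apply: eq_bigr => i _; rewrite /x exprMn rmorphXn /= -!exprM.
  by rewrite [(a * i)%N]mulnC [(b * i)%N]mulnC.
have wc := circle_mulC prim_root_circle.
have wb : w ^+ b * w^* ^+ b = 1 by rewrite -exprMn wc expr1n.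
have x1 : (x == 1) = (a == b %[mod M])%N.
  rewrite -(eq_prim_root_expr wP); apply/eqP/eqP => [x1|ab].
    by rewrite -[RHS]mul1r -x1 /x -mulrA [_ ^* ^+ b * _]mulrC wb mulr1.
  by rewrite /x ab wb.
have xM : x ^+ M = 1.
  have -> : x ^+ M = (w ^+ M) ^+ a * ((w ^+ M)^*) ^+ b.
    by rewrite /x rmorphXn /= exprMn -!exprM [(a * M)%N]mulnC [(b * M)%N]mulnC.
  by rewrite (prim_expr_order wP) rmorph1 !expr1n mulr1.
rewrite -x1; case: eqP => [->|/eqP x_neq1].
  under eq_bigr do rewrite expr1n.
  by rewrite sumr_const card_ord.
have : (x - 1) * \sum_(i < M) x ^+ i = 0 by rewrite -subrX1 xM subrr.
by move/eqP; rewrite mulf_eq0 subr_eq0 (negPf x_neq1) => /eqP.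
Qed.

End RootsOfUnity.

(** * Polynomials in a linear map, positive semidefinite forms *)

Section LinearMaps.
Context {K : pzRingType} {U V W : lmodType K}.
Implicit Types (T : U -> V) (S : V -> W).

Lemma linear_map0 T : linear T -> T 0 = 0.
Proof.
move=> lT; pose f := GRing.isLinear.Build _ _ _ _ T lT.
by pose g : {linear U -> V} := HB.pack T f; exact: (linear0 g).
Qed.

Lemma linear_mapD T : linear T -> {morph T : x y / x + y}.
Proof.
move=> lT; pose f := GRing.isLinear.Build _ _ _ _ T lT.
by pose g : {linear U -> V} := HB.pack T f; exact: (linearD g).
Qed.

Lemma linear_mapB T : linear T -> {morph T : x y / x - y}.
Proof.
move=> lT; pose f := GRing.isLinear.Build _ _ _ _ T lT.
by pose g : {linear U -> V} := HB.pack T f; exact: (linearB g).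
Qed.

Lemma linear_mapZ T a x : linear T -> T (a *: x) = a *: T x.
Proof. by move=> lT; rewrite -[a *: x]addr0 lT linear_map0 // addr0. Qed.

Lemma linear_map_sum T I (r : seq I) (P : pred I) (F : I -> U) : linear T ->
  T (\sum_(i <- r | P i) F i) = \sum_(i <- r | P i) T (F i).
Proof.
move=> lT; pose f := GRing.isLinear.Build _ _ _ _ T lT.
by pose g : {linear U -> V} := HB.pack T f; exact: (linear_sum g).
Qed.

Lemma linear_comp S T : linear S -> linear T -> linear (S \o T).
Proof. by move=> lS lT a x y; rewrite /= lT lS. Qed.

End LinearMaps.

Lemma linear_id (K : pzRingType) (U : lmodType K) : linear (id : U -> U).
Proof. by []. Qed.

Lemma linear_iter (K : pzRingType) (U : lmodType K) (T : U -> U) n :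
  linear T -> linear (iter n T).
Proof. by move=> lT; elim: n => // n IH; exact: linear_comp. Qed.

Lemma linear_lincomb (K : comPzRingType) (U V : lmodType K) (c : nat -> K)
    (F : nat -> U -> V) n : (forall k, linear (F k)) ->
  linear (fun x => \sum_(k < n) c k *: F k x).
Proof.
move=> lF a x y; rewrite scaler_sumr -big_split /=; apply: eq_bigr => k _.
by rewrite lF scalerDr !scalerA [_ * a]mulrC.
Qed.

Section PolyEval.
Context {K : comNzRingType} {U : lmodType K}.
Implicit Types (T : U -> U) (p r : {poly K}).

Definition peval T p (x : U) : U := \sum_(k < size p) p`_k *: iter k T x.

Lemma peval_widen T p n x : (size p <= n)%N ->
  peval T p x = \sum_(k < n) p`_k *: iter k T x.
Proof.
move=> pn; rewrite /peval (big_ord_widen n (fun k => p`_k *: iter k T x) pn).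
rewrite big_mkcond /=; apply: eq_bigr => k _.
by case: ltnP => // pk; rewrite nth_default // scale0r.
Qed.

Lemma linear_peval T p : linear T -> linear (peval T p).
Proof.
move=> lT; apply: (@linear_lincomb _ _ _ (nth 0 p) (fun k => iter k T)) => k.
exact: linear_iter.
Qed.

Lemma pevalD T p r x : peval T (p + r) x = peval T p x + peval T r x.
Proof.
pose n := maxn (size p) (size r).
rewrite !(@peval_widen _ _ n) ?leq_maxl ?leq_maxr ?(leq_trans (size_polyD _ _)) //.
by rewrite -big_split; apply: eq_bigr => k _; rewrite coefD scalerDl.
Qed.

Lemma pevalZ T a p x : peval T (a *: p) x = a *: peval T p x.
Proof.
rewrite (@peval_widen _ _ (size p)) ?size_scale_leq // scaler_sumr.
by apply: eq_bigr => k _; rewrite coefZ scalerA.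
Qed.

Lemma pevalN T p x : peval T (- p) x = - peval T p x.
Proof. by rewrite -[- p]scaleN1r pevalZ scaleN1r. Qed.

Lemma pevalB T p r x : peval T (p - r) x = peval T p x - peval T r x.
Proof. by rewrite pevalD pevalN. Qed.

Lemma peval0 T x : peval T 0 x = 0.
Proof. by rewrite /peval size_poly0 big_ord0. Qed.

Lemma peval_sum T I (s : seq I) (P : pred I) (F : I -> {poly K}) x :
  peval T (\sum_(i <- s | P i) F i) x = \sum_(i <- s | P i) peval T (F i) x.
Proof.
by elim/big_rec2: _ => [|i y p _ IH]; rewrite ?peval0 // pevalD IH.
Qed.

Lemma pevalC T a x : peval T a%:P x = a *: x.
Proof. by rewrite (@peval_widen _ _ 1) ?size_polyC_leq1 // big_ord1 coefC. Qed.

Lemma peval1 T x : peval T 1 x = x.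
Proof. by rewrite pevalC scale1r. Qed.

Lemma pevalMX T p x : linear T -> peval T (p * 'X) x = T (peval T p x).
Proof.
move=> lT; rewrite (@peval_widen _ _ (size p).+1); last first.
  by apply: leq_trans (size_polyMleq _ _) _; rewrite size_polyX addn2.
rewrite big_ord_recl coefMX scale0r add0r linear_map_sum //.
apply: eq_bigr => k _; rewrite coefMX /= (linear_mapZ _ _ lT).
by [].
Qed.

Lemma pevalM T p r x : linear T ->
  peval T (p * r) x = peval T p (peval T r x).
Proof.
move=> lT; elim/poly_ind: p => [|p c IH]; first by rewrite mul0r !peval0.
rewrite mulrDl !pevalD mul_polyC pevalZ pevalC; congr (_ + _).
by rewrite -mulrA ['X * r]mulrC mulrA !pevalMX // IH.
Qed.

Lemma pevalXn T k x : linear T -> peval T 'X^k x = iter k T x.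
Proof.
move=> lT; elim: k => [|k IH]; first by rewrite expr0 peval1.
by rewrite exprSr pevalMX // IH.
Qed.

End PolyEval.

Section PsdForms.
Context {R : realType}.

(** One structure for the inner product of [H], for the Toeplitz forms, which may be degenerate, and
    for the form on scalars that yields bounds in the disk. *)
Record psd_form (V : lmodType R[i]) (q : V -> V -> R[i]) : Prop := PsdForm {
  psdD : forall x y z, q (x + y) z = q x z + q y z;
  psdZ : forall a x z, q (a *: x) z = a * q x z;
  psdC : forall x y, q y x = (q x y)^*;
  psd_ge0 : forall x, 0 <= q x x
}.

Section Theory.
Context {V : lmodType R[i]} {q : V -> V -> R[i]} (hq : psd_form q).

Lemma psdDr x y z : q x (y + z) = q x y + q x z.
Proof. by rewrite (psdC hq) (psdC hq y) (psdC hq z) -rmorphD -psdD. Qed.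

Lemma psdZr a x z : q x (a *: z) = a^* * q x z.
Proof. by rewrite (psdC hq) (psdC hq z) -rmorphM -psdZ. Qed.

Lemma psd0 z : q 0 z = 0.
Proof. by rewrite -(scale0r 0) psdZ // mul0r. Qed.

Lemma psd0r z : q z 0 = 0.
Proof. by rewrite (psdC hq) psd0 rmorph0. Qed.

Lemma psdN x z : q (- x) z = - q x z.
Proof. by rewrite -[- x]scaleN1r psdZ // mulN1r. Qed.

Lemma psdNr x z : q x (- z) = - q x z.
Proof. by rewrite (psdC hq) psdN rmorphN /= -(psdC hq z). Qed.

Lemma psd_sum I (r : seq I) (P : pred I) (F : I -> V) z :
  q (\sum_(i <- r | P i) F i) z = \sum_(i <- r | P i) q (F i) z.
Proof. by elim/big_rec2: _ => [|i y x _ IH]; rewrite ?psd0 // psdD // IH. Qed.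

Lemma psd_sumr I (r : seq I) (P : pred I) (F : I -> V) z :
  q z (\sum_(i <- r | P i) F i) = \sum_(i <- r | P i) q z (F i).
Proof. by elim/big_rec2: _ => [|i y x _ IH]; rewrite ?psd0r // psdDr // IH. Qed.

Lemma psd_Re x : (complex.Re (q x x))%:C%C = q x x.
Proof. by rewrite RRe_real // ger0_real // psd_ge0. Qed.

Lemma psd_Re_ge0 x : 0 <= complex.Re (q x x).
Proof. by rewrite -lecR psd_Re psd_ge0. Qed.

Lemma Re_conj (a : R[i]) : complex.Re a^* = complex.Re a.
Proof. by case: a. Qed.

(** Expand the square of [c *: x - |c| *: y]. Unlike the product form of Cauchy-Schwarz, this
    additive form can be summed over a family of forms. *)
Lemma psd_amgm (c : R[i]) x y :
  2 * complex.Re (c * q x y)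
    <= rnorm c * (complex.Re (q x x) + complex.Re (q y y)).
Proof.
have [c0|c_neq0] := eqVneq c 0.
  by rewrite c0 mul0r rnorm0 mul0r mulr0.
have r_gt0 : 0 < rnorm c by rewrite lt_def rnorm_eq0 c_neq0 rnorm_ge0.
set r := rnorm c in r_gt0 *.
have := psd_Re_ge0 (c *: x - r%:C%C *: y).
have -> : q (c *: x - r%:C%C *: y) (c *: x - r%:C%C *: y)
  = (r ^+ 2)%:C%C * (q x x + q y y) - (r%:C%C * (c * q x y) + (r%:C%C * (c * q x y))^*).
  rewrite (psdD hq) !psdDr !(psdN, psdNr) !(psdZ hq) !psdZr.
  have rc : (r%:C%C)^* = r%:C%C := conjc_real r.
  have rr : r%:C%C * r%:C%C = c * c^* by rewrite mulC_conj -rmorphM.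
  rewrite (psdC hq x y) -(mulC_conj c) !rmorphM /= rc [r%:C%C * (r%:C%C * _)]mulrA rr.
  ring.
have Rr (b : R[i]) (a : R) : complex.Re (a%:C%C * b) = a * complex.Re b.
  by case: b => b1 b2 /=; rewrite mul0r subr0.
rewrite !raddfB !raddfD /= Re_conj !Rr !raddfD /=.
have -> : forall u v : R, r ^+ 2 * u + (- (r * v) - r * v) = r * (r * u - 2 * v).
  by move=> u v; ring.
by rewrite pmulr_rge0 // subr_ge0.
Qed.

End Theory.
End PsdForms.

(** * Von Neumann's inequality *)

Section VonNeumann.
Context {R : realType} {V : lmodType R[i]} {q : V -> V -> R[i]}
  (hq : psd_form q).

Definition geom (T : V -> V) N x : V := \sum_(k < N) iter k T x.

(** The Fejer kernel at [T], [\sum_(|k| < N) (N - |k|) <T^k x, y>], arranged as a sum of symmetric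
    partial sums. Negative powers act as positive ones on [y], so [T] enters without an adjoint
    operator. *)
Definition toeplitz (T : V -> V) N x y : R[i] :=
  \sum_(j < N) (q (geom T j.+1 x) y + q x (geom T j.+1 y) - q x y).

Lemma geomS T N x : linear T -> geom T N.+1 x = x + T (geom T N x).
Proof. by move=> lT; rewrite /geom big_ord_recl (@linear_map_sum _ _ _ T). Qed.

Lemma linear_geom T N : linear T -> linear (geom T N).
Proof.
move=> lT a x y; rewrite /geom scaler_sumr -big_split; apply: eq_bigr => k _.
exact: linear_iter.
Qed.

(* Telescoping: with [u_N = geom T N x], the [N]-th term of the sum is
   [q u_(N+1) u_(N+1) - q (T u_N) (T u_N)]. *)
Lemma toeplitz_ge T N x : linear T -> (forall x, q (T x) (T x) <= q x x) ->
  q (geom T N x) (geom T N x) <= toeplitz T N x x.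
Proof.
move=> lT cT; elim: N => [|N IH].
  by rewrite /geom /toeplitz !big_ord0 (psd0 hq).
rewrite /toeplitz big_ord_recr /= -/(toeplitz T N x x) geomS //.
set u := geom T N x in IH *.
have -> : q (x + T u) x + q x (x + T u) - q x x
  = q (x + T u) (x + T u) - q (T u) (T u).
  rewrite !(psdD hq) !(psdDr hq); ring.
by rewrite addrCA lerDl subr_ge0; exact: le_trans (cT u) IH.
Qed.

Lemma toeplitz_psd T N : linear T -> (forall x, q (T x) (T x) <= q x x) ->
  psd_form (toeplitz T N).
Proof.
move=> lT cT; split=> [x y z|a x z|x y|x].
- rewrite /toeplitz -big_split; apply: eq_bigr => j _ /=.
  have -> : geom T j.+1 (x + y) = geom T j.+1 x + geom T j.+1 y.
    exact: (linear_mapD (linear_geom _ lT)).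
  rewrite !(psdD hq); ring.
- rewrite /toeplitz mulr_sumr; apply: eq_bigr => j _ /=.
  have -> : geom T j.+1 (a *: x) = a *: geom T j.+1 x.
    exact: (linear_mapZ _ _ (linear_geom _ lT)).
  rewrite !(psdZ hq); ring.
- rewrite /toeplitz rmorph_sum; apply: eq_bigr => j _ /=.
  rewrite rmorphB rmorphD /= -!(psdC hq); ring.
- exact: le_trans (psd_ge0 hq _) (toeplitz_ge _ _ lT cT).
Qed.

Definition cesaro (r : {poly R[i]}) (T : V -> V) N x : V :=
  \sum_(j < N) \sum_(k < j.+1) r`_k *: iter k T x.

Lemma linear_scale_comp (a : R[i]) (T : V -> V) :
  linear T -> linear (fun x => a *: T x).
Proof. by move=> lT b x y; rewrite lT scalerDr !scalerA mulrC. Qed.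

Lemma iter_scale (a : R[i]) (T : V -> V) k x : linear T ->
  iter k (fun x => a *: T x) x = a ^+ k *: iter k T x.
Proof.
move=> lT; elim: k => [|k IH]; first by rewrite scale1r.
by rewrite !iterS IH (linear_mapZ _ _ lT) scalerA -exprS.
Qed.

(** A discrete convolution of [r] with the Fejer kernel at [T], which weights the coefficients of
    [r] as Cesaro summation does. The exponents compared in [sum1] and [sum2] stay below [N + N], so
    that many nodes exclude aliasing. *)
Lemma sum_toeplitz (r : {poly R[i]}) T N w x y : linear T ->
  (size r <= N)%N -> (N + N).-primitive_root w ->
  \sum_(i < N + N) r.[w ^+ i] * toeplitz (fun x => (w ^+ i)^* *: T x) N x y
  = (N + N)%:R * q (cesaro r T N x) y.
Proof.
move=> lT rN wP.
have hr z : r.[z] = \sum_(l < N) r`_l * z ^+ l by exact: horner_coef_wide.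
have sum1 (k : nat) : (k < N)%N ->
    \sum_(i < N + N) r.[w ^+ i] * ((w ^+ i)^*) ^+ k = (N + N)%:R * r`_k.
  move=> kN.
  under eq_bigr => i _ do rewrite hr mulr_suml.
  rewrite exchange_big /= (bigD1 (Ordinal kN)) //= [X in _ + X]big1 ?addr0.
    under eq_bigr => i _ do rewrite -mulrA.
    by rewrite -mulr_sumr (sum_prim_root wP) eqxx mulrC.
  move=> l lk; under eq_bigr => i _ do rewrite -mulrA.
  rewrite -mulr_sumr (sum_prim_root wP).
  rewrite !modn_small ?ltn_addr //; case: eqP => [lk'|]; last by rewrite mulr0.
  by move: lk; rewrite -val_eqE /= lk' eqxx.
have sum2 (k : nat) : (k < N)%N ->
    \sum_(i < N + N) r.[w ^+ i] * (w ^+ i) ^+ k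
      = if k == 0%N then (N + N)%:R * r`_0 else 0.
  move=> kN.
  have -> : \sum_(i < N + N) r.[w ^+ i] * (w ^+ i) ^+ k =
      \sum_(l < N) r`_l * \sum_(i < N + N) (w ^+ i) ^+ (l + k) * ((w ^+ i)^*) ^+ 0.
    under [LHS]eq_bigr => i _ do rewrite hr mulr_suml.
    rewrite exchange_big /=; apply: eq_bigr => l _.
    by rewrite mulr_sumr; apply: eq_bigr => i _; rewrite expr0 mulr1 exprD mulrA.
  have N_gt0 : (0 < N)%N by case: (N) kN.
  rewrite (bigD1 (Ordinal N_gt0)) //= [X in _ + X]big1 ?addr0.
    rewrite (sum_prim_root wP) add0n !modn_small ?ltn_addr // .
    by case: eqP => _; rewrite ?mulr0 // mulrC.
  move=> l l0; have lkN : (l + k < N + N)%N by rewrite -addSn leq_add // ltnW.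
  rewrite (sum_prim_root wP) !modn_small ?addn_gt0 ?N_gt0 //.
  case: eqP => [/eqP|]; last by rewrite mulr0.
  by rewrite addn_eq0 -(inj_eq val_inj) /= in l0 *; rewrite (negPf l0).
rewrite /cesaro (psd_sum hq) mulr_sumr.
under eq_bigr => i _ do rewrite /toeplitz mulr_sumr.
rewrite exchange_big /=; apply: eq_bigr => j _.
have kN (k : 'I_j.+1) : (k < N)%N := leq_ltn_trans (leq_ord k) (ltn_ord j).
have E1 : \sum_(i < N + N)
    r.[w ^+ i] * q (geom (fun x => (w ^+ i)^* *: T x) j.+1 x) y
    = (N + N)%:R * q (\sum_(k < j.+1) r`_k *: iter k T x) y.
  rewrite (psd_sum hq) mulr_sumr.
  under eq_bigr => i _ do rewrite /geom (psd_sum hq) mulr_sumr.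
  rewrite exchange_big /=; apply: eq_bigr => k _.
  under eq_bigr => i _ do rewrite iter_scale // (psdZ hq) mulrA.
  by rewrite -mulr_suml sum1 // (psdZ hq) mulrA.
(* Against nonnegative powers of [w ^+ i] only the constant coefficient of [r] survives; [E3]
   cancels it. *)
have E2 : \sum_(i < N + N)
    r.[w ^+ i] * q x (geom (fun x => (w ^+ i)^* *: T x) j.+1 y)
    = (N + N)%:R * r`_0 * q x y.
  under eq_bigr => i _ do rewrite /geom (psd_sumr hq) mulr_sumr.
  rewrite exchange_big /= big_ord_recl [X in _ + X]big1 ?addr0.
    under eq_bigr => i _ do rewrite iter_scale // (psdZr hq) mulrA rmorphXn /= conjCK.
    by rewrite -mulr_suml sum2 ?(leq_trans _ (ltn_ord j)).
  move=> k _.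
  under eq_bigr => i _ do rewrite iter_scale // (psdZr hq) mulrA rmorphXn /= conjCK.
  by rewrite -mulr_suml sum2 ?(kN (lift ord0 k)) // mul0r.
have E3 : \sum_(i < N + N) r.[w ^+ i] * q x y = (N + N)%:R * r`_0 * q x y.
  have := sum1 0%N; under eq_bigr => i _ do rewrite expr0 mulr1.
  by rewrite -mulr_suml => -> //; rewrite (leq_trans _ (ltn_ord j)).
under eq_bigr => i _ do rewrite mulrBr mulrDr.
by rewrite !sumrB big_split /= E1 E2 E3 addrK.
Qed.

(** The Toeplitz forms are positive, so the bound [K] on the circle passes through the average by
    [psd_amgm]. Their total mass is computed by the case [r = 1] of [sum_toeplitz]. *)
Lemma cesaro_bound (r : {poly R[i]}) T N K x : linear T ->
  (forall x, q (T x) (T x) <= q x x) -> (size r <= N)%N -> (0 < N)%N ->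
  0 < K -> (forall z, circle R z -> rnorm r.[z] <= K) ->
  complex.Re (q (cesaro r T N x) (cesaro r T N x))
    <= (K * N%:R) ^+ 2 * complex.Re (q x x).
Proof.
move=> lT cT rN N_gt0 K_gt0 rK.
have NN : (0 < N + N)%N by rewrite addn_gt0 N_gt0.
have [w wP] := @prim_root_exists R _ NN.
have wc i : circle R (w ^+ i) by apply: circleX; exact: prim_root_circle wP.
have lTi (i : nat) := linear_scale_comp (w ^+ i)^* lT.
have cTi (i : nat) y : q ((w ^+ i)^* *: T y) ((w ^+ i)^* *: T y) <= q y y.
  rewrite (psdZ hq) (psdZr hq) conjCK mulrA [_ ^* * _]mulrC.
  by rewrite (circle_mulC (wc i)) mul1r.
have Rn (a : R[i]) n : complex.Re (n%:R * a) = n%:R * complex.Re a.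
  by rewrite mulr_natl raddfMn /= mulr_natl.
have avg1 y : \sum_(i < N + N)
    complex.Re (toeplitz (fun x => (w ^+ i)^* *: T x) N y y)
    = (N + N)%:R * (N%:R * complex.Re (q y y)).
  have := @sum_toeplitz 1 T N w y y lT _ wP; rewrite size_poly1 => /(_ N_gt0).
  under eq_bigr => i _ do rewrite hornerC mul1r.
  move=> /(congr1 (@complex.Re R)); rewrite raddf_sum /= => ->.
  rewrite Rn; congr (_ * _).
  have -> : cesaro 1 T N y = N%:R *: y.
    rewrite /cesaro (eq_bigr (fun=> y)) => [|j _].
      by rewrite sumr_const card_ord scaler_nat.
    rewrite big_ord_recl coefC scale1r big1 ?addr0 // => k _.
    by rewrite coefC scale0r.
  by rewrite (psdZ hq) Rn.
have key y : 2 * complex.Re (q (cesaro r T N x) y)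
    <= K * N%:R * (complex.Re (q x x) + complex.Re (q y y)).
  rewrite -(ler_pM2l (_ : 0 < (N + N)%:R)) ?ltr0n //.
  have -> : (N + N)%:R * (2 * complex.Re (q (cesaro r T N x) y)) =
     \sum_(i < N + N) 2 * complex.Re
        (r.[w ^+ i] * toeplitz (fun x => (w ^+ i)^* *: T x) N x y).
    have := sum_toeplitz x y lT rN wP => /(congr1 (@complex.Re R)).
    by rewrite raddf_sum /= Rn -mulr_sumr => ->; ring.
  have -> : (N + N)%:R * (K * N%:R * (complex.Re (q x x) + complex.Re (q y y)))
    = \sum_(i < N + N) K *
      (complex.Re (toeplitz (fun x => (w ^+ i)^* *: T x) N x x)
       + complex.Re (toeplitz (fun x => (w ^+ i)^* *: T x) N y y)).
    by rewrite -mulr_sumr big_split /= !avg1; ring.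
  apply: ler_sum => i _.
  have tP := toeplitz_psd N (lTi i) (cTi i).
  apply: le_trans (psd_amgm tP _ _ _) _.
  by rewrite ler_wpM2r ?rK // addr_ge0 // psd_Re_ge0.
set F := cesaro r T N x in key *.
have c_gt0 : 0 < K * N%:R by rewrite mulr_gt0 // ltr0n.
set c := K * N%:R in key c_gt0 *.
(* The multiple of [F] that optimises the additive inequality into [|F|^2 <= c^2 |x|^2]. *)
have := key ((c^-1)%:C%C *: F).
have -> : q F ((c^-1)%:C%C *: F) = (c^-1)%:C%C * q F F.
  by rewrite (psdZr hq); congr (_ * _); exact: conjc_real.
have -> : q ((c^-1)%:C%C *: F) ((c^-1)%:C%C *: F) = (c^-2)%:C%C * q F F.
  rewrite (psdZ hq) (psdZr hq) mulrA; congr (_ * _).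
  have -> : ((c^-1)%:C%C)^* = (c^-1)%:C%C := conjc_real c^-1.
  by rewrite -rmorphM -invfM.
have Rr (b : R[i]) (a : R) : complex.Re (a%:C%C * b) = a * complex.Re b.
  by case: b => b1 b2 /=; rewrite mul0r subr0.
rewrite !Rr; set a := complex.Re (q F F); set b := complex.Re (q x x) => h.
have -> : a = c * (2 * (c^-1 * a) - c * (c ^- 2 * a)).
  by field; rewrite gt_eqF.
rewrite [c ^+ 2 * b](_ : _ = c * (c * b)); last by ring.
by rewrite ler_pM2l // lerBlDr -mulrDr.
Qed.

(* Differences of Cesaro sums recover [r(T)] itself, at the price of a
   constant. *)
Lemma von_neumann (r : {poly R[i]}) T K x : linear T ->
  (forall x, q (T x) (T x) <= q x x) ->
  0 < K -> (forall z, circle R z -> rnorm r.[z] <= K) ->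
  complex.Re (q (peval T r x) (peval T r x))
    <= (4 * K) ^+ 2 * complex.Re (q x x).
Proof.
move=> lT cT K_gt0 rK; pose n := (size r).+1.
have rn : (size r <= n)%N by [].
have rnn : (size r <= n + n)%N by rewrite (leq_trans rn) ?leq_addr.
(* De la Vallee Poussin's device: [n] exceeds the degree, so each of the [n] partial sums by which
   the two Cesaro sums differ is [r(T)] itself. *)
have e : n%:R *: peval T r x = cesaro r T (n + n) x - cesaro r T n x.
  rewrite /cesaro big_split_ord /= addrAC subrr add0r.
  rewrite (eq_bigr (fun=> peval T r x)) ?sumr_const ?card_ord ?scaler_nat //.
  by move=> j _; rewrite -peval_widen // (leq_trans rn) // ltnW // ltnS leq_addr.
have n_gt0 : 0 < n%:R :> R by rewrite ltr0n.
rewrite -(ler_pM2l (exprn_gt0 2 n_gt0)).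
have -> : n%:R ^+ 2 * complex.Re (q (peval T r x) (peval T r x))
  = complex.Re (q (n%:R *: peval T r x) (n%:R *: peval T r x)).
  rewrite (psdZ hq) (psdZr hq) mulrA rmorph_nat -natrM !mulr_natl raddfMn /=.
  by rewrite -natrX mulr_natl mulnn.
rewrite e; set a := cesaro _ _ _ _; set b := cesaro _ _ _ _.
(* The parallelogram law costs a factor 2, and [2 * (2^2 + 1^2) = 10 <= 4^2] is the origin of the
   constant 4. *)
have ab : complex.Re (q (a - b) (a - b))
    <= 2 * complex.Re (q a a) + 2 * complex.Re (q b b).
  have := psd_Re_ge0 hq (a + b); rewrite !(psdD hq) !(psdDr hq).
  rewrite !(psdN hq) !(psdNr hq) !raddfD /= !raddfN /=; lra.
apply: le_trans ab _.
have ha := cesaro_bound x lT cT rnn isT K_gt0 rK.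
have hb := cesaro_bound x lT cT rn isT K_gt0 rK.
have x_ge0 := psd_Re_ge0 hq x.
rewrite -/a -/b in ha hb; rewrite natrD in ha.
set X := complex.Re (q x x) in ha hb x_ge0 *.
have P : 0 <= (n%:R * K) ^+ 2 * X by rewrite mulr_ge0 // sqr_ge0.
nra.
Qed.

End VonNeumann.

Section HilbertForm.
Context {R : realType} {H : hilbertType R}.
Implicit Types (x y z : H) (T : H -> H).

Lemma inner_psd : psd_form (inner H).
Proof.
split=> [x y z|a x z|x y|x].
- by rewrite linearDl.
- by rewrite linearZl_LR.
- by rewrite (hermC (inner H)) expr0 mul1r.
- by rewrite inner_normE exprn_ge0.
Qed.

Lemma inner_rnorm x : inner H x x = (rnorm x ^+ 2)%:C%C.
Proof. by rewrite inner_normE rnormE rmorphXn. Qed.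

Lemma Re_inner x : complex.Re (inner H x x) = rnorm x ^+ 2.
Proof. by rewrite inner_rnorm. Qed.

Lemma inner_le x y : (inner H x x <= inner H y y) = (rnorm x <= rnorm y).
Proof. by rewrite !inner_rnorm lecR ler_sqr ?nnegrE ?rnorm_ge0. Qed.

Lemma cauchy_schwarz x y : rnorm (inner H x y) <= rnorm x * rnorm y.
Proof.
have am u v : 2 * rnorm (inner H u v) <= rnorm u ^+ 2 + rnorm v ^+ 2.
  have [->|n0] := eqVneq (rnorm (inner H u v)) 0.
    by rewrite mulr0 addr_ge0 // sqr_ge0.
  have := psd_amgm inner_psd (inner H u v)^* u v.
  rewrite [_ ^* * _]mulrC mulC_conj /= rnorm_conj !Re_inner.
  by rewrite expr2 mulrCA ler_pM2l // lt_def n0 rnorm_ge0.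
have [->|x0] := eqVneq x 0.
  by rewrite (psd0 inner_psd) !rnorm0 mul0r.
have [->|y0] := eqVneq y 0.
  by rewrite (psd0r inner_psd) !rnorm0 mulr0.
have xy : 0 < rnorm x * rnorm y by rewrite mulr_gt0 // lt_def rnorm_ge0 rnorm_eq0 ?x0 ?y0.
(* Both vectors are rescaled to the norm [|x| |y|], where arithmetic and geometric means agree. *)
have := am ((rnorm y)%:C%C *: x) ((rnorm x)%:C%C *: y).
rewrite (psdZ inner_psd) (psdZr inner_psd) !rnormM !rnormZ rnorm_conj !rnorm_real.
rewrite !ger0_norm ?rnorm_ge0 //; nra.
Qed.

Lemma peval_contraction (r : {poly R[i]}) T (K : R) x : linear T ->
  (forall x, rnorm (T x) <= rnorm x) ->
  0 < K -> (forall z : R[i], circle R z -> rnorm r.[z] <= K) ->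
  rnorm (peval T r x) <= 4 * K * rnorm x.
Proof.
move=> lT cT K_gt0 rK.
have cT' z : inner H (T z) (T z) <= inner H z z by rewrite inner_le.
have := von_neumann inner_psd x lT cT' K_gt0 rK.
rewrite !Re_inner -exprMn ler_sqr // nnegrE ?rnorm_ge0 // mulr_ge0 ?rnorm_ge0 //.
by rewrite mulr_ge0 // ltW.
Qed.

End HilbertForm.

Section ScaledVonNeumann.
Context {R : realType}.

(* The scalar case: [w] acts by multiplication on the one-dimensional space. *)
Lemma horner_disk_bound (r : {poly R[i]}) (K : R) (w : R[i]) :
  0 < K -> (forall z : R[i], circle R z -> rnorm r.[z] <= K) -> rnorm w <= 1 ->
  rnorm r.[w] <= 4 * K.
Proof.
move=> K_gt0 rK w1.
pose q (x y : R[i]^o) : R[i] := (x : R[i]) * (y : R[i])^*.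
have hq : psd_form q.
  split=> [x y z|a x z|x y|x]; rewrite /q.
  - by rewrite mulrDl.
  - by rewrite -mulrA.
  - by rewrite rmorphM /= conjCK mulrC.
  - by rewrite mulC_conj -(rmorph0 (real_complex R)) lecR sqr_ge0.
pose T (x : R[i]^o) : R[i]^o := w *: x.
have lT : linear T by move=> a x y; rewrite /T scalerDr !scalerA mulrC.
have cT x : q (T x) (T x) <= q x x.
  rewrite /q !mulC_conj lecR ler_sqr ?nnegrE ?rnorm_ge0 // rnormM.
  by rewrite ler_piMl ?rnorm_ge0.
have := von_neumann hq (1 : R[i]) lT cT K_gt0 rK.
have -> : peval T r (1 : R[i]) = r.[w].
  rewrite horner_coef; apply: eq_bigr => k _; congr (_ * _).
  elim: (nat_of_ord k) => [|n IH]; first by rewrite expr0.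
  by rewrite iterS IH exprS.
rewrite /q !mulC_conj /= rnorm1 expr1n mulr1 ler_sqr // nnegrE ?rnorm_ge0 //.
by rewrite mulr_ge0 // ltW.
Qed.

(* Apply the bound in the disk to the reversed polynomial. *)
Lemma horner_circle_scale (r : {poly R[i]}) (K : R) d (rho : R) (z : R[i]) :
  0 < K -> (forall z : R[i], circle R z -> rnorm r.[z] <= K) -> (size r <= d.+1)%N ->
  1 <= rho -> circle R z -> rnorm r.[rho%:C%C * z] <= 4 * K * rho ^+ d.
Proof.
move=> K_gt0 rK rd rho1 zc.
have rev (u : R[i]) : u != 0 ->
    r.[u] = u ^+ d * (\poly_(i < d.+1) r`_(d - i)).[u^-1].
  move=> u0; rewrite horner_poly (horner_coef_wide _ rd) mulr_sumr.
  rewrite (reindex_inj rev_ord_inj) /=; apply: eq_bigr => i _.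
  have id : (i <= d)%N := leq_ord i.
  rewrite subSS mulrCA exprVn; congr (_ * _).
  by rewrite -expfB_cond // (negPf u0).
have rho_gt0 : 0 < rho := lt_le_trans ltr01 rho1.
have z0 : z != 0 by rewrite -rnorm_eq0 (proj1 (circleP z) zc) oner_eq0.
have rho0 : rho%:C%C != 0 by rewrite -rnorm_eq0 rnorm_real normr_eq0 gt_eqF.
rewrite rev ?mulf_neq0 // rnormM mulrC rnormX rnormM rnorm_real.
rewrite (proj1 (circleP z) zc) mulr1 gtr0_norm // ler_pM2r ?exprn_gt0 //.
apply: horner_disk_bound => // [u uc|].
  have u0 : u != 0 by rewrite -rnorm_eq0 (proj1 (circleP u) uc) oner_eq0.
  have := rev u^-1; rewrite invr_eq0 invrK => /(_ u0) /(congr1 (@rnorm R _)).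
  rewrite rnormM rnormX rnormV (proj1 (circleP u) uc) invr1 expr1n mul1r => <-.
  by apply: rK; apply/circleP; rewrite rnormV (proj1 (circleP u) uc) invr1.
rewrite rnormV rnormM rnorm_real (proj1 (circleP z) zc) mulr1 gtr0_norm //.
by rewrite invf_le1.
Qed.

Context {H : hilbertType R}.

(** [T / rho] is a contraction, and [r (rho z)] is at most [4 * K * rho ^+ d] on the circle; a
    second factor 4 comes from von Neumann's inequality. *)
Lemma peval_bound (r : {poly R[i]}) (T : H -> H) (K : R) d (rho : R) x : linear T ->
  (forall x, rnorm (T x) <= rho * rnorm x) -> 1 <= rho ->
  0 < K -> (forall z : R[i], circle R z -> rnorm r.[z] <= K) -> (size r <= d.+1)%N ->
  rnorm (peval T r x) <= 16 * K * rho ^+ d * rnorm x.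
Proof.
move=> lT cT rho1 K_gt0 rK rd.
have rho_gt0 : 0 < rho := lt_le_trans ltr01 rho1.
have rho0 : rho%:C%C != 0 :> R[i] by rewrite -rnorm_eq0 rnorm_real normr_eq0 gt_eqF.
pose T' y : H := (rho%:C%C)^-1 *: T y.
pose r' := \poly_(i < d.+1) (r`_i * rho%:C%C ^+ i).
have -> : peval T r x = peval T' r' x.
  rewrite (peval_widen _ _ rd) (peval_widen _ _ (size_poly _ _)).
  apply: eq_bigr => k _; rewrite coef_poly ltn_ord iter_scale // scalerA exprVn.
  by rewrite mulfK // expf_neq0.
have -> : 16 * K * rho ^+ d = 4 * (4 * K * rho ^+ d) by ring.
apply: peval_contraction => [||| z zc].
- exact: linear_scale_comp.
- move=> y; rewrite /T' rnormZ rnormV rnorm_real gtr0_norm //.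
  by rewrite mulrC ler_pdivrMr // mulrC.
- by rewrite !mulr_gt0 // exprn_gt0.
have -> : r'.[z] = r.[rho%:C%C * z].
  rewrite horner_poly (horner_coef_wide _ rd); apply: eq_bigr => k _.
  by rewrite exprMn mulrA.
exact: horner_circle_scale.
Qed.

End ScaledVonNeumann.

(** * Cauchy estimates for binomial differences *)

Section AlternatingPowerSums.
Context {K : comNzRingType}.

(* Apply [X * d/dX] [j] times to the binomial expansion of [(1 - X)^m]. *)
Lemma alternating_power_poly m j : (j <= m)%N -> exists g : {poly K},
  \sum_(k < m.+1) ((-1) ^+ k * 'C(m, k)%:R * k%:R ^+ j) *: 'X^k
  = (1 - 'X) ^+ (m - j) * g.
Proof.
elim: j => [_|j IH jm].
  exists 1; rewrite subn0 mulr1 exprBn; apply: eq_bigr => k _.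
  have -> : (-1) ^+ k = ((-1) ^+ k)%:P :> {poly K} by rewrite rmorph_sign.
  by rewrite expr0 mulr1 expr1n mulr1 mul_polyC scalerMnl mulr_natr.
have [g Dg] := IH (ltnW jm); pose f : {poly K} := (1 - 'X) ^+ (m - j.+1).
have e : (m - j = (m - j.+1).+1)%N by rewrite subnSK.
exists ('X * ((1 - 'X) * g^`() - g *+ (m - j))).
have -> : \sum_(k < m.+1) ((-1) ^+ k * 'C(m, k)%:R * k%:R ^+ j.+1) *: 'X^k
   = 'X * (\sum_(k < m.+1) ((-1) ^+ k * 'C(m, k)%:R * k%:R ^+ j) *: 'X^k)^`() :> {poly K}.
  rewrite raddf_sum mulr_sumr /=; apply: eq_bigr => k _.
  rewrite derivZ derivXn -scalerAr; case: (nat_of_ord k) => [|n].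
    by rewrite mulr0n mulr0 exprS mul0r mulr0 scale0r scaler0.
  have -> : 'X * ('X^(n.+1.-1) *+ n.+1) = 'X^(n.+1) *+ n.+1 :> {poly K}.
    by rewrite mulrnAr -exprS.
  by rewrite [n.+1%:R ^+ j.+1]exprSr mulrA -scalerA scaler_nat.
rewrite Dg derivM deriv_exp derivB derivX derivC sub0r e /= -/f exprS -/f.
rewrite [RHS]mulrCA; congr (_ * _).
rewrite mulN1r mulNrn mulNr addrC mulrBr; congr (_ - _).
  by rewrite [_ * f]mulrC mulrA.
by rewrite mulrnAl mulrnAr.
Qed.

(** At [X = 1] the factor [(1 - X)^(m - j)] vanishes. This is the vanishing of the [m]-th finite
    difference on monomials of lower degree. *)
Lemma alternating_power_sum m j : (j < m)%N ->
  \sum_(k < m.+1) ((-1) ^+ k * 'C(m, k)%:R * k%:R ^+ j) = 0 :> K.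
Proof.
move=> jm; have [g] := alternating_power_poly (ltnW jm).
move=> /(congr1 (fun p => p.[1])); rewrite horner_sum hornerM horner_exp.
rewrite !hornerE subrr expr0n subn_eq0 leqNgt jm mul0r => {2}<-.
by apply: eq_bigr => k _; rewrite !hornerE expr1n mulr1.
Qed.

End AlternatingPowerSums.

Section VectorPolynomials.
Context {R : realType} {H : normedModType R[i]}.
Implicit Types (u : R[i] -> H).

(** The degree and the coefficients stay existential because the estimates drawn from such a
    representation do not depend on the degree. *)
Definition polyfun u := exists n (c : nat -> H),
  forall t, u t = \sum_(j < n) t ^+ j *: c j.

Lemma polyfun_cst x : polyfun (fun=> x).
Proof. by exists 1%N, (fun=> x) => t; rewrite big_ord1 scale1r. Qed.

Lemma polyfunD u v : polyfun u -> polyfun v -> polyfun (fun t => u t + v t).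
Proof.
move=> [n [c cE]] [n' [c' cE']].
exists (maxn n n'), (fun j => (if (j < n)%N then c j else 0)
  + (if (j < n')%N then c' j else 0)) => t.
under eq_bigr => j _ do rewrite scalerDr.
rewrite big_split /= cE cE'; congr (_ + _).
  rewrite (big_ord_widen _ (fun j => t ^+ j *: c j) (leq_maxl n n')) big_mkcond.
  by apply: eq_bigr => j _; case: ifP; rewrite // scaler0.
rewrite (big_ord_widen _ (fun j => t ^+ j *: c' j) (leq_maxr n n')) big_mkcond.
by apply: eq_bigr => j _; case: ifP; rewrite // scaler0.
Qed.

Lemma polyfun_sum (I : Type) (r : seq I) (P : pred I) (F : I -> R[i] -> H) :
  (forall i, polyfun (F i)) -> polyfun (fun t => \sum_(i <- r | P i) F i t).
Proof.
move=> pF; elim: r => [|i r IH].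
  have -> : (fun t => \sum_(i <- [::] | P i) F i t) = (fun=> 0).
    by apply/funext => t; rewrite big_nil.
  exact: polyfun_cst.
have -> : (fun t => \sum_(i <- i :: r | P i) F i t) =
    (fun t => (if P i then F i t else 0) + \sum_(i <- r | P i) F i t).
  by apply/funext => t; rewrite big_cons; case: (P i); rewrite ?add0r.
by apply: polyfunD => //; case: (P i) => //; exact: polyfun_cst.
Qed.

Lemma polyfun_linear (T : H -> H) u : linear T -> polyfun u ->
  polyfun (fun t => T (u t)).
Proof.
move=> lT [n [c cE]]; exists n, (fun j => T (c j)) => t.
rewrite cE (linear_map_sum _ _ _ lT); apply: eq_bigr => j _.
by rewrite (linear_mapZ _ _ lT).
Qed.

Lemma polyfunX k u : polyfun u -> polyfun (fun t => t ^+ k *: u t).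
Proof.
move=> [n [c cE]].
exists (k + n)%N, (fun j => if (j < k)%N then 0 else c (j - k)%N) => t.
rewrite big_split_ord /= big1 ?add0r => [|j _]; last first.
  by rewrite ltn_ord scaler0.
rewrite cE scaler_sumr; apply: eq_bigr => j _.
by rewrite ltnNge leq_addr /= addKn scalerA exprD.
Qed.

(** The average of [t^(-j) u(t)] over [n] equidistant points of the circle [|t| = rho] is exactly
    [c j], the degree being below [n]. *)
Lemma cauchy_coef n (c : nat -> H) (rho K : R) j : 0 < rho ->
  (forall t, rnorm t = rho -> rnorm (\sum_(j < n) t ^+ j *: c j) <= K) ->
  (j < n)%N -> rnorm (c j) <= K / rho ^+ j.
Proof.
move=> rho_gt0 uK jn; have n_gt0 : (0 < n)%N by case: (n) jn.
have [w wP] := @prim_root_exists R _ n_gt0.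
have wc i : rnorm (w ^+ i) = 1.
  by apply/circleP/circleX; exact: prim_root_circle wP.
rewrite ler_pdivlMr ?exprn_gt0 //.
have nR : 0 < n%:R :> R by rewrite ltr0n.
rewrite -(ler_pM2l nR).
have -> : n%:R * (rnorm (c j) * rho ^+ j) = rnorm ((n%:R * rho%:C%C ^+ j) *: c j).
  by rewrite rnormZ rnormM rnorm_nat rnormX rnorm_real gtr0_norm // -mulrA [_ * rho ^+ j]mulrC.
have -> : (n%:R * rho%:C%C ^+ j) *: c j = \sum_(i < n) ((w ^+ i)^*) ^+ j *:
    \sum_(k < n) (rho%:C%C * w ^+ i) ^+ k *: c k.
  under [RHS]eq_bigr => i _ do rewrite scaler_sumr.
  rewrite exchange_big /= (bigD1 (Ordinal jn)) //= [X in _ + X]big1 ?addr0 => [|k kj].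
    under [RHS]eq_bigr => i _ do rewrite scalerA exprMn mulrCA [_ ^+ j * (w ^+ i) ^+ j]mulrC.
    by rewrite -scaler_suml -mulr_sumr (sum_prim_root wP) eqxx mulrC.
  under eq_bigr => i _ do rewrite scalerA exprMn mulrCA [_ ^+ j * (w ^+ i) ^+ k]mulrC.
  rewrite -scaler_suml -mulr_sumr (sum_prim_root wP) !modn_small //.
  case: eqP => [e|]; last by rewrite mulr0 scale0r.
  by move: kj; rewrite -val_eqE /= e eqxx.
apply: le_trans (rnorm_sum _ _ _) _.
apply: (@le_trans _ _ (\sum_(i < n) K)); last by rewrite sumr_const card_ord mulr_natl.
apply: ler_sum => i _; rewrite rnormZ rnormX rnorm_conj wc expr1n mul1r.
by apply: uK; rewrite rnormM wc rnorm_real gtr0_norm // mulr1.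
Qed.

Lemma geometric_tail_le (x : R) m n : 0 <= x -> x <= 2^-1 ->
  \sum_(j < n | (m <= j)%N) x ^+ j <= 2 * x ^+ m.
Proof.
move=> x0 x2.
(* The subtracted term makes the induction work: its decrease [2 * (x^n - x^(n+1))] pays for the new
   term [x^n] because [x <= 1/2]. *)
suff h : \sum_(j < n | (m <= j)%N) x ^+ j <= 2 * (x ^+ m - x ^+ (maxn m n)).
  apply: le_trans h _; rewrite ler_pM2l // gerBl exprn_ge0 //.
elim: n => [|n IH]; first by rewrite big_ord0 maxn0 subrr mulr0.
rewrite big_mkcond big_ord_recr -big_mkcond /=; case: leqP => mn.
  rewrite (maxn_idPr mn) in IH; rewrite (maxn_idPr (leqW mn)) exprS.
  have := exprn_ge0 n x0; set y := x ^+ n in IH *; nra.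
rewrite (maxn_idPl (ltnW mn)) subrr mulr0 in IH.
by rewrite addr0 (maxn_idPl mn) subrr mulr0.
Qed.

Lemma sum_binR m : \sum_(k < m.+1) 'C(m, k)%:R = 2 ^+ m :> R.
Proof.
have := exprDn (1 : R) 1 m; rewrite -[1 + 1]/(2%:R) => ->.
by apply: eq_bigr => k _; rewrite !expr1n mulr1.
Qed.

Definition binomial_diff m (u : nat -> H) : H :=
  \sum_(k < m.+1) ((-1) ^+ k * 'C(m, k)%:R : R[i]) *: u k.

Lemma binomial_diff_le m (u : nat -> H) (K : R) :
  (forall k, rnorm (u k) <= K) -> rnorm (binomial_diff m u) <= 2 ^+ m * K.
Proof.
move=> uK; apply: le_trans (rnorm_sum _ _ _) _.
rewrite -sum_binR mulr_suml; apply: ler_sum => k _.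
by rewrite rnormZ rnormM rnorm_sign mul1r rnorm_nat ler_wpM2l.
Qed.

(* The first [m] Taylor coefficients of [u] do not contribute, and the others
   are controlled by Cauchy's estimate. *)
Lemma binomial_diff_polyfun m u (rho K : R) : polyfun u -> 0 < rho ->
  2 * m%:R <= rho -> (forall t, rnorm t = rho -> rnorm (u t) <= K) ->
  rnorm (binomial_diff m (fun k => u k%:R)) <= 2 ^+ m.+1 * K * (m%:R / rho) ^+ m.
Proof.
move=> [n [c cE]] rho_gt0 rho_m uK.
have K_ge0 : 0 <= K.
  by apply: le_trans (uK rho%:C%C _); rewrite ?rnorm_ge0 // rnorm_real gtr0_norm.
have cK j : (j < n)%N -> rnorm (c j) <= K / rho ^+ j.
  by apply: cauchy_coef => // t /uK; rewrite cE.
pose d j : R[i] := \sum_(k < m.+1) ((-1) ^+ k * 'C(m, k)%:R * k%:R ^+ j).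
(* The nodes are at most [m], so [d j] grows like [m^j]. Against the decay [rho^(-j)] of the
   coefficients this leaves a geometric series of ratio [m / rho <= 1/2]. *)
have dle j : rnorm (d j) <= 2 ^+ m * m%:R ^+ j.
  apply: le_trans (rnorm_sum _ _ _) _.
  rewrite -sum_binR mulr_suml; apply: ler_sum => k _.
  rewrite !rnormM rnorm_sign mul1r rnormX !rnorm_nat ler_wpM2l //.
  by rewrite lerXn2r ?nnegrE // ler_nat leq_ord.
have -> : binomial_diff m (fun k => u k%:R) = \sum_(j < n | (m <= j)%N) d j *: c j.
  rewrite /binomial_diff.
  under eq_bigr => k _ do rewrite cE scaler_sumr.
  rewrite exchange_big /= [RHS]big_mkcond; apply: eq_bigr => j _ /=.
  under eq_bigr => k _ do rewrite scalerA.
  rewrite -scaler_suml; case: leqP => // jm.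
  by rewrite (alternating_power_sum jm) scale0r.
apply: le_trans (rnorm_sum _ _ _) _.
have x0 : 0 <= m%:R / rho by rewrite divr_ge0 // ltW.
have x2 : m%:R / rho <= 2^-1 by rewrite ler_pdivrMr // ler_pdivlMl.
have -> : 2 ^+ m.+1 * K * (m%:R / rho) ^+ m = 2 ^+ m * K * (2 * (m%:R / rho) ^+ m).
  by rewrite exprS; ring.
apply: le_trans (ler_wpM2l _ (geometric_tail_le m n x0 x2)); last first.
  by rewrite mulr_ge0 // exprn_ge0.
rewrite mulr_sumr; apply: ler_sum => j _; rewrite rnormZ.
have -> : 2 ^+ m * K * (m%:R / rho) ^+ j = (2 ^+ m * m%:R ^+ j) * (K / rho ^+ j).
  by rewrite expr_div_n; ring.
by apply: ler_pM; rewrite ?rnorm_ge0 // cK.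
Qed.

End VectorPolynomials.

(** * Strong convergence and operator exponentials *)

Section RnormCvg.
Context {R : realType}.

Lemma posC_Re (e : R[i]) : 0 < e -> exists2 r : R, 0 < r & e = r%:C%C.
Proof.
move=> e0; exists (complex.Re e); last by rewrite RRe_real // gtr0_real.
by rewrite -ltcR RRe_real // gtr0_real.
Qed.

Lemma cvg_rnormP (V : normedModType R[i]) (u : nat -> V) (l : V) :
  u @ \oo --> l <->
  forall e : R, 0 < e -> exists N, forall n, (N <= n)%N -> rnorm (u n - l) < e.
Proof.
split=> [/cvgrPdist_lt h e e0|h].
  have /h [N _ hN] : 0 < e%:C%C :> R[i] by rewrite ltcR.
  by exists N => n /hN /=; rewrite distrC rnormE ltcR.
apply/cvgrPdist_lt => e /posC_Re[r r0 ->].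
have [N hN] := h _ r0; exists N => // n /hN /=.
by rewrite distrC rnormE ltcR.
Qed.

Lemma cvg_unique_rnorm (V : normedModType R[i]) (u : nat -> V) (l l' : V) :
  u @ \oo --> l -> u @ \oo --> l' -> l = l'.
Proof. by move=> ul ul'; apply: (cvg_unique _ ul ul'); exact: norm_hausdorff. Qed.

Lemma rnorm_cauchy_cvg (V : completeNormedModType R[i]) (u : nat -> V) :
  (forall e : R, 0 < e ->
     exists N, forall n, (N <= n)%N -> rnorm (u n - u N) < e) ->
  exists l : V, u @ \oo --> l.
Proof.
move=> h; apply/cvg_ex/cauchy_cvgP; apply: cauchy_exP => e /posC_Re[r r0 ->].
have [N hN] := h _ r0; exists (u N); exists N => // n /hN /=.
by rewrite -ball_normE /ball_ /= distrC rnormE ltcR.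
Qed.

Lemma cvg_rnorm_le (V : normedModType R[i]) (u : nat -> V) (l : V) (c : R) :
  u @ \oo --> l -> (forall n, rnorm (u n) <= c) -> rnorm l <= c.
Proof.
move=> /cvg_rnormP ul uc; apply/ler_addgt0Pr => e /ul[N /(_ N (leqnn _)) h].
have := rnormD (u N) (l - u N); rewrite subrKC => /le_trans; apply.
by rewrite lerD ?uc // rnormC ltW.
Qed.

(** The uniform bound [E] controls [T_ n (u n - l)]; this is what allows strong limits to be
    composed. *)
Lemma cvg_operators (H : normedModType R[i]) (T_ : nat -> H -> H) (T : H -> H)
    (u : nat -> H) (l : H) (E : R) :
  (forall n, linear (T_ n)) -> (forall n x, rnorm (T_ n x) <= E * rnorm x) ->
  (forall x, T_ ^~ x @ \oo --> T x) -> u @ \oo --> l ->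
  (fun n => T_ n (u n)) @ \oo --> T l.
Proof.
move=> lT bT cT /cvg_rnormP ul; apply/cvg_rnormP => e e0.
have E1 : 0 < `|E| + 1 by rewrite ltr_wpDl.
have [N hN] := ul (e / 2 / (`|E| + 1)) ltac:(by rewrite !divr_gt0).
have [N' hN'] := proj1 (cvg_rnormP _ _) (cT l) (e / 2) ltac:(by rewrite divr_gt0).
exists (maxn N N') => n; rewrite geq_max => /andP[/hN h /hN' h'].
have -> : T_ n (u n) - T l = T_ n (u n - l) + (T_ n l - T l).
  by rewrite (linear_mapB (lT n)) addrA subrK.
apply: le_lt_trans (rnormD _ _) _; rewrite (splitr e) ltr_leD // ?ltW //.
apply: le_lt_trans (bT _ _) _.
apply: (@le_lt_trans _ _ (`|E| * rnorm (u n - l))).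
  by rewrite ler_wpM2r ?rnorm_ge0 // ler_norm.
rewrite ltr_pdivlMr // in h; have := rnorm_ge0 (u n - l); have := normr_ge0 E.
by move: h; rewrite -subr_gt0 => h; nra.
Qed.

Lemma cvg_inner (H : hilbertType R) (u v : nat -> H) (x y a b : H) :
  u @ \oo --> a -> v @ \oo --> b ->
  (forall n, inner H (u n) y = inner H x (v n)) -> inner H a y = inner H x b.
Proof.
move=> /cvg_rnormP ua /cvg_rnormP vb uv; apply/eqP.
rewrite -subr_eq0 -rnorm_eq0 eq_le rnorm_ge0 andbT.
apply/ler_addgt0Pr => e e0; rewrite add0r.
pose c := rnorm x + rnorm y + 1.
have c0 : 0 < c by rewrite ltr_wpDl // addr_ge0 ?rnorm_ge0.
have ec : 0 < e / c by rewrite divr_gt0.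
have [N hN] := ua _ ec; have [N' hN'] := vb _ ec.
have /hN/ltW h := leq_maxl N N'; have /hN'/ltW h' := leq_maxr N N'.
set n := maxn N N' in h h'.
have -> : inner H a y - inner H x b
    = inner H (a - u n) y + inner H x (v n - b).
  rewrite (psdD (@inner_psd R H)) (psdN (@inner_psd R H)).
  rewrite (psdDr (@inner_psd R H)) (psdNr (@inner_psd R H)) uv.
  by rewrite addrA subrK.
apply: le_trans (rnormD _ _) _.
apply: le_trans (lerD (cauchy_schwarz _ _) (cauchy_schwarz _ _)) _.
rewrite rnormC; have x0 := rnorm_ge0 x; have y0 := rnorm_ge0 y.
apply: (@le_trans _ _ ((e / c) * rnorm y + rnorm x * (e / c))).
  by rewrite lerD ?ler_wpM2r ?ler_wpM2l.
have -> : e / c * rnorm y + rnorm x * (e / c) = (e / c) * (c - 1).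
  by rewrite /c; ring.
by rewrite mulrBr divfK ?gt_eqF // mulr1 gerBl ltW.
Qed.

End RnormCvg.

Section ExpSeries.
Context {R : realType}.

Definition exp_sum (x : R) L : R := \sum_(n < L) x ^+ n / n`!%:R.

Lemma exp_sumE x L : exp_sum x L = series (exp_coeff x) L.
Proof. by rewrite /series /= big_mkord. Qed.

Lemma exp_sum_nd x : 0 <= x -> {homo exp_sum x : m n / (m <= n)%N >-> m <= n}.
Proof.
move=> x0 m n mn; rewrite /exp_sum -!(big_mkord xpredT (fun n => x ^+ n / n`!%:R)).
rewrite (big_cat_nat (leq0n m) mn) /= lerDl sumr_ge0 // => i _.
by rewrite divr_ge0 // exprn_ge0.
Qed.

Lemma exp_sum_cvg (x : R) : exp_sum x @ \oo --> expR x.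
Proof.
have -> : exp_sum x = series (exp_coeff x) by apply/funext => L; exact: exp_sumE.
exact: is_cvg_series_exp_coeff.
Qed.

Lemma exp_sum_le x L : 0 <= x -> exp_sum x L <= expR x.
Proof.
move=> x0; have cv := @exp_sum_cvg x; rewrite -(cvg_lim _ cv) //.
by apply: nondecreasing_cvgn_le; [exact: exp_sum_nd|apply/cvg_ex; exists (expR x)].
Qed.

Lemma exp_sum_near (x e : R) : 0 <= x -> 0 < e ->
  exists N, forall L, (N <= L)%N -> expR x - exp_sum x L < e.
Proof.
move=> x0 e0; have /cvgrPdist_lt/(_ e e0)[N _ hN] := @exp_sum_cvg x.
exists N => L /hN /=; apply: le_lt_trans; exact: ler_norm.
Qed.

End ExpSeries.

Section OperatorExponential.
Context {R : realType} {H : hilbertType R} (A : H -> H).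
Hypothesis lA : linear A.

Definition exp_trunc L (c : R[i]) (x : H) : H :=
  \sum_(n < L) (c ^+ n / n`!%:R) *: iter n A x.

Lemma linear_exp_trunc L c : linear (exp_trunc L c).
Proof.
apply: (@linear_lincomb _ _ _ (fun n => c ^+ n / n`!%:R) (fun n => iter n A)) => n.
exact: linear_iter.
Qed.

Lemma exp_truncE L c x : exp_trunc L c x
  = series (fun n => (n`!%:R : R[i])^-1 *: iter n (fun y => c *: A y) x) L.
Proof.
rewrite /series /= big_mkord; apply: eq_bigr => n _.
by rewrite iter_scale // scalerA mulrC.
Qed.

Variable s : R.
Hypotheses (s_ge0 : 0 <= s) (sA : forall x, rnorm (A x) <= s * rnorm x).

Lemma rnorm_iter n x : rnorm (iter n A x) <= s ^+ n * rnorm x.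
Proof.
elim: n => [|n IH]; first by rewrite mul1r.
by rewrite iterS; apply: le_trans (sA _) _; rewrite exprS -mulrA ler_wpM2l.
Qed.

Lemma rnorm_exp_term c n x :
  rnorm ((c ^+ n / n`!%:R) *: iter n A x)
    <= (rnorm c * s) ^+ n / n`!%:R * rnorm x.
Proof.
rewrite rnormZ rnormM rnormX rnormV rnorm_nat exprMn.
have -> : rnorm c ^+ n * s ^+ n / n`!%:R * rnorm x
  = rnorm c ^+ n / n`!%:R * (s ^+ n * rnorm x) by ring.
by rewrite ler_wpM2l ?rnorm_iter // divr_ge0 // exprn_ge0 ?rnorm_ge0.
Qed.

Lemma exp_trunc_le L c x :
  rnorm (exp_trunc L c x) <= expR (rnorm c * s) * rnorm x.
Proof.
have cs : 0 <= rnorm c * s by rewrite mulr_ge0 ?rnorm_ge0.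
apply: le_trans (rnorm_sum _ _ _) _.
apply: (@le_trans _ _ (exp_sum (rnorm c * s) L * rnorm x)).
  by rewrite mulr_suml; apply: ler_sum => n _; exact: rnorm_exp_term.
by rewrite ler_wpM2r ?rnorm_ge0 // exp_sum_le.
Qed.

Lemma exp_trunc_dist L L' c x : (L <= L')%N ->
  rnorm (exp_trunc L' c x - exp_trunc L c x)
    <= (expR (rnorm c * s) - exp_sum (rnorm c * s) L) * rnorm x.
Proof.
move=> LL'; have cs : 0 <= rnorm c * s by rewrite mulr_ge0 ?rnorm_ge0.
apply: (@le_trans _ _
  ((exp_sum (rnorm c * s) L' - exp_sum (rnorm c * s) L) * rnorm x)).
  rewrite /exp_trunc /exp_sum.
  rewrite -!(big_mkord xpredT (fun n => (c ^+ n / n`!%:R) *: iter n A x)).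
  rewrite -!(big_mkord xpredT (fun n => (rnorm c * s) ^+ n / n`!%:R)).
  rewrite (big_cat_nat (leq0n L) LL') /= addrAC subrr add0r.
  rewrite [in leRHS](big_cat_nat (leq0n L) LL') /= addrAC subrr add0r.
  apply: le_trans (rnorm_sum _ _ _) _.
  by rewrite mulr_suml; apply: ler_sum => n _; exact: rnorm_exp_term.
by rewrite ler_wpM2r ?rnorm_ge0 // lerD2r exp_sum_le.
Qed.

(** [op_exp] is a [limn], which says nothing until convergence is known. Completeness of [H] and
    domination by the scalar exponential series provide it. *)
Lemma op_exp_cvg c x :
  (fun L => exp_trunc L c x) @ \oo --> op_exp (fun y => c *: A y) x.
Proof.
have cs : 0 <= rnorm c * s by rewrite mulr_ge0 ?rnorm_ge0.
have [l hl] : exists l : H, (fun L => exp_trunc L c x) @ \oo --> l.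
  apply: rnorm_cauchy_cvg => e e0.
  have x1 : 0 < rnorm x + 1 by rewrite ltr_wpDl ?rnorm_ge0.
  have ex : 0 < e / (rnorm x + 1) by rewrite divr_gt0.
  have [N hN] := exp_sum_near cs ex; exists N => n Nn.
  apply: le_lt_trans (exp_trunc_dist c x Nn) _.
  have := hN N (leqnn N); rewrite ltr_pdivlMr //; apply: le_lt_trans.
  by rewrite ler_wpM2l ?subr_ge0 ?exp_sum_le // lerDl.
suff -> : op_exp (fun y => c *: A y) x = l by [].
rewrite /op_exp; apply: cvg_lim; first exact: norm_hausdorff.
suff <- : (fun L => exp_trunc L c x) =
  series (fun n => n`!%:R^-1 *: iter n (fun y => c *: A y) x) by [].
by apply/funext => L; exact: exp_truncE.
Qed.

Lemma linear_op_exp c : linear (op_exp (fun y => c *: A y)).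
Proof.
move=> a x y; have h : (fun L => exp_trunc L c (a *: x + y)) @ \oo -->
    a *: op_exp (fun y => c *: A y) x + op_exp (fun y => c *: A y) y.
  have -> : (fun L => exp_trunc L c (a *: x + y))
      = (fun L => a *: exp_trunc L c x + exp_trunc L c y).
    by apply/funext => L; rewrite linear_exp_trunc.
  by apply: cvgD; [apply: cvgZr|]; exact: op_exp_cvg.
exact: (cvg_unique_rnorm (@op_exp_cvg c (a *: x + y)) h).
Qed.

Lemma op_exp_adjoint c x y : is_adjoint A A ->
  inner H (op_exp (fun y => c *: A y) x) y
    = inner H x (op_exp (fun y => c^* *: A y) y).
Proof.
move=> sa; apply: (cvg_inner (@op_exp_cvg c x) (@op_exp_cvg c^* y)) => L.
rewrite (psd_sum (@inner_psd R H)) (psd_sumr (@inner_psd R H)).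
apply: eq_bigr => n _; rewrite (psdZ (@inner_psd R H)) (psdZr (@inner_psd R H)).
rewrite rmorphM rmorphXn /= conjCK fmorphV rmorph_nat; congr (_ * _).
elim: (nat_of_ord n) x y => // k IH x y.
by rewrite iterS sa IH -iterSr.
Qed.

Definition exp_poly L (c : R[i]) : {poly R[i]} := \poly_(n < L) (c ^+ n / n`!%:R).

Lemma exp_truncP L c x : exp_trunc L c x = peval A (exp_poly L c) x.
Proof.
rewrite (peval_widen _ _ (size_poly _ _)); apply: eq_bigr => n _.
by rewrite coef_poly ltn_ord.
Qed.

(** Below the index [L] the truncation is invisible, and [exp(cX) exp(-cX)] has the coefficients
    [c^j / j! * (1 - 1)^j]. *)
Lemma exp_poly_mulN L c j : (j < L)%N ->
  (exp_poly L c * exp_poly L (- c))`_j = (j == 0%N)%:R.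
Proof.
move=> jL; rewrite coefM.
have -> : (j == 0%N)%:R = c ^+ j / j`!%:R * (1 - 1) ^+ j.
  case: j {jL} => [|j]; first by rewrite !expr0 fact0 divr1 mulr1.
  by rewrite subrr expr0n mulr0.
rewrite exprBn mulr_sumr (reindex_inj rev_ord_inj) /=; apply: eq_bigr => i _.
have ij : (i <= j)%N := leq_ord i.
rewrite !coef_poly subSS subKn // (leq_ltn_trans (leq_subr _ _) jL).
rewrite (leq_ltn_trans ij jL) !expr1n !mulr1 -[(-1) ^+ i *+ _]mulr_natr.
have f0 n : n`!%:R != 0 :> R[i] by rewrite pnatr_eq0 -lt0n fact_gt0.
have -> : 'C(j, i)%:R = j`!%:R / i`!%:R / (j - i)`!%:R :> R[i].
  by rewrite -(bin_fact ij) !natrM; field; rewrite !f0.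
have -> : c ^+ j = c ^+ i * c ^+ (j - i) by rewrite -exprD subnKC.
by rewrite [(- c) ^+ i]exprNn; field; rewrite !f0.
Qed.

(** Domination by the coefficients of [exp(|c| X)^2], for all [j], including those affected by
    truncation. *)
Lemma exp_poly_mulN_le L c j :
  rnorm (exp_poly L c * exp_poly L (- c))`_j <= (2 * rnorm c) ^+ j / j`!%:R.
Proof.
rewrite coefM; apply: le_trans (rnorm_sum _ _ _) _.
have -> : (2 * rnorm c) ^+ j / j`!%:R
    = \sum_(i < j.+1) 'C(j, i)%:R * (rnorm c ^+ j / j`!%:R).
  by rewrite -mulr_suml sum_binR exprMn mulrA.
apply: ler_sum => i _; have ij : (i <= j)%N := leq_ord i.
have f0 n : n`!%:R != 0 :> R by rewrite pnatr_eq0 -lt0n fact_gt0.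
have -> : 'C(j, i)%:R * (rnorm c ^+ j / j`!%:R)
    = rnorm c ^+ i / i`!%:R * (rnorm c ^+ (j - i) / (j - i)`!%:R).
  have -> : rnorm c ^+ j = rnorm c ^+ i * rnorm c ^+ (j - i).
    by rewrite -exprD subnKC.
  by rewrite -(bin_fact ij) !natrM; field; rewrite !f0 pnatr_eq0 -lt0n bin_gt0.
have g n b : rnorm b = rnorm c ->
    rnorm (exp_poly L b)`_n <= rnorm c ^+ n / n`!%:R.
  move=> bc; rewrite coef_poly; case: ifP => _.
    by rewrite rnormM rnormX rnormV rnorm_nat bc.
  by rewrite rnorm0 divr_ge0 // exprn_ge0 // rnorm_ge0.
by rewrite rnormM ler_pM ?rnorm_ge0 // g ?rnormN.
Qed.

(** The product of the truncations at [c] and [- c] differs from the identity only by terms of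
    degree at least [L], dominated by a tail of the series of [exp(2 |c| s)]. *)
Lemma op_expK c : cancel (op_exp (fun y => - c *: A y)) (op_exp (fun y => c *: A y)).
Proof.
move=> x; have h1 : (fun L => exp_trunc L c (exp_trunc L (- c) x)) @ \oo -->
    op_exp (fun y => c *: A y) (op_exp (fun y => - c *: A y) x).
  apply: (@cvg_operators _ _ (fun L => exp_trunc L c) _ _ _ (expR (rnorm c * s))
            _ _ _ (@op_exp_cvg (- c) x)) => [L|L y|y].
  - exact: linear_exp_trunc.
  - exact: exp_trunc_le.
  - exact: op_exp_cvg.
apply: (cvg_unique_rnorm h1); apply/cvg_rnormP => e e0.
pose a := 2 * rnorm c * s.
have a0 : 0 <= a by rewrite !mulr_ge0 ?rnorm_ge0.
have x1 : 0 < rnorm x + 1 by rewrite ltr_wpDl ?rnorm_ge0.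
have ex : 0 < e / (rnorm x + 1) by rewrite divr_gt0.
have [N hN] := exp_sum_near a0 ex; exists N.+1 => L NL.
have L_gt0 : (0 < L)%N by case: (L) NL.
rewrite !exp_truncP -pevalM //; set p := exp_poly L c * _.
have sp : (size p <= L + L)%N.
  apply: leq_trans (size_polyMleq _ _) _; apply: leq_trans (leq_pred _) _.
  by rewrite leq_add ?size_poly.
rewrite (peval_widen _ _ sp) big_split_ord /=.
rewrite (bigD1 (Ordinal L_gt0)) //= exp_poly_mulN // scale1r.
rewrite [X in x + X + _]big1 ?addr0 => [|j j0]; last first.
  have jn0 : (j : nat) == 0%N = false by apply/negbTE; rewrite -(inj_eq val_inj) in j0.
  by rewrite exp_poly_mulN // jn0 scale0r.
rewrite addrAC subrr add0r; apply: le_lt_trans (rnorm_sum _ _ _) _.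
apply: (@le_lt_trans _ _ ((expR a - exp_sum a L) * rnorm x)).
  apply: (@le_trans _ _ ((exp_sum a (L + L) - exp_sum a L) * rnorm x)); last first.
    by rewrite ler_wpM2r ?rnorm_ge0 // lerD2r exp_sum_le.
  rewrite /exp_sum big_split_ord /= addrAC subrr add0r mulr_suml.
  apply: ler_sum => j _; rewrite rnormZ /a exprMn.
  have -> : (2 * rnorm c) ^+ (L + j) * s ^+ (L + j) / (L + j)`!%:R * rnorm x
    = (2 * rnorm c) ^+ (L + j) / (L + j)`!%:R * (s ^+ (L + j) * rnorm x) by ring.
  by apply: ler_pM; rewrite ?rnorm_ge0 ?exp_poly_mulN_le ?rnorm_iter.
have := hN L (ltnW NL); rewrite ltr_pdivlMr //; apply: le_lt_trans.
by rewrite ler_wpM2l ?subr_ge0 ?exp_sum_le // lerDl.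
Qed.

End OperatorExponential.

(** * A Bernstein inequality for rotated unitary operators *)

Section UnitaryPairs.
Context {R : realType} {H : hilbertType R}.
Implicit Types (V W U A : H -> H).

(** The inverse is carried along because negative powers of [V], and adjoints of its powers, are
    iterates of [W]. *)
Record unitary_pair V W : Prop := UnitaryPair {
  up_linear : linear V;
  up_linearV : linear W;
  up_adj : is_adjoint V W;
  up_K : cancel V W;
  up_VK : cancel W V
}.

Lemma up_sym V W : unitary_pair V W -> unitary_pair W V.
Proof.
move=> [lV lW adj VK WK]; split=> // x y.
by rewrite (psdC (@inner_psd R H) y) -adj -(psdC (@inner_psd R H) (V y)).
Qed.

Lemma up_isometry V W x : unitary_pair V W -> rnorm (V x) = rnorm x.
Proof.
move=> vw; apply: (@pexpIrn _ 2); rewrite ?nnegrE ?rnorm_ge0 //.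
by rewrite -!Re_inner (up_adj vw) (up_K vw).
Qed.

Lemma iter_isometry V n x : (forall x, rnorm (V x) = rnorm x) ->
  rnorm (iter n V x) = rnorm x.
Proof. by move=> iV; elim: n => // n IH; rewrite iterS iV. Qed.

Lemma iter_cancel V W k n x : cancel V W -> (k <= n)%N ->
  iter n W (iter k V x) = iter (n - k) W x.
Proof.
move=> VK; elim: k n => [|k IH] [|n] // kn.
by rewrite iterSr iterS VK IH.
Qed.

Lemma unitary_has_pair U : unitary U -> exists W, unitary_pair U W.
Proof.
move=> [[lU _] [W [adj UK WK]]]; exists W; split=> // a x y.
by apply: (can_inj UK); rewrite lU !WK.
Qed.

Lemma up_comp V V' W W' : unitary_pair V W -> unitary_pair V' W' ->
  unitary_pair (V \o V') (W' \o W).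
Proof.
move=> [lV lW adj VK WK] [lV' lW' adj' VK' WK']; split.
- exact: linear_comp.
- exact: linear_comp.
- by move=> x y /=; rewrite adj adj'.
- exact: can_comp.
- exact: can_comp.
Qed.

Lemma op_exp_pair A (s t : R) : linear A -> is_adjoint A A -> 0 <= s ->
  (forall x, rnorm (A x) <= s * rnorm x) ->
  unitary_pair (op_exp (fun y => ('i * t%:C%C) *: A y))
               (op_exp (fun y => - ('i * t%:C%C) *: A y)).
Proof.
move=> lA sa s0 sA; split.
- exact: (linear_op_exp lA s0 sA).
- exact: (linear_op_exp lA s0 sA).
- move=> x y; rewrite (op_exp_adjoint lA s0 sA) // rmorphM /= conjCi.
  have -> : (t%:C%C)^* = t%:C%C := conjc_real t.
  by rewrite mulNr.
- have := @op_expK _ _ _ lA _ s0 sA (- ('i * t%:C%C)); rewrite opprK; exact.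
- exact: (op_expK lA s0 sA).
Qed.

(* The value at [V] of the trigonometric polynomial [tpoly d r z = z^-d * r(z)]
   below, where [W] is the inverse of [V]. *)
Definition teval V W d (r : {poly R[i]}) x : H := iter d W (peval V r x).

Lemma linear_teval V W d r : linear V -> linear W -> linear (teval V W d r).
Proof.
by move=> lV lW; apply: (linear_comp (linear_iter d lW)); exact: linear_peval.
Qed.

Lemma teval_le V W d (r : {poly R[i]}) (K : R) x : unitary_pair V W -> 0 < K ->
  (forall z : R[i], circle R z -> rnorm r.[z] <= K) ->
  rnorm (teval V W d r x) <= 4 * K * rnorm x.
Proof.
move=> vw K0 rK; rewrite iter_isometry; last first.
  by move=> y; exact: (up_isometry _ (up_sym vw)).
apply: peval_contraction => //; first exact: up_linear vw.
by move=> y; rewrite (up_isometry _ vw).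
Qed.

End UnitaryPairs.

Section OperatorBernstein.
Context {R : realType} {H : hilbertType R} (U W A : H -> H) (s : R).
Hypotheses (uw : unitary_pair U W) (lA : linear A) (sa : is_adjoint A A).
Hypotheses (s_gt0 : 0 < s) (sA : forall x, rnorm (A x) <= s * rnorm x).

Definition rotated (k : nat) : H -> H :=
  op_exp (fun y => ('i * k%:R) *: A y) \o U.
Definition rotatedV (k : nat) : H -> H :=
  W \o op_exp (fun y => - ('i * k%:R) *: A y).

Lemma rotated_pair k : unitary_pair (rotated k) (rotatedV k).
Proof.
apply: up_comp uw.
have := op_exp_pair k%:R lA sa (ltW s_gt0) sA.
by rewrite (rmorph_nat (real_complex R)).
Qed.

(* The exponentials are truncated so that this is a polynomial in [t]. *)
Definition entire_approx L d (r : {poly R[i]}) (x : H) (t : R[i]) : H :=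
  iter d (fun y => W (exp_trunc A L (- ('i * t)) y))
    (peval (fun y => exp_trunc A L ('i * t) (U y)) r x).

Lemma polyfun_exp_trunc L (c : R[i]) (u : R[i] -> H) : polyfun u ->
  polyfun (fun t => exp_trunc A L (c * t) (u t)).
Proof.
move=> pu; apply: polyfun_sum => n.
have -> : (fun t => ((c * t) ^+ n / n`!%:R) *: iter n A (u t))
    = (fun t => t ^+ n *: ((c ^+ n / n`!%:R) *: iter n A (u t))).
  by apply/funext => t; rewrite scalerA exprMn; congr (_ *: _); ring.
apply: polyfunX.
apply: (polyfun_linear (linear_scale_comp _ (linear_iter n lA)) pu).
Qed.

Lemma polyfun_iter (S : R[i] -> H -> H) n u :
  (forall u, polyfun u -> polyfun (fun t => S t (u t))) ->
  polyfun u -> polyfun (fun t => iter n (S t) (u t)).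
Proof. by move=> pS pu; elim: n => // n IH; exact: pS. Qed.

Lemma polyfun_entire_approx L d r x : polyfun (entire_approx L d r x).
Proof.
apply: polyfun_iter => [u pu|].
  apply: polyfun_linear; first exact: up_linearV uw.
  have := polyfun_exp_trunc L (- 'i) pu.
  by under eq_fun => t do rewrite mulNr.
apply: polyfun_sum => k.
apply: (polyfun_linear (linear_scale_comp r`_k (@linear_id _ H))).
apply: polyfun_iter; last exact: polyfun_cst.
move=> u pu; apply: polyfun_exp_trunc.
exact: polyfun_linear (up_linear uw) pu.
Qed.

(** The [d] inverse factors contribute [E^d], where [E = exp(rho s)], and the polynomial of degree
    at most [d + d] contributes [E^(d + d)]; hence the 3 in the exponent. *)
Lemma entire_approx_le L d (r : {poly R[i]}) (K rho : R) x t :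
  (size r <= (d + d).+1)%N -> 0 < K ->
  (forall z : R[i], circle R z -> rnorm r.[z] <= K) -> rnorm t = rho ->
  rnorm (entire_approx L d r x t)
    <= 16 * K * expR (d%:R * rho * s * 3) * rnorm x.
Proof.
move=> rd K0 rK t_rho.
have rho0 : 0 <= rho by rewrite -t_rho rnorm_ge0.
pose E := expR (rho * s).
have E1 : 1 <= E by rewrite -expR0 ler_expR mulr_ge0 // ltW.
have E0 : 0 <= E by rewrite ltW // expR_gt0.
have s0 := ltW s_gt0.
have ni : rnorm ('i * t) = rho by rewrite rnormM rnorm_i mul1r.
have V_le y : rnorm (exp_trunc A L ('i * t) (U y)) <= E * rnorm y.
  apply: le_trans (exp_trunc_le s0 sA _ _ _) _.
  by rewrite ni (up_isometry _ uw).
have W_le y : rnorm (W (exp_trunc A L (- ('i * t)) y)) <= E * rnorm y.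
  rewrite (up_isometry _ (up_sym uw)).
  by apply: le_trans (exp_trunc_le s0 sA _ _ _) _; rewrite rnormN ni.
have iW n y : rnorm (iter n (fun y => W (exp_trunc A L (- ('i * t)) y)) y)
    <= E ^+ n * rnorm y.
  elim: n => [|n IH]; first by rewrite mul1r.
  by rewrite iterS (le_trans (W_le _)) // exprS -mulrA ler_wpM2l.
apply: le_trans (iW _ _) _.
have lV : linear (fun y => exp_trunc A L ('i * t) (U y)).
  exact: linear_comp (linear_exp_trunc lA _ _) (up_linear uw).
have := peval_bound x lV V_le E1 K0 rK rd => h.
apply: le_trans (ler_wpM2l (exprn_ge0 d E0) h) _.
have -> : expR (d%:R * rho * s * 3) = E ^+ d * E ^+ (d + d).
  by rewrite /E -!expRM_natl -expRD natrD; congr expR; ring.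
have -> : E ^+ d * (16 * K * E ^+ (d + d) * rnorm x)
  = 16 * K * (E ^+ d * E ^+ (d + d)) * rnorm x by ring.
by [].
Qed.

(** [cvg_operators] composes the strong limits one factor at a time, the bounds on the truncated
    exponentials being uniform in [L]. *)
Lemma entire_approx_cvg d (r : {poly R[i]}) x k :
  (fun L => entire_approx L d r x k%:R) @ \oo
    --> teval (rotated k) (rotatedV k) d r x.
Proof.
have s0 := ltW s_gt0; have lU := up_linear uw; have lW := up_linearV uw.
have ni c : rnorm c = rnorm ('i * k%:R : R[i]) -> forall L y,
    rnorm (exp_trunc A L c y) <= expR (rnorm ('i * k%:R : R[i]) * s) * rnorm y.
  by move=> <- L y; exact: exp_trunc_le.
have cV (u : nat -> H) l n : u @ \oo --> l ->
    (fun L => iter n (fun y => exp_trunc A L ('i * k%:R) (U y)) (u L)) @ \oo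
      --> iter n (rotated k) l.
  move=> ul; elim: n => [//|n IH].
  apply: (@cvg_operators _ _ (fun L y => exp_trunc A L ('i * k%:R) (U y))
    (rotated k) _ _ (expR (rnorm ('i * k%:R : R[i]) * s)) _ _ _ IH).
  - by move=> L; exact: linear_comp (linear_exp_trunc lA _ _) lU.
  - by move=> L y; rewrite -(up_isometry y uw); exact: ni.
  - by move=> y; exact: op_exp_cvg s0 sA _ _.
have cW (u : nat -> H) l n : u @ \oo --> l ->
    (fun L => iter n (fun y => W (exp_trunc A L (- ('i * k%:R)) y)) (u L)) @ \oo
      --> iter n (rotatedV k) l.
  move=> ul; elim: n => [//|n IH].
  apply: (@cvg_operators _ _ (fun L y => W (exp_trunc A L (- ('i * k%:R)) y))
    (rotatedV k) _ _ (expR (rnorm ('i * k%:R : R[i]) * s)) _ _ _ IH).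
  - by move=> L; exact: linear_comp lW (linear_exp_trunc lA _ _).
  - by move=> L y; rewrite (up_isometry _ (up_sym uw)); apply: ni; rewrite rnormN.
  - move=> y; apply: (@cvg_operators _ _ (fun=> W) W _ _ 1) => //.
    + by move=> _ z; rewrite mul1r (up_isometry _ (up_sym uw)).
    + by move=> z; exact: cvg_cst.
    + exact: op_exp_cvg s0 sA _ _.
apply: cW; rewrite /peval.
elim: (size r) => [|n IH].
  under eq_cvg => L do rewrite big_ord0.
  by rewrite big_ord0; exact: cvg_cst.
under eq_cvg => L do rewrite big_ord_recr /=.
rewrite big_ord_recr /=; apply: cvgD IH _; apply: cvgZr.
by apply: cV; exact: cvg_cst.
Qed.

(** The factor [2^(m+1)] comes from [binomial_diff_polyfun], 16 from [peval_bound], and [exp(6m)] is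
    the growth of the extension on the circle of radius [2m / (d s)]. *)
Definition bernstein_const m : R := 2 ^+ m.+1 * 16 * expR (6 * m%:R).

Lemma bernstein_const_gt0 m : 0 < bernstein_const m.
Proof. by rewrite !mulr_gt0 ?expR_gt0 // exprn_gt0. Qed.

Lemma operator_bernstein m d (r : {poly R[i]}) (K : R) x :
  (0 < m)%N -> (size r <= (d + d).+1)%N -> 0 < K ->
  (forall z : R[i], circle R z -> rnorm r.[z] <= K) ->
  rnorm (binomial_diff m (fun k => teval (rotated k) (rotatedV k) d r x))
    <= bernstein_const m * K * (d%:R * s) ^+ m * rnorm x.
Proof.
move=> m_gt0 rd K0 rK.
have [d0|d_neq0] := posnP d.
  rewrite {}d0 in rd *; rewrite mul0r expr0n -(negbK (m == 0)%N) -lt0n m_gt0 mulr0 mul0r.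
  have := @alternating_power_sum R[i] m 0 m_gt0.
  under eq_bigr => k _ do rewrite expr0 mulr1.
  move=> S0; rewrite /binomial_diff.
  under eq_bigr => k _ do rewrite /teval (peval_widen _ _ rd) big_ord1.
  by rewrite /= -scaler_suml S0 scale0r rnorm0.
have d_gt0 : 0 < d%:R :> R by rewrite ltr0n.
have ds0 : 0 < d%:R * s by rewrite mulr_gt0.
have e1 : 1 <= expR (6 * m%:R) :> R by rewrite -expR0 ler_expR mulr_ge0.
have x0 := rnorm_ge0 x.
(* For [d s > 1] the trivial bound suffices, since [(d s)^m >= 1]; the radius chosen below would
   then be less than [2m]. *)
have [ds1|ds1] := leP (d%:R * s) 1; last first.
  apply: (@le_trans _ _ (2 ^+ m * (4 * K * rnorm x))).
    by apply: binomial_diff_le => k; apply: teval_le => //; exact: rotated_pair.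
  have -> : 2 ^+ m * (4 * K * rnorm x) = (2 ^+ m * 4) * (K * rnorm x) by ring.
  have -> : bernstein_const m * K * (d%:R * s) ^+ m * rnorm x
    = (2 ^+ m * (32 * (expR (6 * m%:R) * (d%:R * s) ^+ m))) * (K * rnorm x).
    by rewrite /bernstein_const exprS; ring.
  rewrite ler_wpM2r ?mulr_ge0 // ?(ltW K0) // ler_wpM2l ?exprn_ge0 //.
  have : 1 <= expR (6 * m%:R) * (d%:R * s) ^+ m.
    by rewrite -[leLHS]mulr1 ler_pM // exprn_ege1 // ltW.
  lra.
(* This radius makes the exponent [3 d rho s] equal to [6m], and it is at least [2m] because
   [d s <= 1]. *)
pose rho := 2 * m%:R / (d%:R * s).
have m0 : 0 < m%:R :> R by rewrite ltr0n.
have rho0 : 0 < rho by rewrite divr_gt0 // mulr_gt0.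
have rho_m : 2 * m%:R <= rho.
  by rewrite ler_pdivlMr // ler_piMr // mulr_ge0 // ltW.
have dE : d%:R * rho * s * 3 = 6 * m%:R.
  by rewrite /rho; field; rewrite !gt_eqF.
apply: (@cvg_rnorm_le _ _
  (fun L => binomial_diff m (fun k => entire_approx L d r x k%:R))).
  rewrite /binomial_diff; elim: m.+1 => [|n IH].
    under eq_cvg => L do rewrite big_ord0.
    by rewrite big_ord0; exact: cvg_cst.
  under eq_cvg => L do rewrite big_ord_recr /=.
  rewrite big_ord_recr /=; apply: cvgD IH _; apply: cvgZr.
  exact: entire_approx_cvg.
move=> L.
have := binomial_diff_polyfun (polyfun_entire_approx L d r x) rho0 rho_m
  (fun t => entire_approx_le L x rd K0 rK).
move=> h; apply: le_trans h _; rewrite dE.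
have -> : m%:R / rho = (d%:R * s) / 2.
  by rewrite /rho; field; rewrite !gt_eqF.
have -> : 2 ^+ m.+1 * (16 * K * expR (6 * m%:R) * rnorm x) * (d%:R * s / 2) ^+ m
   = bernstein_const m * K * (d%:R * s / 2) ^+ m * rnorm x.
  by rewrite /bernstein_const; ring.
rewrite ler_wpM2r // ler_wpM2l; last 2 first.
- by rewrite mulr_ge0 // ltW // bernstein_const_gt0.
- by apply: lerXn2r; rewrite ?nnegrE; lra.
by [].
Qed.

End OperatorBernstein.

(** * Continuous functions on the circle *)

Section CircleContinuity.
Context {R : realType}.
Implicit Types (f g : R[i] -> R[i]).

Lemma circle_continuousP f : circle_continuous f <->
  forall z, circle R z -> forall e : R, 0 < e -> exists2 d : R, 0 < d &
    forall w, circle R w -> rnorm (w - z) < d -> rnorm (f w - f z) < e.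
Proof.
split=> [/subspace_continuousP h z zc e e0|h].
  have /cvgrPdist_lt/(_ e%:C%C) := h z zc; rewrite ltcR => /(_ e0).
  move=> /nbhs_normP[_ /posC_Re[d d0 ->] hd]; exists d => // w wc wz.
  have /hd/(_ wc) : ball_ Num.norm (z : R[i]^o) d%:C%C w.
    by rewrite /ball_ /= distrC rnormE ltcR.
  by rewrite /= distrC rnormE ltcR.
apply/subspace_continuousP => z zc; apply/cvgrPdist_lt => _ /posC_Re[e e0 ->].
have [d d0 hd] := h z zc e e0.
suff : \forall w \near (z : R[i]^o), circle R w -> `|f z - f w| < e%:C%C by [].
apply/nbhs_normP; exists d%:C%C; first by rewrite /= ltcR.
move=> w; rewrite /ball_ /= distrC rnormE ltcR => wz wc.
by rewrite distrC rnormE ltcR hd.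
Qed.

Lemma circle_continuous_ext f g : circle_continuous f ->
  (forall z, circle R z -> f z = g z) -> circle_continuous g.
Proof.
move=> /circle_continuousP cf fg; apply/circle_continuousP => z zc e e0.
have [d d0 hd] := cf z zc e e0; exists d => // w wc wz.
by rewrite -!fg // hd.
Qed.

Lemma circle_continuous_cst (a : R[i]) : circle_continuous (fun=> a).
Proof.
by apply/circle_continuousP => z zc e e0; exists 1 => // w _ _; rewrite subrr rnorm0.
Qed.

Lemma circle_continuous_id : circle_continuous (@id R[i]).
Proof. by apply/circle_continuousP => z zc e e0; exists e. Qed.

Lemma circle_continuous_conj f : circle_continuous f ->
  circle_continuous (fun z => (f z)^*).
Proof.
move=> /circle_continuousP cf; apply/circle_continuousP => z zc e e0.
have [d d0 hd] := cf z zc e e0; exists d => // w wc wz.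
by rewrite -rmorphB rnorm_conj hd.
Qed.

Lemma circle_continuousD f g : circle_continuous f -> circle_continuous g ->
  circle_continuous (fun z => f z + g z).
Proof.
move=> /circle_continuousP cf /circle_continuousP cg.
apply/circle_continuousP => z zc e e0; have e2 : 0 < e / 2 by rewrite divr_gt0.
have [d d0 hd] := cf z zc _ e2; have [d' d'0 hd'] := cg z zc _ e2.
exists (Num.min d d') => [|w wc]; first by rewrite lt_min d0.
rewrite lt_min => /andP[wz wz']; rewrite opprD addrACA.
by apply: le_lt_trans (rnormD _ _) _; rewrite (splitr e) ltrD ?hd ?hd'.
Qed.

Lemma circle_continuousM f g : circle_continuous f -> circle_continuous g ->
  circle_continuous (fun z => f z * g z).
Proof.
move=> /circle_continuousP cf /circle_continuousP cg.
apply/circle_continuousP => z zc e e0.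
pose c := rnorm (f z) + rnorm (g z) + 1.
have c0 : 0 < c by rewrite ltr_wpDl // addr_ge0 ?rnorm_ge0.
pose t := Num.min 1 (e / c).
have t0 : 0 < t by rewrite lt_min ltr01 divr_gt0.
have [d d0 hd] := cf z zc _ t0; have [d' d'0 hd'] := cg z zc _ t0.
exists (Num.min d d') => [|w wc]; first by rewrite lt_min d0.
rewrite lt_min => /andP[/(hd _ wc) h /(hd' _ wc) h'].
have -> : f w * g w - f z * g z
  = (f w - f z) * (g w - g z) + (f w - f z) * g z + f z * (g w - g z) by ring.
apply: le_lt_trans (rnormD _ _) _.
apply: le_lt_trans (lerD (rnormD _ _) (lexx _)) _; rewrite !rnormM.
have t1 : t <= 1 by rewrite ge_min lexx.
have tc : t * c <= e by rewrite -ler_pdivlMr // ge_min lexx orbT.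
have := rnorm_ge0 (f z); have := rnorm_ge0 (g z).
have := rnorm_ge0 (f w - f z); have := rnorm_ge0 (g w - g z).
rewrite /c in tc; move: h h' tc.
set a := rnorm (f w - f z); set b := rnorm (g w - g z).
set p := rnorm (f z); set q := rnorm (g z) => h h' tc b0 a0 q0 p0.
have ab : a * b < t.
  apply: (@le_lt_trans _ _ a) => //; rewrite ler_piMr // ltW //.
  exact: lt_le_trans h' t1.
have aq : a * q <= t * q by rewrite ler_wpM2r // ltW.
have pb : p * b <= p * t by rewrite ler_wpM2l // ltW.
by apply: lt_le_trans tc; rewrite !mulrDr mulr1 [t * p]mulrC; lra.
Qed.

Lemma circle_continuousX n : circle_continuous (fun z : R[i] => z ^+ n).
Proof.
elim: n => [|n IH]; first exact: circle_continuous_cst.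
apply: (circle_continuous_ext (circle_continuousM circle_continuous_id IH)) => z _.
by rewrite exprS.
Qed.

Lemma circle_continuous_sum n (F : nat -> R[i] -> R[i]) :
  (forall k, circle_continuous (F k)) ->
  circle_continuous (fun z => \sum_(k < n) F k z).
Proof.
move=> cF; elim: n => [|n IH].
  apply: (circle_continuous_ext (@circle_continuous_cst 0)) => z _.
  by rewrite big_ord0.
apply: (circle_continuous_ext (circle_continuousD IH (cF n))) => z _.
by rewrite big_ord_recr.
Qed.

Lemma circle_continuous_horner (r : {poly R[i]}) :
  circle_continuous (fun z => r.[z]).
Proof.
under eq_fun => z do rewrite horner_coef.
apply: (@circle_continuous_sum _ (fun k z => r`_k * z ^+ k)) => k.
by apply: circle_continuousM; [exact: circle_continuous_cst|exact: circle_continuousX].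
Qed.

Lemma sqrt_holder (a b : R) : 0 <= a -> 0 <= b ->
  (Num.sqrt a - Num.sqrt b) ^+ 2 <= `|a - b|.
Proof.
move=> a0 b0; have := sqrtr_ge0 a; have := sqrtr_ge0 b.
have := sqr_sqrtr b0; have := sqr_sqrtr a0.
move: (Num.sqrt a) (Num.sqrt b) => x y <- <- y0 x0.
rewrite subr_sqr normrM [`|x + y|]ger0_norm ?addr_ge0 // -real_normK ?num_real //.
rewrite expr2 ler_wpM2l // ler_norml; lra.
Qed.

Lemma circle_continuous_sqrt f (c : R) : circle_continuous f -> 0 <= c ->
  (forall z, circle R z -> rnorm (f z) <= c) ->
  circle_continuous (fun z => (Num.sqrt (c ^+ 2 - rnorm (f z) ^+ 2))%:C%C).
Proof.
move=> /circle_continuousP cf c0 fc; apply/circle_continuousP => z zc e e0.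
have c1 : 0 < 2 * c + 1 by rewrite ltr_wpDl // mulr_ge0.
have [|d d0 hd] := cf z zc (e ^+ 2 / (2 * c + 1)); first by rewrite divr_gt0 // exprn_gt0.
exists d => // w wc wz; have := hd w wc wz; rewrite ltr_pdivlMr // => h.
rewrite -rmorphB rnorm_real -ltr_sqr ?nnegrE ?(ltW e0) // real_normK ?num_real //.
have pos u : circle R u -> 0 <= c ^+ 2 - rnorm (f u) ^+ 2.
  by move=> uc; rewrite subr_ge0 ler_sqr ?nnegrE ?rnorm_ge0 ?fc.
apply: le_lt_trans (sqrt_holder (pos _ wc) (pos _ zc)) _; apply: le_lt_trans h.
have -> : c ^+ 2 - rnorm (f w) ^+ 2 - (c ^+ 2 - rnorm (f z) ^+ 2)
  = (rnorm (f z) - rnorm (f w)) * (rnorm (f z) + rnorm (f w)) by ring.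
have fw0 := rnorm_ge0 (f w); have fz0 := rnorm_ge0 (f z).
rewrite normrM [X in _ * X]ger0_norm ?addr_ge0 //.
apply: ler_pM; rewrite ?addr_ge0 //; last first.
  by have := fc _ wc; have := fc _ zc; lra.
rewrite ler_norml; have := rnormD (f w) (f z - f w).
have := rnormD (f z) (f w - f z); rewrite !subrKC (rnormC (f z)); lra.
Qed.

Lemma circle_param_continuous (s : R) :
  continuous (fun x : R => (x +i* (s * Num.sqrt (1 - x ^+ 2)))%C : R[i]^o).
Proof.
move=> x; apply/cvgrPdist_lt => _ /posC_Re[e e0 ->].
have e2 : 0 < e / 2 by rewrite divr_gt0.
have c1 : {for x, continuous (fun x : R => s * Num.sqrt (1 - x ^+ 2))}.
  apply: cvgM; first exact: cvg_cst.
  apply: continuous_comp; last exact: sqrt_continuous.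
  by apply: cvgB; [exact: cvg_cst|exact: exprn_continuous].
have h1 := cvgr_dist_lt _ _ c1 _ e2.
have h2 := cvgr_dist_lt _ _ (@cvg_id _ (nbhs x)) _ e2.
suff : \forall y \near x,
    `|(x +i* (s * Num.sqrt (1 - x ^+ 2)))%C - (y +i* (s * Num.sqrt (1 - y ^+ 2)))%C|
      < e%:C%C by [].
apply: filterS2 (h1 _) (h2 _) => y h3 h4.
rewrite rnormE ltcR; apply: le_lt_trans (rnorm_le_Re_Im _) _ => /=.
by rewrite (splitr e) ltrD.
Qed.

(** The upper and the lower half circle are graphs over [[-1, 1]], hence continuous images of a
    segment. *)
Lemma circle_compact : compact (circle R : set R[i]^o).
Proof.
pose g (s x : R) : R[i]^o := (x +i* (s * Num.sqrt (1 - x ^+ 2)))%C.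
have cg s : compact [set g s x | x in `[-1, 1]].
  apply: continuous_compact; last exact: segment_compact.
  by apply: continuous_subspaceT; exact: circle_param_continuous.
suff -> : (circle R : set R[i]^o)
    = [set g 1 x | x in `[-1, 1]] `|` [set g (-1) x | x in `[-1, 1]].
  exact: compactU.
have nE (a b : R) : circle R (a +i* b)%C <-> a ^+ 2 + b ^+ 2 = 1.
  split=> [/circle_mulC/(congr1 (@complex.Re R)) /= h|h].
    by rewrite -h; ring.
  apply/circleP; rewrite /rnorm normc_def /= h sqrtr1 //.
apply/seteqP; split=> [[a b] /nE h|z].
  have a1 : a \in `[-1, 1].
    rewrite in_itv /=; have := sqr_ge0 b; nra.
  have b2 : 1 - a ^+ 2 = b ^+ 2 by rewrite -h; ring.
  have [b0|b0] := leP 0 b; [left|right]; exists a => //; rewrite /g b2 sqrtr_sqr.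
    by rewrite ger0_norm // mul1r.
  by rewrite ltr0_norm // mulN1r opprK.
have a2 (x : R) : `[-1, 1]%classic x -> 0 <= 1 - x ^+ 2.
  by rewrite /= in_itv /= => /andP[x1 x2]; nra.
by case=> -[x /a2 hx <-]; apply/nE; rewrite exprMn sqr_sqrtr //; ring.
Qed.

(** The near-covering form of compactness, over the filter [\oo] in [n]: local thresholds [N] merge
    into a single index. *)
Lemma circle_cover (P : nat -> R[i] -> Prop) :
  (forall z, circle R z -> exists2 d : R, 0 < d & exists N, forall w n,
     circle R w -> rnorm (w - z) < d -> (N <= n)%N -> P n w) ->
  exists n, forall z, circle R z -> P n z.
Proof.
move=> h; have := circle_compact; rewrite compact_near_coveringP.
move=> /(_ nat \oo (fun n w => circle R w -> P n w) _)[|N _ hN].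
  move=> z /h[d d0 [N hN]].
  exists ([set w | rnorm (w - z) < d], [set n | (N <= n)%N]).
    split; last by exists N.
    suff : \forall w \near (z : R[i]^o), rnorm (w - z) < d by [].
    apply/nbhs_normP; exists d%:C%C; first by rewrite /= ltcR.
    by move=> w; rewrite /ball_ /= distrC rnormE ltcR.
  by move=> [w n] [/= wz Nn] wc; exact: hN.
by exists N => z zc; exact: (hN N (leqnn N) z zc zc).
Qed.

Lemma circle_bounded f : circle_continuous f ->
  exists2 M : R, 0 < M & forall z, circle R z -> rnorm (f z) <= M.
Proof.
move=> /circle_continuousP cf.
have [|n hn] := @circle_cover (fun n z => rnorm (f z) <= n%:R).
  move=> z zc; have [d d0 hd] := cf z zc 1 ltr01; exists d => //.
  have := truncnS_gt (rnorm (f z) + 1); set N := (Num.truncn _).+1 => hN.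
  exists N => w n wc wz Nn.
  have := hd w wc wz; have := rnormD (f z) (f w - f z); rewrite subrKC => h1 h2.
  have : N%:R <= n%:R :> R by rewrite ler_nat.
  lra.
exists n.+1%:R => [|z zc]; first by rewrite ltr0n.
by apply: le_trans (hn z zc) _; rewrite ler_nat.
Qed.

(** Uniform continuity with distant pairs absorbed into a quadratic term, the weight against which
    the Fejer kernel is bounded. *)
Lemma circle_modulus f (e : R) : circle_continuous f -> 0 < e ->
  exists2 C : R, 0 <= C & forall z w, circle R z -> circle R w ->
    rnorm (f w - f z) <= e + C * rnorm (w - z) ^+ 2.
Proof.
move=> cf e0; have [M M0 fM] := circle_bounded cf.
move: cf => /circle_continuousP cf.
have [|n hn] := @circle_cover (fun n z => forall w, circle R w ->
    rnorm (f w - f z) <= e + n%:R * rnorm (w - z) ^+ 2).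
  move=> z zc; have e2 : 0 < e / 2 by rewrite divr_gt0.
  (* Halving [d] puts [u], and every [w] within [d / 2] of it, into the [d]-neighbourhood of [z]. *)
  have [d d0 hd] := cf z zc _ e2; exists (d / 2); first by rewrite divr_gt0.
  have := truncnS_gt (2 * M / (d / 2) ^+ 2); set N := (Num.truncn _).+1 => hN.
  exists N => u n uc uz Nn w wc.
  have [wu|wu] := ltP (rnorm (w - u)) (d / 2).
    apply: (@le_trans _ _ e); last by rewrite lerDl mulr_ge0 // sqr_ge0.
    have wz : rnorm (w - z) < d.
      rewrite -(subrKA u) (splitr d); apply: le_lt_trans (rnormD _ _) _.
      by rewrite ltrD.
    rewrite -(subrKA (f z)) (splitr e); apply: le_trans (rnormD _ _) _.
    rewrite lerD ?(ltW (hd _ wc wz)) // rnormC ltW // hd //.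
    by move: uz; lra.
  apply: (@le_trans _ _ (2 * M)).
    by apply: le_trans (rnormB _ _) _; have := fM _ uc; have := fM _ wc; lra.
  have : 2 * M <= n%:R * (d / 2) ^+ 2.
    rewrite -ler_pdivrMr ?exprn_gt0 ?divr_gt0 //.
    by apply: le_trans (ltW hN) _; rewrite ler_nat.
  have : n%:R * (d / 2) ^+ 2 <= n%:R * rnorm (w - u) ^+ 2.
    by rewrite ler_wpM2l // lerXn2r ?nnegrE ?rnorm_ge0 // ltW // divr_gt0.
  lra.
by exists n%:R => // z w zc wc; exact: hn.
Qed.

(* On the circle this is the Laurent polynomial [z^-d * r(z)]. *)
Definition tpoly d (r : {poly R[i]}) (z : R[i]) : R[i] :=
  (z^* : R[i]) ^+ d * r.[z].

Lemma rnorm_tpoly d r z : circle R z -> rnorm (tpoly d r z) = rnorm r.[z].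
Proof.
by move=> /circleP zn; rewrite rnormM rnormX rnorm_conj zn expr1n mul1r.
Qed.

Lemma circle_continuous_tpoly d r : circle_continuous (tpoly d r).
Proof.
apply: circle_continuousM; last exact: circle_continuous_horner.
under eq_fun => z do rewrite -rmorphXn.
exact/circle_continuous_conj/circle_continuousX.
Qed.

(* Averages of [f] over roots of unity against the Fejer kernel [|g_i|^2],
   which satisfies [|w ^+ i - z|^2 * |g_i z|^2 <= 4]. *)
Lemma tpoly_dense f (e : R) : circle_continuous f -> 0 < e ->
  exists d r, forall z, circle R z -> rnorm (f z - tpoly d r z) <= e.
Proof.
move=> cf e0; have [|C C0 hC] := @circle_modulus f (e / 2) cf; first by rewrite divr_gt0.
(* The quadratic part of the modulus contributes at most [4 * C / N^2] at each of the [N] nodes, so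
   [4 * C / N] in all. *)
have := truncnS_gt (4 * C / (e / 2)); set N := (Num.truncn _).+1 => hN.
have [w wP] := @prim_root_exists R N isT.
have wc i : circle R (w ^+ i) by apply: circleX; exact: prim_root_circle wP.
have N0 : 0 < N%:R :> R by rewrite ltr0n.
pose g i (z : R[i]) : R[i] := \sum_(j < N) ((w ^+ i)^* * z) ^+ j.
(* On the circle this is [z^N |g_i z|^2]: the second factor is [z^N] times the conjugate of the
   first. *)
pose q i : {poly R[i]} := (\sum_(j < N) ((w ^+ i)^* ^+ j) *: 'X^j)
   * (\sum_(l < N) ((w ^+ i) ^+ l) *: 'X^(N - l)).
pose r := \sum_(i < N) (f (w ^+ i) / N%:R ^+ 2) *: q i.
have qE i z : circle R z -> z^* ^+ N * (q i).[z] = (rnorm (g i z) ^+ 2)%:C%C.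
  move=> zc; rewrite -mulC_conj hornerM !horner_sum mulrCA; congr (_ * _).
    by apply: eq_bigr => j _; rewrite hornerZ hornerXn exprMn.
  rewrite mulr_sumr rmorph_sum; apply: eq_bigr => l _.
  rewrite hornerZ hornerXn rmorphXn rmorphM /= conjCK exprMn mulrCA; congr (_ * _).
  rewrite -{1}(subnK (ltnW (ltn_ord l))) exprD mulrAC -exprMn.
  by rewrite [z^* * z]mulrC circle_mulC // expr1n mul1r.
have gsum z : circle R z -> \sum_(i < N) rnorm (g i z) ^+ 2 = N%:R ^+ 2.
  move=> zc; apply: (@complexI R); rewrite rmorph_sum /=.
  under eq_bigr => i _ do rewrite -mulC_conj /g rmorph_sum mulr_suml.
  rewrite exchange_big /= rmorphXn /= rmorph_nat expr2.
  have -> : N%:R * N%:R = \sum_(j < N) N%:R :> R[i].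
    by rewrite sumr_const card_ord mulr_natl.
  apply: eq_bigr => j _; under eq_bigr => i _ do rewrite mulr_sumr.
  rewrite exchange_big /= (bigD1 j) //= [X in _ + X]big1 ?addr0 => [|l lj].
    rewrite (eq_bigr (fun=> 1)) => [|i _]; first by rewrite sumr_const card_ord.
    by apply/circle_mulC/circleX/circleM => //; exact: circle_conj.
  have tE (a : R[i]) : (a^* * z) ^+ j * ((a^* * z) ^+ l)^*
      = z ^+ j * z^* ^+ l * (a ^+ l * a^* ^+ j).
    by rewrite rmorphXn rmorphM /= conjCK !exprMn; ring.
  under eq_bigr => i _ do rewrite tE.
  rewrite -mulr_sumr (sum_prim_root wP) !modn_small //.
  by rewrite -(inj_eq val_inj) /= in lj; rewrite (negPf lj) mulr0.
have gle i z : circle R z -> rnorm (w ^+ i - z) ^+ 2 * rnorm (g i z) ^+ 2 <= 4.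
  move=> zc; rewrite -exprMn -rnormM.
  have -> : rnorm ((w ^+ i - z) * g i z) = rnorm (1 - ((w ^+ i)^* * z) ^+ N).
    have -> : rnorm ((w ^+ i - z) * g i z)
        = rnorm (((w ^+ i)^* * z - 1) * g i z).
      rewrite !rnormM; congr (_ * _).
      have /circleP wn := circle_conj (wc i); rewrite -[LHS]mul1r -wn -rnormM.
      by rewrite mulrBr [_ * w ^+ i]mulrC circle_mulC // rnormC.
    by rewrite -subrX1 rnormC.
  have h : rnorm (1 - ((w ^+ i)^* * z) ^+ N) <= 2.
    apply: le_trans (rnormB _ _) _; rewrite rnorm1.
    have /circleP -> // : circle R (((w ^+ i)^* * z) ^+ N).
    by apply: circleX; apply: circleM => //; exact: circle_conj.
  have := rnorm_ge0 (1 - ((w ^+ i)^* * z) ^+ N); nra.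
exists N, r => z zc.
have -> : tpoly N r z = \sum_(i < N) f (w ^+ i) / N%:R ^+ 2 * (rnorm (g i z) ^+ 2)%:C%C.
  rewrite /tpoly horner_sum mulr_sumr; apply: eq_bigr => i _.
  by rewrite hornerZ mulrCA qE.
have NC : N%:R ^+ 2 != 0 :> R[i] by rewrite expf_neq0 // pnatr_eq0.
have -> : f z = \sum_(i < N) f z / N%:R ^+ 2 * (rnorm (g i z) ^+ 2)%:C%C.
  rewrite -mulr_sumr -rmorph_sum /= gsum // rmorphXn /= rmorph_nat divfK //.
rewrite -sumrB; apply: le_trans (rnorm_sum _ _ _) _.
apply: (@le_trans _ _ (\sum_(i < N) (N%:R ^- 2 * (e / 2 * rnorm (g i z) ^+ 2)
    + N%:R ^- 2 * (C * 4)))); last first.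
  rewrite big_split /= -!mulr_sumr gsum // sumr_const card_ord.
  have -> : N%:R ^- 2 * (e / 2 * N%:R ^+ 2) + N%:R ^- 2 * (C * (4 *+ N))
      = e / 2 + (4 * C) / N%:R.
    by rewrite -[4 *+ N]mulr_natr; field; rewrite gt_eqF.
  have : 4 * C / N%:R <= e / 2.
    have h := ltW hN; rewrite ler_pdivrMr ?divr_gt0 // in h.
    by rewrite ler_pdivrMr //; lra.
  lra.
apply: ler_sum => i _; rewrite -mulrBl -mulrBl !rnormM rnormV rnormX rnorm_nat.
rewrite rnorm_real ger0_norm ?sqr_ge0 // -mulrDr -mulrA mulrCA ler_wpM2l //.
apply: (@le_trans _ _ ((e / 2 + C * rnorm (z - w ^+ i) ^+ 2) * rnorm (g i z) ^+ 2)).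
  by rewrite ler_wpM2r ?sqr_ge0 // hC.
rewrite mulrDl lerD2l -mulrA ler_wpM2l // rnormC; exact: gle.
Qed.

End CircleContinuity.

(** * Existence of the functional calculus *)

Section TrigonometricCalculus.
Context {R : realType} {H : hilbertType R} {V W : H -> H}.
Hypothesis vw : unitary_pair V W.
Let lV := up_linear vw.
Let lW := up_linearV vw.
Implicit Types (f g : R[i] -> R[i]) (r : {poly R[i]}).

Lemma iterV_comm n x : W (iter n V x) = iter n V (W x).
Proof. by elim: n => // n IH; rewrite iterS (up_K vw) iterSr (up_VK vw). Qed.

Lemma iterVV_comm m n x : iter m W (iter n V x) = iter n V (iter m W x).
Proof. by elim: m => // m IH; rewrite !iterS IH iterV_comm. Qed.

Lemma peval_iterV m r x : iter m W (peval V r x) = peval V r (iter m W x).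
Proof.
rewrite /peval (linear_map_sum _ _ _ (linear_iter m lW)); apply: eq_bigr => k _.
by rewrite (linear_mapZ _ _ (linear_iter m lW)) iterVV_comm.
Qed.

Lemma teval_shift d k r x : teval V W (k + d) ('X^k * r) x = teval V W d r x.
Proof.
rewrite /teval pevalM // pevalXn // iter_cancel ?leq_addr //; last exact: up_K vw.
by rewrite addKn.
Qed.

Lemma tpoly_shift d k r z : circle R z -> tpoly (k + d) ('X^k * r) z = tpoly d r z.
Proof.
move=> zc; rewrite /tpoly hornerM hornerXn mulrA; congr (_ * _).
by rewrite exprD mulrAC -exprMn [z^* * z]mulrC circle_mulC // expr1n mul1r.
Qed.

(** Powers of [X] bring both polynomials to the common shift [d' + d], where von Neumann's
    inequality applies to their difference. *)
Lemma teval_dist d r d' r' (e : R) x : 0 < e ->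
  (forall z, circle R z -> rnorm (tpoly d r z - tpoly d' r' z) <= e) ->
  rnorm (teval V W d r x - teval V W d' r' x) <= 4 * e * rnorm x.
Proof.
move=> e0 h; pose p := 'X^d' * r - 'X^d * r'.
have -> : teval V W d r x - teval V W d' r' x = teval V W (d' + d) p x.
  rewrite -(teval_shift d d' r) -(teval_shift d' d r') [(d + d')%N]addnC.
  by rewrite /teval pevalB (linear_mapB (linear_iter _ lW)).
apply: teval_le => // z zc; rewrite -(@rnorm_tpoly _ (d' + d)) //.
have -> : tpoly (d' + d) p z = tpoly d r z - tpoly d' r' z.
  rewrite -(tpoly_shift d d' r zc) -(tpoly_shift d' d r' zc) [(d + d')%N]addnC.
  by rewrite /tpoly hornerD hornerN mulrBr.
exact: h.
Qed.

Lemma teval_comp d r d' r' x :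
  teval V W d r (teval V W d' r' x) = teval V W (d + d') (r * r') x.
Proof. by rewrite /teval -peval_iterV -iterD pevalM. Qed.

Lemma tpolyM d r d' r' z : tpoly d r z * tpoly d' r' z = tpoly (d + d') (r * r') z.
Proof. by rewrite /tpoly hornerM exprD mulrACA. Qed.

(** The conjugate of [z^(-d) r(z)] involves the exponents [d - k]; the shift by [size r] makes them
    nonnegative. *)
Definition tconj d r := \sum_(k < size r) (r`_k)^* *: 'X^(d + (size r - k)).

Lemma tpoly_conj d r z : circle R z ->
  tpoly (size r) (tconj d r) z = (tpoly d r z)^*.
Proof.
move=> zc; rewrite /tpoly /tconj horner_sum rmorphM rmorphXn /= conjCK.
rewrite horner_coef rmorph_sum !mulr_sumr; apply: eq_bigr => k _.
rewrite hornerZ hornerXn rmorphM rmorphXn /= mulrCA [RHS]mulrCA; congr (_ * _).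
rewrite -{1}(subnK (ltnW (ltn_ord k))) !exprD.
have e : z^* ^+ (size r - k) * z ^+ (size r - k) = 1.
  by rewrite -exprMn [z^* * z]mulrC circle_mulC // expr1n.
rewrite [z ^+ d * _]mulrC mulrACA e mul1r mulrC //.
Qed.

Lemma teval_adj d r x y :
  inner H (teval V W d r x) y = inner H x (teval V W (size r) (tconj d r) y).
Proof.
have P := @inner_psd R H.
have aV n u v : inner H (iter n V u) v = inner H u (iter n W v).
  by elim: n u v => // n IH u v; rewrite iterS (up_adj vw) IH -iterSr.
have aW n u v : inner H (iter n W u) v = inner H u (iter n V v).
  by elim: n u v => // n IH u v; rewrite iterS (up_adj (up_sym vw)) IH -iterSr.
rewrite /teval aW /peval (psd_sum P) /tconj -/(peval V (tconj d r) y).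
rewrite -/(tconj d r) /tconj peval_sum (linear_map_sum _ _ _ (linear_iter _ lW)).
rewrite (psd_sumr P); apply: eq_bigr => k _.
rewrite (psdZ P) pevalZ (linear_mapZ _ _ (linear_iter _ lW)) (psdZr P) conjCK.
congr (_ * _); rewrite aV pevalXn //; congr (inner H x _).
by rewrite addnC iterD [RHS](iter_cancel _ (up_K vw)) ?leq_subr // subKn // ltnW.
Qed.

(** The relation [f(V) = T] as a closure: the same trigonometric polynomial approximates [f] on the
    circle and [T] in norm. Uniqueness and the algebraic rules follow by approximation, before any
    value is chosen. *)
Definition calc f (T : H -> H) := forall e : R, 0 < e -> exists d r,
  (forall z, circle R z -> rnorm (f z - tpoly d r z) <= e) /\
  (forall x, rnorm (T x - teval V W d r x) <= e * rnorm x).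

Lemma calc_tpoly d r : calc (tpoly d r) (teval V W d r).
Proof.
move=> e e0; exists d, r; split=> [z zc|x]; rewrite subrr rnorm0; first exact: ltW.
by rewrite mulr_ge0 ?rnorm_ge0 // ltW.
Qed.

Lemma calc_dist f g S T (c : R) x : calc f S -> calc g T -> 0 <= c ->
  (forall z, circle R z -> rnorm (f z - g z) <= c) ->
  rnorm (S x - T x) <= 4 * c * rnorm x.
Proof.
move=> cf cg c0 fg; apply/ler_addgt0Pr => e e0.
have x1 : 0 < rnorm x + 1 by rewrite ltr_wpDl ?rnorm_ge0.
(* The 10 is [1 + 4 * 2 + 1]: one [t] for each operator, and two under the factor 4 of
   [teval_dist]. *)
pose t := e / (rnorm x + 1) / 10.
have t0 : 0 < t by rewrite !divr_gt0.
have [d [r [fr Sr]]] := cf _ t0; have [d' [r' [gr Tr]]] := cg _ t0.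
have c't : 0 < t + c + t by rewrite ltr_pwDr // addr_ge0 // ltW.
have h : rnorm (teval V W d r x - teval V W d' r' x) <= 4 * (t + c + t) * rnorm x.
  apply: teval_dist => // z zc.
  have -> : tpoly d r z - tpoly d' r' z
    = (tpoly d r z - f z) + (f z - g z) + (g z - tpoly d' r' z) by ring.
  apply: le_trans (rnormD _ _) _; rewrite lerD ?gr //.
  by apply: le_trans (rnormD _ _) _; rewrite lerD ?fg // rnormC fr.
have -> : S x - T x = (S x - teval V W d r x)
   + (teval V W d r x - teval V W d' r' x) + (teval V W d' r' x - T x).
  by rewrite !subrKA.
apply: le_trans (rnormD _ _) _.
apply: le_trans (lerD (le_trans (rnormD _ _) (lerD (Sr x) h)) (lexx _)) _.
rewrite rnormC; apply: le_trans (lerD (lexx _) (Tr x)) _.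
have -> : t * rnorm x + 4 * (t + c + t) * rnorm x + t * rnorm x
  = 4 * c * rnorm x + e * (rnorm x / (rnorm x + 1)).
  by rewrite /t; field; rewrite gt_eqF.
by rewrite lerD2l ler_piMr ?ltW // ltr_pdivrMr // mul1r ltrDl.
Qed.

Lemma calc_unique f g S T : calc f S -> calc g T ->
  (forall z, circle R z -> f z = g z) -> S = T.
Proof.
move=> cf cg fg; apply/funext => x; apply/eqP.
rewrite -subr_eq0 -rnorm_eq0 eq_le rnorm_ge0 andbT.
have := @calc_dist f g S T 0 x cf cg (lexx _); rewrite mulr0 mul0r; apply.
by move=> z zc; rewrite fg // subrr rnorm0.
Qed.

Lemma calc_ext f g T : calc f T -> (forall z, circle R z -> f z = g z) -> calc g T.
Proof.
move=> cf fg e /cf[d [r [fr Tr]]]; exists d, r; split=> // z zc.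
by rewrite -fg // fr.
Qed.

Lemma calc_le f T (c : R) x : calc f T -> 0 <= c ->
  (forall z, circle R z -> rnorm (f z) <= c) -> rnorm (T x) <= 4 * c * rnorm x.
Proof.
move=> cf c0 fc; have := @calc_dist f (tpoly 0 0) T (teval V W 0 0) c x cf (calc_tpoly _ _) c0.
rewrite /teval peval0 /= subr0; apply => z zc.
by rewrite /tpoly horner0 mulr0 subr0 fc.
Qed.

Lemma calc_exists f : circle_continuous f -> exists T, calc f T.
Proof.
move=> cf; have e0 n : 0 < n.+1%:R^-1 :> R by rewrite invr_gt0 ltr0n.
have h n : exists p : nat * {poly R[i]}, forall z, circle R z ->
    rnorm (f z - tpoly p.1 p.2 z) <= n.+1%:R^-1.
  by have [d [r hr]] := tpoly_dense cf (e0 n); exists (d, r).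
have [p hp] := choice h.
have dist m n x : (n <= m)%N ->
    rnorm (teval V W (p m).1 (p m).2 x - teval V W (p n).1 (p n).2 x)
      <= 8 / n.+1%:R * rnorm x.
  move=> nm; have := @teval_dist (p m).1 (p m).2 (p n).1 (p n).2
    (n.+1%:R^-1 + n.+1%:R^-1) x _ _;
  have -> : 8 / n.+1%:R = 4 * (n.+1%:R^-1 + n.+1%:R^-1) :> R by ring.
  apply; first by rewrite addr_gt0.
  move=> z zc; rewrite -(subrKA (f z)); apply: le_trans (rnormD _ _) _.
  rewrite lerD ?hp // rnormC; apply: le_trans (hp _ _ zc) _.
  by rewrite lef_pV2 ?posrE ?ltr0n // ler_nat.
have cv x : exists l : H, (fun n => teval V W (p n).1 (p n).2 x) @ \oo --> l.
  apply: rnorm_cauchy_cvg => e e_gt0.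
  pose N := (Num.truncn (8 * rnorm x / e)).+1; exists N => n Nn.
  apply: le_lt_trans (dist _ _ x Nn) _.
  have := truncnS_gt (8 * rnorm x / e); rewrite -/N ltr_pdivrMr // => hN.
  rewrite mulrAC ltr_pdivrMr ?ltr0n //; apply: lt_trans hN _.
  by rewrite mulrC ltr_pM2l // ltr_nat.
have [T hT] := choice cv; exists T => e e_gt0.
pose N := (Num.truncn (8 / e)).+1.
have hN : 8 / N.+1%:R <= e.
  have := truncnS_gt (8 / e); rewrite -/N ltr_pdivrMr // => h8.
  rewrite ler_pdivrMr ?ltr0n // mulrC; apply: le_trans (ltW h8) _.
  by rewrite ler_wpM2r ?ltW // ltr_nat.
exists (p N).1, (p N).2; split=> [z zc|x].
  apply: le_trans (hp N z zc) _; apply: le_trans hN.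
  by apply: ler_peMl; [exact: ltW|rewrite ler1n].
apply: (@cvg_rnorm_le _ _ (fun n => teval V W (p (n + N)%N).1 (p (n + N)%N).2 x
    - teval V W (p N).1 (p N).2 x)).
  apply: cvgB; last exact: cvg_cst.
  have := hT x; rewrite -(cvg_shiftn N) //.
move=> n; apply: le_trans (dist _ _ x (leq_addl _ _)) _.
by rewrite ler_wpM2r ?rnorm_ge0.
Qed.

Lemma calcD f g S T : calc f S -> calc g T ->
  calc (fun z => f z + g z) (fun x => S x + T x).
Proof.
move=> cf cg e e0; have e2 : 0 < e / 2 by rewrite divr_gt0.
have [d [r [fr Sr]]] := cf _ e2; have [d' [r' [gr Tr]]] := cg _ e2.
exists (d' + d)%N, ('X^d' * r + 'X^d * r'); split=> [z zc|x].
  have -> : tpoly (d' + d) ('X^d' * r + 'X^d * r') z = tpoly d r z + tpoly d' r' z.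
    rewrite -(tpoly_shift d d' r zc) -(tpoly_shift d' d r' zc) [(d + d')%N]addnC.
    by rewrite /tpoly hornerD mulrDr.
  rewrite opprD addrACA (splitr e); apply: le_trans (rnormD _ _) _.
  by rewrite lerD ?fr ?gr.
have -> : teval V W (d' + d) ('X^d' * r + 'X^d * r') x
    = teval V W d r x + teval V W d' r' x.
  rewrite -(teval_shift d d' r) -(teval_shift d' d r') [(d + d')%N]addnC.
  by rewrite /teval pevalD (linear_mapD (linear_iter _ lW)).
rewrite opprD addrACA (splitr e) mulrDl; apply: le_trans (rnormD _ _) _.
by rewrite lerD ?Sr ?Tr.
Qed.

Lemma calcZ (a : R[i]) f T : calc f T ->
  calc (fun z => a * f z) (fun x => a *: T x).
Proof.
move=> cf e e0; have a1 : 0 < rnorm a + 1 by rewrite ltr_wpDl ?rnorm_ge0.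
have [|d [r [fr Tr]]] := cf (e / (rnorm a + 1)); first by rewrite divr_gt0.
have ae : rnorm a * (e / (rnorm a + 1)) <= e.
  by rewrite mulrA ler_pdivrMr // mulrC ler_pM2l // lerDl.
exists d, (a *: r); split=> [z zc|x].
  rewrite /tpoly hornerZ mulrCA -mulrBr rnormM; apply: le_trans ae.
  by rewrite ler_wpM2l ?rnorm_ge0 ?fr.
rewrite /teval pevalZ (linear_mapZ _ _ (linear_iter _ lW)) -scalerBr rnormZ.
apply: le_trans (ler_wpM2l (rnorm_ge0 a) (Tr x)) _.
by rewrite mulrA ler_wpM2r ?rnorm_ge0.
Qed.

Lemma calc_linear f T : calc f T -> linear T.
Proof.
move=> cf a x y; apply/eqP; rewrite -subr_eq0 -rnorm_eq0 eq_le rnorm_ge0 andbT.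
apply/ler_addgt0Pr => e e0; rewrite add0r.
pose c := rnorm (a *: x + y) + rnorm a * rnorm x + rnorm y + 1.
have c0 : 0 < c by rewrite ltr_wpDl // !addr_ge0 ?rnorm_ge0 // mulr_ge0 ?rnorm_ge0.
have [|d [r [_ Tr]]] := cf (e / c); first by rewrite divr_gt0.
pose P := teval V W d r.
have lP : P (a *: x + y) = a *: P x + P y by exact: linear_teval.
have -> : T (a *: x + y) - (a *: T x + T y) = (T (a *: x + y) - P (a *: x + y))
    - a *: (T x - P x) - (T y - P y).
  rewrite lP scalerBr !opprB -!addrA; congr (_ + _).
  by rewrite !opprD addrACA addNr add0r addrCA addKr.
apply: le_trans (rnormB _ _) _; apply: le_trans (lerD (rnormB _ _) (lexx _)) _.
rewrite rnormZ.
apply: (@le_trans _ _ (e / c * rnorm (a *: x + y) + rnorm a * (e / c * rnorm x)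
    + e / c * rnorm y)).
  by rewrite !lerD ?Tr // ler_wpM2l ?rnorm_ge0 ?Tr.
have -> : e / c * rnorm (a *: x + y) + rnorm a * (e / c * rnorm x)
    + e / c * rnorm y = e - e / c.
  by rewrite /c; field; rewrite -/c gt_eqF.
by rewrite gerBl divr_ge0 // ltW.
Qed.

Lemma calcM f g S T : circle_continuous f -> circle_continuous g ->
  calc f S -> calc g T -> calc (fun z => f z * g z) (S \o T).
Proof.
move=> /circle_bounded[M M0 fM] /circle_bounded[N N0 gN] cf cg e e0.
(* The multiples of [t'] in the operator estimate add up to [4 * M + 4 * (N + 1)], where [N + 1]
   bounds the approximant of [g] because [t' <= 1]. *)
have c0 : 0 < 4 * M + 4 * N + 5 by lra.
pose t' := Num.min 1 (e / (4 * M + 4 * N + 5)).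
have t0 : 0 < t' by rewrite lt_min ltr01 divr_gt0.
have t1 : t' <= 1 by rewrite ge_min lexx.
have te : t' * (4 * M + 4 * N + 5) <= e by rewrite -ler_pdivlMr // ge_min lexx orbT.
have [d [r [fr Sr]]] := cf _ t0; have [d' [r' [gr Tr]]] := cg _ t0.
have lS := calc_linear cf.
exists (d + d')%N, (r * r'); split=> [z zc|x].
  rewrite -tpolyM.
  have -> : f z * g z - tpoly d r z * tpoly d' r' z
    = f z * (g z - tpoly d' r' z) + (f z - tpoly d r z) * tpoly d' r' z by ring.
  have q : rnorm (tpoly d' r' z) <= N + 1.
    have := rnormB (g z) (g z - tpoly d' r' z); rewrite opprB subrKC.
    by have := gN z zc; have := gr z zc; lra.
  apply: le_trans (rnormD _ _) _.
  rewrite [rnorm (f z * _)]rnormM [rnorm (_ * tpoly _ _ _)]rnormM.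
  have := ler_pM (rnorm_ge0 _) (rnorm_ge0 _) (fM z zc) (gr z zc).
  have := ler_pM (rnorm_ge0 _) (rnorm_ge0 _) (fr z zc) q.
  have : 0 <= t' * M by rewrite mulr_ge0 ?ltW.
  have : 0 <= t' * N by rewrite mulr_ge0 ?ltW.
  lra.
rewrite -teval_comp /=; set P := teval V W d r; set Q := teval V W d' r'.
have -> : S (T x) - P (Q x) = S (T x - Q x) + (S (Q x) - P (Q x)).
  by rewrite (linear_mapB lS) subrKA.
have q : rnorm (Q x) <= 4 * (N + 1) * rnorm x.
  apply: (calc_le (f := tpoly d' r')); first exact: calc_tpoly.
    by lra.
  move=> z zc; have := rnormB (g z) (g z - tpoly d' r' z); rewrite opprB subrKC.
  by have := gN z zc; have := gr z zc; lra.
apply: le_trans (rnormD _ _) _.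
have h1 := calc_le (T x - Q x) cf (ltW M0) fM.
have h2 := Sr (Q x); have x0 := rnorm_ge0 x.
have h3 : 4 * M * rnorm (T x - Q x) <= 4 * M * (t' * rnorm x).
  by rewrite ler_wpM2l ?Tr //; lra.
have h4 : t' * rnorm (Q x) <= t' * (4 * (N + 1) * rnorm x).
  by rewrite ler_wpM2l // ltW.
have h5 := ler_wpM2r x0 te.
have : 0 <= t' * rnorm x by rewrite mulr_ge0 // ltW.
lra.
Qed.

Lemma calc_adjoint f S T : circle_continuous f -> calc f S ->
  calc (fun z => (f z)^*) T -> is_adjoint S T.
Proof.
move=> cf cS cT x y; apply/eqP.
rewrite -subr_eq0 -rnorm_eq0 eq_le rnorm_ge0 andbT.
apply/ler_addgt0Pr => e e0; rewrite add0r.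
pose c := 5 * (rnorm x * rnorm y) + 1.
have xy : 0 <= rnorm x * rnorm y by rewrite mulr_ge0 ?rnorm_ge0.
have c0 : 0 < c by rewrite ltr_wpDl // mulr_ge0.
have ec : 0 < e / c by rewrite divr_gt0.
have [d [r [fr Sr]]] := cS _ ec.
have P := @inner_psd R H.
pose A := teval V W d r; pose B := teval V W (size r) (tconj d r).
have Ty : rnorm (B y - T y) <= 4 * (e / c) * rnorm y.
  apply: (calc_dist _ (calc_tpoly _ _) cT (ltW ec)) => z zc.
  by rewrite tpoly_conj // -rmorphB rnorm_conj rnormC fr.
have -> : inner H (S x) y - inner H x (T y)
    = inner H (S x - A x) y + inner H x (B y - T y).
  rewrite (psdD P) (psdN P) (psdDr P) (psdNr P) teval_adj addrA subrK //.
apply: le_trans (rnormD _ _) _.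
apply: le_trans (lerD (cauchy_schwarz _ _) (cauchy_schwarz _ _)) _.
apply: (@le_trans _ _ (e / c * rnorm x * rnorm y
    + rnorm x * (4 * (e / c) * rnorm y))).
  by rewrite lerD ?ler_wpM2r ?ler_wpM2l ?rnorm_ge0 ?Sr.
have -> : e / c * rnorm x * rnorm y + rnorm x * (4 * (e / c) * rnorm y)
    = e - e / c.
  by rewrite /c; field; rewrite -/c gt_eqF.
by rewrite gerBl ltW.
Qed.

Lemma bounded_operatorP (T : H -> H) (c : R) : linear T ->
  (forall x, rnorm (T x) <= c * rnorm x) -> bounded_operator T.
Proof.
move=> lT bT; split=> // x; apply/cvgrPdist_lt => _ /posC_Re[e e0 ->].
have c1 : 0 < `|c| + 1 by rewrite ltr_wpDl.
apply/nbhs_normP; exists (e / (`|c| + 1))%:C%C; first by rewrite /= ltcR divr_gt0.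
move=> y; rewrite /ball_ /= !rnormE !ltcR ltr_pdivlMr // -(linear_mapB lT).
apply: le_lt_trans; apply: le_trans (bT _) _.
rewrite mulrC ler_wpM2l ?rnorm_ge0 //.
by apply: le_trans (ler_norm _) _; rewrite lerDl.
Qed.

Definition calculus f : H -> H := xget (id : H -> H) [set T | calc f T].

Lemma calculusP_ex f T : calc f T -> calc f (calculus f).
Proof. by move=> cT; apply: (xgetPex _ (P := [set T | calc f T])); exists T. Qed.

Lemma calculusP f : circle_continuous f -> calc f (calculus f).
Proof. by move=> /calc_exists[T]; exact: calculusP_ex. Qed.

Lemma calculus_eq f T : calc f T -> calculus f = T.
Proof. by move=> cf; exact: (calc_unique (calculusP_ex cf) cf). Qed.

Lemma functional_calculus_exists : functional_calculus V calculus.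
Proof.
split=> [f cf|f g cf cg fg|f g cf cg|a f cf|f g cf cg||f cf|].
- have [M M0 fM] := circle_bounded cf; have h := calculusP cf.
  apply: (@bounded_operatorP _ (4 * M)); first exact: calc_linear h.
  by move=> x; exact: calc_le h (ltW M0) fM.
- apply: (calc_unique (calculusP cf) (calculusP cg)) => z zc.
  by apply: fg; rewrite inE.
- by apply/calculus_eq/calcD; exact: calculusP.
- by apply/calculus_eq/calcZ; exact: calculusP.
- by apply/calculus_eq/calcM => //; exact: calculusP.
- apply: calculus_eq; have : calc (tpoly 0 1) (teval V W 0 1) by exact: calc_tpoly.
  have -> : teval V W 0 1 = id by apply/funext => x; rewrite /teval /= peval1.
  by move=> /calc_ext; apply => z _; rewrite /tpoly expr0 mul1r hornerC.
- apply: (calc_adjoint cf (calculusP cf)).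
  exact: calculusP (circle_continuous_conj cf).
- apply: calculus_eq; have : calc (tpoly 0 'X) (teval V W 0 'X) by exact: calc_tpoly.
  have -> : teval V W 0 'X = V.
    by apply/funext => x; rewrite /teval /= -(expr1 'X) pevalXn.
  by move=> /calc_ext; apply => z _; rewrite /tpoly expr0 mul1r hornerX.
Qed.

End TrigonometricCalculus.

(** * Contractivity of the functional calculus *)

Section FunctionalCalculus.
Context {R : realType} {H : hilbertType R} {V W : H -> H}.
Context {Phi : (R[i] -> R[i]) -> (H -> H)}.
Hypotheses (vw : unitary_pair V W) (fc : functional_calculus V Phi).
Implicit Types (f : R[i] -> R[i]) (r : {poly R[i]}).

(** Since [z * z^* = 1] on the circle, the image of conjugation is a right inverse of [V]. *)
Lemma fc_conj_coord : Phi (fun z => z^*) = W.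
Proof.
have ci := @circle_continuous_id R.
have cc : circle_continuous (fun z : R[i] => z^*) := circle_continuous_conj ci.
have h : Phi (fun z => z * z^*) = V \o Phi (fun z => z^*).
  by have E := fc_mul fc ci cc; rewrite (fc_coord fc) in E; exact: E.
have h1 : Phi (fun z => z * z^*) = id.
  rewrite -(fc_one fc); apply: (fc_ext fc).
  - exact: circle_continuousM ci cc.
  - exact: circle_continuous_cst.
  - by move=> z; rewrite inE => zc; exact: circle_mulC.
apply/funext => x; apply: (can_inj (up_K vw)); rewrite (up_VK vw).
by have := congr1 (fun T => T x) (etrans (esym h) h1).
Qed.

Lemma fc_exp f n : circle_continuous f ->
  circle_continuous (fun z => f z ^+ n) /\ Phi (fun z => f z ^+ n) = iter n (Phi f).
Proof.
move=> cf; elim: n => [|n [cn Pn]].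
  by split; [exact: circle_continuous_cst|exact: fc_one fc].
under eq_fun => z do rewrite exprS.
split; first exact: circle_continuousM.
by rewrite (fc_mul fc) // Pn.
Qed.

Lemma fc_horner r x : Phi (fun z => r.[z]) x = peval V r x.
Proof.
have X n := (fc_exp n (@circle_continuous_id R)).
have cr n : circle_continuous (fun z => \sum_(k < n) r`_k * z ^+ k).
  apply: (@circle_continuous_sum _ _ (fun k z => r`_k * z ^+ k)) => k.
  by apply: circle_continuousM; [exact: circle_continuous_cst|exact: circle_continuousX].
under eq_fun => z do rewrite horner_coef.
rewrite /peval; elim: (size r) => [|n IH].
  under eq_fun => z do rewrite big_ord0.
  have -> : (fun _ : R[i] => 0 : R[i]) = (fun z => 0 * 1).
    by apply/funext => z; rewrite mul0r.
  by rewrite (fc_scale fc) ?scale0r ?big_ord0 //; exact: circle_continuous_cst.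
under eq_fun => z do rewrite big_ord_recr /=.
have cn : circle_continuous (fun z : R[i] => r`_n * z ^+ n).
  by apply: circle_continuousM; [exact: circle_continuous_cst|exact: circle_continuousX].
rewrite (fc_add fc (cr n) cn) (fc_scale fc) ?big_ord_recr /= ?IH; last first.
  exact: circle_continuousX.
by have [_ ->] := X n; rewrite (fc_coord fc).
Qed.

Lemma fc_tpoly d r x : Phi (tpoly d r) x = teval V W d r x.
Proof.
have cc : circle_continuous (fun z : R[i] => z^*).
  exact: circle_continuous_conj (@circle_continuous_id R).
have [c1 c2] := fc_exp d cc.
have E : Phi (tpoly d r) = Phi (fun z => z^* ^+ d) \o Phi (fun z => r.[z]).
  have h := fc_mul fc c1 (@circle_continuous_horner _ r); exact: h.
by rewrite E /= fc_horner c2 fc_conj_coord.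
Qed.

(* [c^2 - |f|^2] is the square of a continuous real function. *)
Lemma fc_contractive f (c : R) x : circle_continuous f -> 0 <= c ->
  (forall z, circle R z -> rnorm (f z) <= c) -> rnorm (Phi f x) <= c * rnorm x.
Proof.
move=> cf c0 fle; pose h z : R[i] := (Num.sqrt (c ^+ 2 - rnorm (f z) ^+ 2))%:C%C.
have ch : circle_continuous h by exact: circle_continuous_sqrt.
have cJ (g : R[i] -> R[i]) : circle_continuous g ->
    circle_continuous (fun z => ((g z)^* : R[i]) * g z).
  by move=> cg; exact: circle_continuousM (circle_continuous_conj cg) cg.
have sq (g : R[i] -> R[i]) : circle_continuous g ->
    (rnorm (Phi g x) ^+ 2)%:C%C
      = inner H x (Phi (fun z => ((g z)^* : R[i]) * g z) x).
  move=> cg; have E := fc_mul fc (circle_continuous_conj cg) cg.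
  by rewrite E -inner_rnorm (fc_conj fc cg).
have E1 := sq f cf; have E2 := sq h ch.
have cs := circle_continuousD (cJ f cf) (cJ h ch).
have c1 := @circle_continuous_cst R 1.
have c2 := circle_continuousM (@circle_continuous_cst R (c ^+ 2)%:C%C) c1.
have E3 : Phi (fun z => ((f z)^* : R[i]) * f z + ((h z)^* : R[i]) * h z)
    = Phi (fun z => (c ^+ 2)%:C%C * 1).
  apply: (fc_ext fc cs c2) => z; rewrite inE => zc.
  rewrite mulr1 ![_^* * _]mulrC !mulC_conj /h rnorm_real.
  rewrite ger0_norm ?sqrtr_ge0 // sqr_sqrtr -?rmorphD ?subrKC //.
  by rewrite subr_ge0 ler_sqr ?nnegrE ?rnorm_ge0 ?fle.
(* Pairing the image of [|f|^2 + |h|^2 = c^2] with [x] gives a Pythagorean identity, hence a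
   contraction bound without the factor 4. *)
have E : (rnorm (Phi f x) ^+ 2 + rnorm (Phi h x) ^+ 2)%:C%C
    = (c ^+ 2 * rnorm x ^+ 2)%:C%C.
  have A := fc_add fc (cJ f cf) (cJ h ch); rewrite E3 in A.
  have S := fc_scale fc (c ^+ 2)%:C%C c1.
  rewrite rmorphD /= E1 E2 -(psdDr (@inner_psd R H)).
  have := congr1 (fun T => T x) A => /= <-; rewrite S (fc_one fc).
  rewrite (psdZr (@inner_psd R H)) inner_rnorm.
  have -> : ((c ^+ 2)%:C%C)^* = (c ^+ 2)%:C%C := conjc_real _.
  by rewrite -[LHS]rmorphM.
move/complexI: E => E.
rewrite -ler_sqr ?nnegrE ?rnorm_ge0 ?mulr_ge0 ?rnorm_ge0 // exprMn -E.
by rewrite lerDl sqr_ge0.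
Qed.

Lemma fc_approx f d r (e : R) x : circle_continuous f -> 0 <= e ->
  (forall z, circle R z -> rnorm (f z - tpoly d r z) <= e) ->
  rnorm (Phi f x - teval V W d r x) <= e * rnorm x.
Proof.
move=> cf e0 fr; rewrite -fc_tpoly.
have ct := @circle_continuous_tpoly R d r.
have ct' := circle_continuousM (@circle_continuous_cst R (-1)) ct.
have A := fc_add fc cf ct'; have S := fc_scale fc (-1) ct.
have -> : Phi f x - Phi (tpoly d r) x = Phi (fun z => f z + -1 * tpoly d r z) x.
  by rewrite A S scaleN1r.
have := fc_contractive x (circle_continuousD cf ct') e0; apply=> z zc.
by rewrite mulN1r fr.
Qed.

End FunctionalCalculus.

(** [fun_op] selects an unspecified calculus. The constructed one shows that there is something to
    select; the estimate holds for whichever [Phi] is selected. *)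
Lemma fun_op_approx (R : realType) (H : hilbertType R) (V W : H -> H)
    (f : R[i] -> R[i]) d r (e : R) x :
  unitary_pair V W -> circle_continuous f -> 0 <= e ->
  (forall z, circle R z -> rnorm (f z - tpoly d r z) <= e) ->
  rnorm (fun_op f V x - teval V W d r x) <= e * rnorm x.
Proof.
move=> vw cf e0 fr.
have [Phi fc ->] : exists2 Phi, functional_calculus V Phi & fun_op f V = Phi f.
  apply: (xgetPex (id : H -> H)
    (P := [set T | exists2 Phi, functional_calculus V Phi & T = Phi f])).
  exists (calculus (V := V) (W := W) f); exists (calculus (V := V) (W := W)) => //.
  exact: functional_calculus_exists.
exact: fc_approx.
Qed.

(** * Jackson's approximation theorem *)

Section Jackson.
Context {R : realType}.
Implicit Types (p q : {poly R[i]}) (z tau : R[i]).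

(** On the circle this is the character [z^(i - d)], its integer exponent being given by two natural
    numbers. *)
Definition trig_monomial d i z : R[i] := (z^* : R[i]) ^+ d * z ^+ i.

Lemma trig_monomialM d i z w :
  trig_monomial d i (z * w) = trig_monomial d i z * trig_monomial d i w.
Proof. by rewrite /trig_monomial rmorphM /= !exprMn mulrACA. Qed.

Lemma tpoly_sum d q z : tpoly d q z = \sum_(i < size q) q`_i * trig_monomial d i z.
Proof.
rewrite /tpoly horner_coef mulr_sumr; apply: eq_bigr => i _.
by rewrite mulrCA.
Qed.

(** Characters are eigenfunctions of rotations, so each difference multiplies the [i]-th coefficient
    by [tau^(i - d) - 1]. *)
Lemma iter_rot_diff_tpoly n tau d q :
  iter n (rot_diff tau) (tpoly d q) = fun z => \sum_(i < size q)
    q`_i * (trig_monomial d i tau - 1) ^+ n * trig_monomial d i z.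
Proof.
elim: n => [|n IH] /=.
  by apply/funext => z; rewrite tpoly_sum; apply: eq_bigr => i _; rewrite mulr1.
rewrite IH; apply/funext => z; rewrite /rot_diff -sumrB; apply: eq_bigr => i _.
by rewrite trig_monomialM exprSr; ring.
Qed.

Lemma iter_rot_diff_dist n tau (f g : R[i] -> R[i]) (e : R) z :
  circle R tau -> circle R z ->
  (forall z, circle R z -> rnorm (f z - g z) <= e) ->
  rnorm (iter n (rot_diff tau) f z - iter n (rot_diff tau) g z) <= 2 ^+ n * e.
Proof.
move=> tc zc fg; elim: n z zc => [|n IH] z zc; first by rewrite mul1r fg.
rewrite !iterS /rot_diff.
set F := iter n _ f; set G := iter n _ g.
have -> : F (tau * z) - F z - (G (tau * z) - G z)
    = (F (tau * z) - G (tau * z)) - (F z - G z) by ring.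
apply: le_trans (rnormB _ _) _; have := IH _ (circleM tc zc); have := IH _ zc.
by rewrite exprS -mulrA -/F -/G; lra.
Qed.

(** Autocorrelations of the coefficients of [p] at lag [a - b], up to aliasing modulo [M]. Lag 0
    gives Parseval's identity, large lags the vanishing moments of the Jackson kernel. *)
Lemma sum_prim_root_sqr M (w : R[i]) p a b : M.-primitive_root w ->
  \sum_(k < M) (w ^+ k) ^+ a * ((w ^+ k)^* : R[i]) ^+ b
     * (rnorm p.[w ^+ k] ^+ 2)%:C%C
  = \sum_(u < size p) \sum_(v < size p) p`_u * (p`_v)^* *
      (if (u + a == v + b %[mod M])%N then M%:R else 0).
Proof.
move=> wP.
under eq_bigr => k _ do rewrite -mulC_conj horner_coef rmorph_sum mulr_suml mulr_sumr.
rewrite exchange_big; apply: eq_bigr => u _ /=.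
under eq_bigr => k _ do rewrite !mulr_sumr.
rewrite exchange_big; apply: eq_bigr => v _ /=.
rewrite -(sum_prim_root wP) mulr_sumr; apply: eq_bigr => k _.
by move: (w ^+ k) => z; rewrite rmorphM rmorphXn /= !exprD; ring.
Qed.

Lemma parseval M (w : R[i]) p : M.-primitive_root w -> (size p <= M)%N ->
  \sum_(k < M) rnorm p.[w ^+ k] ^+ 2 = M%:R * \sum_(u < size p) rnorm p`_u ^+ 2.
Proof.
move=> wP pM; have := @sum_prim_root_sqr M w p 0 0 wP.
under eq_bigr => k _ do rewrite !expr0 !mul1r.
move=> h; apply: (@complexI R).
rewrite rmorphM /= rmorph_nat !rmorph_sum /= h mulr_sumr; apply: eq_bigr => u _.
rewrite (bigD1 u) //= big1 ?addr0 => [|v vu].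
  by rewrite eqxx mulC_conj mulrC.
rewrite !addn0 !modn_small ?(leq_trans (ltn_ord _) pM) //.
by rewrite -(inj_eq val_inj) /= eq_sym in vu; rewrite (negPf vu) mulr0.
Qed.

Lemma sum_sqr_le n (a : 'I_n -> R) :
  (\sum_(i < n) a i) ^+ 2 <= n%:R * \sum_(i < n) a i ^+ 2.
Proof.
case: n a => [|n] a; first by rewrite !big_ord0 expr0n mulr0.
have n0 : 0 < n.+1%:R :> R by rewrite ltr0n.
set T := \sum_(i < n.+1) a i; set Q := \sum_(i < n.+1) _.
have : 0 <= \sum_(i < n.+1) (a i - T / n.+1%:R) ^+ 2.
  by apply: sumr_ge0 => i _; rewrite sqr_ge0.
under eq_bigr => i _ do rewrite sqrrB.
rewrite big_split sumrB /= sumrMnl -mulr_suml sumr_const card_ord -/T -/Q.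
have -> : Q - T * (T / n.+1%:R) *+ 2 + (T / n.+1%:R) ^+ 2 *+ n.+1
    = (n.+1%:R * Q - T ^+ 2) / n.+1%:R.
  by rewrite -[_ *+ n.+1]mulr_natr; field; rewrite gt_eqF.
by rewrite pmulr_lge0 ?invr_gt0 // subr_ge0.
Qed.

Definition dirichlet N : {poly R[i]} := \sum_(j < N) 'X^j.

Lemma size_dirichlet N : (size (dirichlet N) <= N)%N.
Proof.
apply: (leq_trans (size_sum _ _ _)); apply/bigmax_leqP => j _.
by rewrite size_polyXn.
Qed.

Lemma size_dirichletX N m :
  (size (dirichlet N ^+ m) <= (N.-1 * m).+1)%N.
Proof.
apply: leq_trans (size_poly_exp_leq _ _) _; rewrite ltnS leq_mul2r.
by apply/orP; right; have := size_dirichlet N; case: (size _) => //= k; case: N.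
Qed.

Lemma horner_dirichlet N z : (z - 1) * (dirichlet N).[z] = z ^+ N - 1.
Proof.
by rewrite subrX1 horner_sum; congr (_ * _); apply: eq_bigr => j _; rewrite hornerXn.
Qed.

(** Reduces a moment of real order to the mass and a moment of integer order. *)
Lemma powR_le_expn (alpha x : R) k : 0 < alpha -> alpha <= k%:R -> 0 <= x ->
  x `^ alpha <= 1 + x ^+ k.
Proof.
move=> a0 ak x0; have [x1|x1] := leP x 1.
  apply: (@le_trans _ _ 1); last by rewrite lerDl exprn_ge0.
  have e : 1 `^ alpha = 1 :> R by rewrite powR1.
  by rewrite -[leRHS]e; apply: ge0_ler_powR; rewrite ?nnegrE // ltW.
apply: (@le_trans _ _ (x ^+ k)); last by rewrite lerDr.
by rewrite -powR_mulrn // ler_powR // ltW.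
Qed.

(** The 1 bounds the part of the moment near [tau = 1]; the rest is [kernel_moment] divided by the
    lower bound [kernel_mass]. *)
Definition jackson_const m : R := 1 + 4 ^+ m * m.+1%:R.

Lemma jackson_const_gt0 m : 0 < jackson_const m.
Proof. by rewrite ltr_pwDl // mulr_ge0 ?exprn_ge0. Qed.

Section Kernel.
Context {N m M : nat} {w : R[i]}.
Hypotheses (N_gt0 : (0 < N)%N) (wP : M.-primitive_root w).
Hypothesis NM : (N * m.+1 <= M)%N.

(** With [w ^+ k = e^(it)] this is the unnormalised Jackson kernel
    [(sin(N t / 2) / sin(t / 2))^(2m + 2)]. *)
Definition kernel k : R := rnorm (dirichlet N ^+ m.+1).[w ^+ k] ^+ 2.

Let size_kernel : (size (dirichlet N ^+ m.+1) <= N * m.+1)%N.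
Proof.
apply: leq_trans (size_dirichletX _ _) _.
by case: N N_gt0 => // n _; rewrite mulSn /= addSn ltnS leq_addl.
Qed.

(** Parseval's identity turns the mass into a sum of squared coefficients. There are at most
    [N * m.+1] of them, and their sum is the value [N^(m+1)] at 1, so Cauchy-Schwarz bounds that sum
    from below. *)
Lemma kernel_mass : M%:R * (N%:R ^+ m.+1) ^+ 2 <= (N * m.+1)%:R * \sum_(k < M) kernel k.
Proof.
rewrite parseval ?(leq_trans size_kernel) // [leRHS]mulrCA ler_wpM2l //.
have := size_kernel; set p := dirichlet N ^+ m.+1 => sp.
have p1 : p.[1] = N%:R ^+ m.+1.
  rewrite horner_exp horner_sum; congr (_ ^+ _).
  by under eq_bigr => j _ do rewrite hornerXn expr1n; rewrite sumr_const card_ord.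
have -> : N%:R ^+ m.+1 = rnorm p.[1] by rewrite p1 rnormX rnorm_nat.
apply: (@le_trans _ _ ((\sum_(u < size p) rnorm p`_u) ^+ 2)).
  rewrite lerXn2r ?nnegrE ?rnorm_ge0 ?sumr_ge0 // => [i _|]; first exact: rnorm_ge0.
  rewrite horner_coef; apply: le_trans (rnorm_sum _ _ _) _.
  by apply: ler_sum => u _; rewrite expr1n mulr1.
apply: le_trans (sum_sqr_le _) _; rewrite ler_wpM2r ?ler_nat //.
by apply: sumr_ge0 => i _; rewrite sqr_ge0.
Qed.

Lemma kernel_mass_gt0 : 0 < \sum_(k < M) kernel k.
Proof.
have M_gt0 := prim_order_gt0 wP.
have : 0 < (N * m.+1)%:R * \sum_(k < M) kernel k.
  by apply: lt_le_trans kernel_mass; rewrite mulr_gt0 ?exprn_gt0 ?ltr0n.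
by rewrite pmulr_rgt0 // ltr0n muln_gt0 N_gt0.
Qed.

(* [(1 - X) * dirichlet N = 1 - X^N] cancels all but one Dirichlet factor, and
   Parseval's identity evaluates what is left. *)
Lemma kernel_moment : \sum_(k < M) rnorm (1 - w ^+ k) ^+ (m + m) * kernel k
  <= 4 ^+ m * (M%:R * N%:R).
Proof.
have wc k : circle R (w ^+ k) by apply: circleX; exact: prim_root_circle wP.
have E2 : \sum_(k < M) rnorm (dirichlet N).[w ^+ k] ^+ 2 = M%:R * N%:R.
  have sN : (size (dirichlet N) <= M)%N.
    by rewrite (leq_trans (size_dirichlet N)) // (leq_trans _ NM) // leq_pmulr.
  have sE : size (dirichlet N) = N.
    rewrite /dirichlet; case: N N_gt0 => // n _.
    rewrite big_ord_recr /= addrC size_polyDl ?size_polyXn //.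
    by rewrite ltnS size_dirichlet.
  rewrite parseval // sE; congr (_ * _).
  rewrite (eq_bigr (fun=> 1)) ?sumr_const ?card_ord // => u _.
  rewrite /dirichlet coef_sum (bigD1 u) //= coefXn eqxx big1 ?addr0 ?rnorm1 ?expr1n //.
  by move=> v vu; rewrite coefXn -(inj_eq val_inj) /= eq_sym in vu *; rewrite (negPf vu).
rewrite -E2 mulr_sumr; apply: ler_sum => k _.
rewrite /kernel horner_exp rnormX.
set a := rnorm (1 - w ^+ k); set b := rnorm (dirichlet N).[w ^+ k].
have ab : a * b <= 2.
  rewrite -rnormM -rnormN -mulNr opprB horner_dirichlet.
  apply: le_trans (rnormB _ _) _; rewrite rnorm1.
  by have /circleP -> : circle R (w ^+ k ^+ N) by exact: circleX.
have a0 : 0 <= a := rnorm_ge0 _; have b0 : 0 <= b := rnorm_ge0 _.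
have -> : a ^+ (m + m) * (b ^+ m.+1) ^+ 2 = ((a * b) ^+ m) ^+ 2 * b ^+ 2.
  by rewrite exprD [b ^+ m.+1]exprS !exprMn; ring.
have -> : 4 ^+ m = (2 ^+ m) ^+ 2 :> R by rewrite exprAC; congr (_ ^+ m); rewrite -natrX.
rewrite ler_wpM2r ?sqr_ge0 // !lerXn2r ?nnegrE ?exprn_ge0 ?mulr_ge0 //.
Qed.

(** Apply [powR_le_expn] with exponent [m + m] to [N |1 - w^k|]: the kernel is concentrated at
    distance about [1 / N] from 1. *)
Lemma kernel_powR_moment (alpha : R) : 0 < alpha -> alpha <= m%:R ->
  \sum_(k < M) rnorm (1 - w ^+ k) `^ alpha * kernel k
    <= jackson_const m * N%:R `^ (- alpha) * \sum_(k < M) kernel k.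
Proof.
move=> a0 am; have N0 : 0 < N%:R :> R by rewrite ltr0n.
have M0 : 0 < M%:R :> R by rewrite ltr0n (prim_order_gt0 wP).
have k0 k : 0 <= kernel k by rewrite sqr_ge0.
have NaP := powR_gt0 alpha N0.
have -> : jackson_const m * N%:R `^ (- alpha) * \sum_(k < M) kernel k
  = (jackson_const m * \sum_(k < M) kernel k) / N%:R `^ alpha.
  by rewrite powRN; ring.
rewrite ler_pdivlMr // mulr_suml.
apply: (@le_trans _ _ (\sum_(k < M) (kernel k
    + N%:R ^+ (m + m) * (rnorm (1 - w ^+ k) ^+ (m + m) * kernel k)))).
  apply: ler_sum => k _; rewrite mulrAC -powRM ?rnorm_ge0 ?ler0n //.
  have -> : kernel k + N%:R ^+ (m + m) * (rnorm (1 - w ^+ k) ^+ (m + m) * kernel k)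
    = (1 + (rnorm (1 - w ^+ k) * N%:R) ^+ (m + m)) * kernel k.
    by rewrite exprMn; ring.
  rewrite ler_wpM2r // powR_le_expn ?mulr_ge0 ?rnorm_ge0 ?ler0n //.
  by apply: le_trans am _; rewrite ler_nat leq_addr.
rewrite big_split /= -mulr_sumr /jackson_const mulrDl mul1r lerD2l.
have h1 := kernel_moment.
have h2 := kernel_mass; rewrite natrM in h2.
have Nm : 0 <= N%:R ^+ (m + m) :> R by rewrite exprn_ge0 // ltW.
apply: le_trans (ler_wpM2l Nm h1) _.
rewrite mulrCA -mulrA ler_wpM2l ?exprn_ge0 //.
rewrite -(ler_pM2l N0); apply: le_trans (le_trans _ h2) _; last by rewrite mulrA.
have -> : N%:R * (N%:R ^+ (m + m) * (M%:R * N%:R)) = M%:R * (N%:R ^+ m.+1) ^+ 2 :> R.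
  by rewrite [N%:R ^+ m.+1]exprS exprD; ring.
by [].
Qed.

End Kernel.

(* [q - q'] is, up to sign, the average of [Delta_tau^n] over roots of unity
   [tau] weighted by the Jackson kernel: the terms [f (tau^j z)], [j > 0], of the
   difference average to trigonometric polynomials of degree at most
   [N.-1 * m.+1], the [i]-th coefficient belonging to the frequency [i - d]. *)
Lemma jackson n m (alpha : R) d q (B e : R) N :
  0 < alpha -> alpha <= m%:R -> (0 < N)%N -> 0 <= B ->
  (forall tau z, circle R tau -> circle R z ->
     rnorm (iter n (rot_diff tau) (tpoly d q) z)
       <= B * rnorm (1 - tau) `^ alpha + e) ->
  exists q', (forall i, (i + N.-1 * m.+1 < d)%N || (d + N.-1 * m.+1 < i)%N ->
                q'`_i = 0)
    /\ forall z, circle R z ->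
         rnorm (tpoly d (q - q') z)
           <= jackson_const m * N%:R `^ (- alpha) * B + e.
Proof.
move=> a0 am N_gt0 B0 hq; set D := (N.-1 * m.+1)%N.
(* Large enough for all exponents compared in [orth] to lie below [M], so that congruence modulo [M]
   means equality. *)
pose M := (N * m.+1 + n * (size q + d) + 1)%N.
have M_gt0 : (0 < M)%N by rewrite /M addn1.
have [w wP] := @prim_root_exists R M M_gt0.
have NM : (N * m.+1 <= M)%N by rewrite /M -addnA leq_addr.
have wc k : circle R (w ^+ k) by apply: circleX; exact: prim_root_circle wP.
pose K k : R := kernel (N := N) (m := m) (w := w) k.
have K0 k : 0 <= K k by rewrite sqr_ge0.
pose S := \sum_(k < M) K k.
have S0 : 0 < S by exact: kernel_mass_gt0 N_gt0 wP NM.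
have SC : S%:C%C != 0 :> R[i] by rewrite -rnorm_eq0 rnorm_real normr_eq0 gt_eqF.
pose x i k : R[i] := trig_monomial d i (w ^+ k).
(* The signed average of the differences multiplies the [i]-th coefficient by [mu i]. Beyond
   frequency [D] only the term [j = 0] of the binomial expansion survives, so there [mu i = 1] and
   [q'] has no coefficient. *)
pose mu i : R[i] := (S%:C%C)^-1 * \sum_(k < M) (K k)%:C%C * (1 - x i k) ^+ n.
pose q' : {poly R[i]} := \poly_(i < size q) (q`_i * (1 - mu i)).
have orth i j : (i < size q)%N -> (i + D < d)%N || (d + D < i)%N ->
    (0 < j)%N -> (j <= n)%N -> \sum_(k < M) (K k)%:C%C * x i k ^+ j = 0.
  move=> iq iD j0 jn; set p := dirichlet N ^+ m.+1.
  have := sum_prim_root_sqr p (i * j) (d * j) wP.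
  rewrite [RHS]big1 => [h|u _]; last first.
    rewrite big1 // => v _.
    have sp : (size p <= D.+1)%N by exact: size_dirichletX.
    have ub : (u <= D)%N by rewrite -ltnS (leq_trans (ltn_ord u) sp).
    have vb : (v <= D)%N by rewrite -ltnS (leq_trans (ltn_ord v) sp).
    have DN : (D < N * m.+1)%N by rewrite /D; case: (N) N_gt0 => //= N' _; nia.
    rewrite !modn_small; last 2 first.
    - by rewrite /M; nia.
    - by rewrite /M; nia.
    (* Equality would mean [(i - d) * j = v - u] with [j > 0], whereas [|i - d| > D >= |v - u|]. *)
    case: eqP => [e1|_]; last by rewrite mulr0.
    by exfalso; case/orP: iD => iD; nia.
  rewrite -[RHS]h; apply: eq_bigr => k _; rewrite mulrC; congr (_ * _).
  by rewrite /x /trig_monomial exprMn mulrC !exprM.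
exists q'; split=> [i iD|z zc].
  rewrite coef_poly; case: ltnP => // iq.
  suff -> : mu i = 1 by rewrite subrr mulr0.
  rewrite /mu; suff -> : \sum_(k < M) (K k)%:C%C * (1 - x i k) ^+ n = S%:C%C.
    by rewrite mulVf.
  under eq_bigr => k _ do rewrite exprBn mulr_sumr.
  rewrite exchange_big /= (big_ord_recl n) /= [X in _ + X]big1 ?addr0 => [|j _].
    by rewrite /S rmorph_sum; apply: eq_bigr => k _; rewrite !expr0 expr1n !mulr1 bin0 mulr1n mulr1.
  have := orth i (bump 0 j) iq iD isT (ltn_ord j) => h.
  rewrite -[RHS](mulr0 ((-1) ^+ bump 0 j *+ 'C(n, bump 0 j))) -[in RHS]h mulr_sumr.
  apply: eq_bigr => k _.
  by rewrite expr1n mulr1 mulrnAr mulrnAl mulrCA.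
have -> : tpoly d (q - q') z = (S%:C%C)^-1 * \sum_(k < M) (K k)%:C%C
    * ((-1) ^+ n * iter n (rot_diff (w ^+ k)) (tpoly d q) z).
  have -> : q - q' = \poly_(i < size q) (q`_i * mu i).
    apply/polyP => i; rewrite coefB !coef_poly; case: ltnP => iq.
      by ring.
    by rewrite nth_default // subr0.
  rewrite /tpoly horner_poly !mulr_sumr.
  under [RHS]eq_bigr => k _ do rewrite -/(tpoly d q) iter_rot_diff_tpoly !mulr_sumr.
  rewrite [RHS]exchange_big; apply: eq_bigr => i _ /=.
  rewrite /mu !mulr_sumr mulr_suml mulr_sumr; apply: eq_bigr => k _.
  have -> : (1 - x i k) ^+ n = (-1) ^+ n * (x i k - 1) ^+ n.
    by rewrite -exprMn mulN1r opprB.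
  by rewrite /x /trig_monomial; ring.
rewrite rnormM rnormV rnorm_real gtr0_norm // mulrC ler_pdivrMr //.
apply: le_trans (rnorm_sum _ _ _) _.
apply: (@le_trans _ _ (\sum_(k < M) (B * (rnorm (1 - w ^+ k) `^ alpha * K k) + e * K k))).
  apply: ler_sum => k _.
  rewrite rnormM rnormM rnorm_sign mul1r rnorm_real ger0_norm //.
  rewrite mulrA -mulrDl mulrC ler_wpM2r // hq //.
rewrite big_split /= -!mulr_sumr -/S mulrDl lerD2r.
have := kernel_powR_moment N_gt0 wP NM a0 am; rewrite -/S => h.
apply: le_trans (ler_wpM2l B0 h) _.
by rewrite -/S [leRHS]mulrAC mulrC mulrAC.
Qed.

End Jackson.

(** * The Hoelder estimate *)

Lemma outside_widen D D' d j : (D <= D')%N ->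
  (j + D' < d)%N || (d + D' < j)%N -> (j + D < d)%N || (d + D < j)%N.
Proof. by lia. Qed.

Section OperatorDifferences.
Context {R : realType} {H : hilbertType R} (U W A : H -> H) (s : R).
Hypotheses (uw : unitary_pair U W) (lA : linear A) (sa : is_adjoint A A).
Hypotheses (s_gt0 : 0 < s) (sA : forall x, rnorm (A x) <= s * rnorm x).
Context (m : nat).
Hypothesis m_gt0 : (0 < m)%N.

Let V := rotated U A.
Let V' := rotatedV W A.
Let vw k : unitary_pair (V k) (V' k) := rotated_pair uw lA sa s_gt0 sA k.

Definition trig_diff d (p : {poly R[i]}) (x : H) : H :=
  binomial_diff m (fun k => teval (V k) (V' k) d p x).

Lemma trig_diffD d p q x : trig_diff d (p + q) x = trig_diff d p x + trig_diff d q x.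
Proof.
rewrite /trig_diff /binomial_diff -big_split; apply: eq_bigr => k _ /=.
rewrite -scalerDr /teval pevalD (linear_mapD (linear_iter _ _)) //.
exact: up_linearV (vw k).
Qed.

Lemma trig_diff_sum d n (p : nat -> {poly R[i]}) x :
  trig_diff d (\sum_(i < n) p i) x = \sum_(i < n) trig_diff d (p i) x.
Proof.
elim: n => [|n IH]; last by rewrite !big_ord_recr trig_diffD IH.
rewrite !big_ord0 /trig_diff /binomial_diff big1 // => k _.
rewrite /teval peval0 (linear_map0 (linear_iter _ _)) ?scaler0 //.
exact: up_linearV (vw k).
Qed.

Lemma trig_diff_le d p (K : R) x : 0 < K ->
  (forall z : R[i], circle R z -> rnorm (tpoly d p z) <= K) ->
  rnorm (trig_diff d p x) <= 2 ^+ m * (4 * K * rnorm x).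
Proof.
move=> K0 pK; apply: binomial_diff_le => k; apply: teval_le => // z zc.
by rewrite -(@rnorm_tpoly _ d) // pK.
Qed.

(** The shift [d], inherited from the approximation of [f], may far exceed the true degree [D].
    Dividing or multiplying by a power of [X] changes the shift to [D], so that only [D] enters the
    bound. *)
Lemma trig_diff_bernstein d D (p : {poly R[i]}) (K : R) x : 0 < K ->
  (forall i, (i + D < d)%N || (d + D < i)%N -> p`_i = 0) ->
  (forall z : R[i], circle R z -> rnorm (tpoly d p z) <= K) ->
  rnorm (trig_diff d p x) <= bernstein_const m * K * (D%:R * s) ^+ m * rnorm x.
Proof.
move=> K0 pD pK.
have sp : (size p <= (d + D).+1)%N.
  by apply/leq_sizeP => i iD; apply: pD; rewrite iD orbT.
suff [r [sr rE re]] : exists r : {poly R[i]}, [/\ (size r <= (D + D).+1)%N,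
    forall z, circle R z -> tpoly D r z = tpoly d p z &
    forall k x, teval (V k) (V' k) D r x = teval (V k) (V' k) d p x].
  have -> : trig_diff d p x = binomial_diff m (fun k => teval (V k) (V' k) D r x).
    by apply: eq_bigr => k _; rewrite re.
  apply: operator_bernstein => // z zc.
  by rewrite -(@rnorm_tpoly _ D) // rE // pK.
have [Dd|dD] := leqP D d.
  exists (drop_poly (d - D) p); have pE : p = 'X^(d - D) * drop_poly (d - D) p.
    rewrite -{1}(poly_take_drop (d - D) p) mulrC.
    rewrite (_ : take_poly _ _ = 0) ?add0r //.
    apply/polyP => i; rewrite coef_take_poly coef0; case: ltnP => // iD.
    by apply: pD; lia.
  split=> [|z zc|k y].
  - by rewrite size_drop_poly; lia.
  - by rewrite -(@tpoly_shift _ D (d - D)) // -pE subnK.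
  - by rewrite -(@teval_shift _ _ _ _ (vw k) D (d - D)) -pE subnK.
exists ('X^(D - d) * p); split=> [|z zc|k y].
- apply: leq_trans (size_polyMleq _ _) _; rewrite size_polyXn; lia.
- by rewrite -{1}(subnK (ltnW dD)) tpoly_shift.
- by rewrite -{1}(subnK (ltnW dD)) (teval_shift (vw k)).
Qed.

Definition dyadic_ratio (alpha : R) : R := 2 `^ (m%:R - alpha).

(** The first summand accounts for [q - p I], the second for the increments [p i.+1 - p i]: 2 for
    their two approximation errors, [2 * m.+1] for their degree [2^(i+1) * m.+1], and a geometric
    sum that blows up as [alpha] tends to [m]. *)
Definition holder_const (alpha : R) : R := 2 ^+ m * 4 * jackson_const m
  + 2 * bernstein_const m * (2 * m.+1%:R) ^+ m * jackson_const m
    * (dyadic_ratio alpha / (dyadic_ratio alpha - 1)).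

Lemma dyadic_ratio_gt1 alpha : alpha < m%:R -> 1 < dyadic_ratio alpha.
Proof.
move=> am; have e : 1 `^ (m%:R - alpha) = 1 :> R by rewrite powR1.
rewrite /dyadic_ratio -[ltLHS]e; apply: gt0_ltr_powR; rewrite ?nnegrE ?subr_gt0 //.
by rewrite ltr1n.
Qed.

Lemma holder_const_gt0 alpha : alpha < m%:R -> 0 < holder_const alpha.
Proof.
move=> am; have b1 := dyadic_ratio_gt1 am.
have j0 := @jackson_const_gt0 R m; have p0 := @bernstein_const_gt0 R m.
rewrite addr_gt0 ?mulr_gt0 ?exprn_gt0 ?invr_gt0 ?subr_gt0 //.
exact: lt_trans ltr01 b1.
Qed.

(** Minimality of [I] matters: it keeps [s * 2^i] below 1 for every increment. For [s >= 1] it gives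
    [I = 0], hence no increments. *)
Lemma dyadic_scale : exists I : nat, 1 <= s * 2 ^+ I /\
  forall i, (i < I)%N -> s * 2 ^+ i < 1.
Proof.
have ex : exists I, 1 <= s * 2 ^+ I.
  exists (Num.truncn s^-1).+1.
  rewrite -ler_pdivrMl // mulr1; apply: le_trans (ltW (truncnS_gt _)) _.
  by rewrite -natrX ler_nat ltnW // ltn_expl.
exists (ex_minn ex); case: ex_minnP => I I1 Imin; split=> // i iI.
by rewrite ltNge; apply/negP => /Imin; rewrite leqNgt iI.
Qed.

(** The terms form a geometric progression of ratio greater than 1, so the last one dominates; there
    [s * 2^i < 1] trades [s^(m - alpha)] for the power of 2. *)
Lemma dyadic_sum_le alpha I : alpha < m%:R ->
  (forall i, (i < I)%N -> s * 2 ^+ i < 1) ->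
  s ^+ m * \sum_(i < I) (2 ^+ i) `^ (- alpha) * (2 ^+ i) ^+ m
    <= dyadic_ratio alpha / (dyadic_ratio alpha - 1) * s `^ alpha.
Proof.
move=> am hI; set b := dyadic_ratio alpha.
have b1 : 1 < b := dyadic_ratio_gt1 am.
have b0 : 0 < b := lt_trans ltr01 b1.
have rhs0 : 0 <= b / (b - 1) * s `^ alpha.
  by rewrite mulr_ge0 ?powR_ge0 // divr_ge0 ?(ltW b0) // subr_ge0 ltW.
have bE i : b ^+ i = (2 ^+ i) `^ (m%:R - alpha).
  have -> : b ^+ i = b `^ i%:R by rewrite powR_mulrn // ltW.
  have -> : 2 ^+ i = 2 `^ i%:R :> R by rewrite powR_mulrn.
  by rewrite -!powRrM mulrC.
have E i : (2 ^+ i) `^ (- alpha) * (2 ^+ i) ^+ m = b ^+ i.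
  have i0 : 2 ^+ i != 0 :> R by rewrite expf_neq0.
  rewrite bE addrC powRD ?i0 ?implybT //; congr (_ * _).
  by rewrite powR_mulrn // exprn_ge0.
under eq_bigr => i _ do rewrite E.
case: I hI => [|I] hI; first by rewrite big_ord0 mulr0.
have S : \sum_(i < I.+1) b ^+ i <= b ^+ I.+1 / (b - 1).
  rewrite ler_pdivlMr ?subr_gt0 // mulrC -subrX1; lra.
have s0 := exprn_ge0 m (ltW s_gt0).
apply: le_trans (ler_wpM2l s0 S) _.
have -> : s ^+ m * (b ^+ I.+1 / (b - 1)) = b / (b - 1) * (s ^+ m * b ^+ I).
  by rewrite exprS; ring.
rewrite ler_wpM2l ?divr_ge0 ?subr_ge0 ?(ltW b0) ?(ltW b1) //.
have -> : s ^+ m = s `^ alpha * s `^ (m%:R - alpha).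
  rewrite -powRD; last by rewrite (gt_eqF s_gt0) implybT.
  by rewrite addrC subrK powR_mulrn // ltW.
rewrite -mulrA ler_piMr ?powR_ge0 //.
rewrite bE.
rewrite -powRM ?exprn_ge0 ?(ltW s_gt0) //.
have e : 1 `^ (m%:R - alpha) = 1 :> R by rewrite powR1.
rewrite -[leRHS]e; apply: ge0_ler_powR; rewrite ?nnegrE ?subr_ge0 ?(ltW am) //.
  by rewrite mulr_ge0 ?exprn_ge0 // ltW.
exact: ltW (hI I (ltnSn I)).
Qed.

(* [f] is split as [(f - q) + (q - p I) + \sum_(i < I) (p i.+1 - p i) + p 0], the
   [p i] being Jackson approximants of degree about [2^i] and [2^I] about [1/s];
   the constant [p 0] contributes nothing. *)
Lemma holder_estimate n (alpha B : R) (f : R[i] -> R[i]) x :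
  0 < alpha -> alpha < m%:R -> 0 <= B -> circle_continuous f ->
  (forall tau z, circle R tau -> circle R z ->
     rnorm (iter n (rot_diff tau) f z) <= B * rnorm (1 - tau) `^ alpha) ->
  rnorm (binomial_diff m (fun k => fun_op f (V k) x))
    <= holder_const alpha * B * s `^ alpha * rnorm x.
Proof.
move=> a0 am B0 cf hf.
have [I [I1 hI]] := dyadic_scale.
set J : R := jackson_const m; set P : R := bernstein_const m.
have J0 : 0 < J := @jackson_const_gt0 R m.
have P0 : 0 < P := @bernstein_const_gt0 R m.
pose Q := 2 * P * (2 * m.+1%:R) ^+ m.
have Q0 : 0 < Q by rewrite !mulr_gt0 ?exprn_gt0 ?mulr_gt0.
(* The coefficients of [e] from [f - q], from [q - p I] and from the increments. [Z] is fixed before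
   [e], whereas [d], [q] and [p] depend on it. *)
pose Z := 2 ^+ m + 2 ^+ m * 4 * 2 ^+ n
  + Q * 2 ^+ n * (s ^+ m * \sum_(i < I) (2 ^+ i) ^+ m).
have x0 := rnorm_ge0 x.
have Z0 : 0 <= Z.
  rewrite !addr_ge0 ?mulr_ge0 ?exprn_ge0 ?(ltW Q0) ?(ltW s_gt0) //.
  by apply: sumr_ge0 => i _; rewrite !exprn_ge0.
suff key e : 0 < e -> rnorm (binomial_diff m (fun k => fun_op f (V k) x))
    <= holder_const alpha * B * s `^ alpha * rnorm x + e * (Z * rnorm x).
  apply/ler_addgt0Pr => e e0.
  have Zx : 0 < Z * rnorm x + 1 by rewrite ltr_wpDl ?mulr_ge0.
  apply: le_trans (key (e / (Z * rnorm x + 1)) _) _; first by rewrite divr_gt0.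
  by rewrite lerD2l mulrAC ler_pdivrMr // ler_pM2l // lerDl.
move=> e0; have [d [q fq]] := tpoly_dense cf e0.
have e2 : 0 < 2 ^+ n * e by rewrite mulr_gt0 ?exprn_gt0.
have hq tau z : circle R tau -> circle R z ->
    rnorm (iter n (rot_diff tau) (tpoly d q) z)
      <= B * rnorm (1 - tau) `^ alpha + 2 ^+ n * e.
  move=> tc zc; have := hf tau z tc zc.
  have := iter_rot_diff_dist n tc zc fq.
  set a := iter n _ f z; set b := iter n _ _ z => h1 h2.
  have := rnormB a (a - b); rewrite opprB subrKC => h.
  by apply: le_trans h _; rewrite lerD.
have /choice[p hp] : forall i : nat, exists q' : {poly R[i]},
    (forall j, (j + (2 ^ i).-1 * m.+1 < d)%N || (d + (2 ^ i).-1 * m.+1 < j)%N ->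
       q'`_j = 0)
    /\ forall z, circle R z -> rnorm (tpoly d (q - q') z)
         <= J * (2 ^+ i) `^ (- alpha) * B + 2 ^+ n * e.
  by move=> i; rewrite -natrX; apply: (jackson a0 (ltW am) _ B0 hq); rewrite expn_gt0.
pose K i := J * (2 ^+ i) `^ (- alpha) * B + 2 ^+ n * e.
have K0 i : 0 < K i by rewrite ltr_wpDl // !mulr_ge0 ?powR_ge0 // ltW.
have K_nd i : K i.+1 <= K i.
  rewrite lerD2r ler_wpM2r // ler_wpM2l ?(ltW J0) // !powRN lef_pV2 ?posrE ?powR_gt0 ?exprn_gt0 //.
  apply: ge0_ler_powR; rewrite ?nnegrE ?exprn_ge0 ?(ltW a0) //.
  by rewrite exprS ler_peMl ?exprn_ge0 // ler1n.
have E : q = (q - p I) + \sum_(i < I) (p i.+1 - p i) + p 0%N.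
  by rewrite -(big_mkord xpredT (fun i => p i.+1 - p i)) telescope_sumr // subrKA subrK.
(* The kernel with [N = 1] is constant, so [p 0] has degree 0 and the Bernstein bound for [D = 0] is
   [0^m = 0]. *)
have T0 : trig_diff d (p 0%N) x = 0.
  apply/eqP; rewrite -rnorm_eq0 eq_le rnorm_ge0 andbT.
  have [M M0 hM] := circle_bounded (@circle_continuous_tpoly R d (p 0%N)).
  have := @trig_diff_bernstein d 0 (p 0%N) M x M0 _ hM.
  rewrite mul0r expr0n (gtn_eqF m_gt0) mulr0 mul0r; apply => j hj.
  by apply: (hp 0%N).1; rewrite expn0 mul0n.
have Ti i : rnorm (trig_diff d (p i.+1 - p i) x)
    <= Q * (s ^+ m * (K i * (2 ^+ i) ^+ m)) * rnorm x.
  have := @trig_diff_bernstein d (2 ^ i.+1 * m.+1) (p i.+1 - p i) (2 * K i) x.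
  move=> h; apply: le_trans (h _ _ _) _; first by rewrite mulr_gt0.
  - move=> j hj; rewrite coefB (hp i.+1).1 ?(hp i).1 ?subrr //.
      apply: outside_widen hj; rewrite leq_mul2r /=; apply: leq_trans (leq_pred _) _.
      by rewrite leq_exp2l.
    by apply: outside_widen hj; rewrite leq_mul2r leq_pred orbT.
  - move=> z zc.
    have -> : tpoly d (p i.+1 - p i) z = tpoly d (q - p i) z - tpoly d (q - p i.+1) z.
      by rewrite /tpoly -mulrBr -hornerN -hornerD; congr (_ * _.[_]); ring.
    apply: le_trans (rnormB _ _) _.
    have := (hp i).2 z zc; have := (hp i.+1).2 z zc; have := K_nd i.
    rewrite -/(K i) -/(K i.+1); lra.
  rewrite natrM natrX exprS.
  have -> : bernstein_const m * (2 * K i) * (2 * 2 ^+ i * m.+1%:R * s) ^+ m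
    = Q * (s ^+ m * (K i * (2 ^+ i) ^+ m)).
    by rewrite /Q -/P !exprMn; ring.
  by [].
have T1 := trig_diff_le x (K0 I) (hp I).2.
have Tf : rnorm (binomial_diff m (fun k => fun_op f (V k) x) - trig_diff d q x)
    <= 2 ^+ m * (e * rnorm x).
  rewrite /trig_diff /binomial_diff -sumrB.
  under eq_bigr => k _ do rewrite -scalerBr.
  apply: (@binomial_diff_le _ _ m
    (fun k => fun_op f (V k) x - teval (V k) (V' k) d q x)) => k.
  exact: fun_op_approx (vw k) cf (ltW e0) fq.
have Tq : rnorm (trig_diff d q x) <= 2 ^+ m * (4 * K I * rnorm x)
    + \sum_(i < I) Q * (s ^+ m * (K i * (2 ^+ i) ^+ m)) * rnorm x.
  rewrite [in trig_diff d q x]E trig_diffD T0 addr0 trig_diffD.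
  apply: le_trans (rnormD _ _) _; rewrite lerD //.
  rewrite (@trig_diff_sum d I (fun i => p i.+1 - p i)).
  by apply: le_trans (rnorm_sum _ _ _) _; apply: ler_sum => i _.
have SE : \sum_(i < I) Q * (s ^+ m * (K i * (2 ^+ i) ^+ m)) * rnorm x
    = (Q * J * B * (s ^+ m * \sum_(i < I) (2 ^+ i) `^ (- alpha) * (2 ^+ i) ^+ m)
       + e * (Q * 2 ^+ n * (s ^+ m * \sum_(i < I) (2 ^+ i) ^+ m))) * rnorm x.
  rewrite -mulr_suml -!mulr_sumr; congr (_ * _).
  have -> : \sum_(i < I) K i * (2 ^+ i) ^+ m
      = J * B * (\sum_(i < I) (2 ^+ i) `^ (- alpha) * (2 ^+ i) ^+ m)
        + 2 ^+ n * e * (\sum_(i < I) (2 ^+ i) ^+ m).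
    by rewrite !mulr_sumr -big_split; apply: eq_bigr => i _; rewrite /K /=; ring.
  ring.
(* By [1 <= s * 2^I] the approximation rate [(2^I)^(- alpha)] is at most [s^alpha]. *)
have KI : K I <= J * B * s `^ alpha + 2 ^+ n * e.
  rewrite lerD2r mulrAC ler_wpM2l ?mulr_ge0 ?(ltW J0) //.
  rewrite powRN -[leLHS]mul1r ler_pdivrMr ?powR_gt0 ?exprn_gt0 //.
  rewrite -powRM ?exprn_ge0 ?(ltW s_gt0) //.
  have e1 : 1 `^ alpha = 1 :> R by rewrite powR1.
  rewrite -[leLHS]e1; apply: ge0_ler_powR; rewrite ?nnegrE ?(ltW a0) //.
  by apply: le_trans I1.
have DS := dyadic_sum_le am hI.
set b := dyadic_ratio alpha / (dyadic_ratio alpha - 1) in DS.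
set y := binomial_diff _ _ in Tf *.
have -> : y = (y - trig_diff d q x) + trig_diff d q x by rewrite subrK.
apply: le_trans (rnormD _ _) _; apply: le_trans (lerD Tf Tq) _; rewrite SE.
have QJB : 0 <= Q * J * B by rewrite !mulr_ge0 // ltW.
have h1 := ler_wpM2l QJB DS.
set S1 := s ^+ m * _ in h1 *; set S2 := s ^+ m * _ in Z Z0 *.
have -> : holder_const alpha * B * s `^ alpha * rnorm x + e * (Z * rnorm x)
   = 2 ^+ m * (e * rnorm x)
     + (2 ^+ m * (4 * (J * B * s `^ alpha + 2 ^+ n * e) * rnorm x)
        + (Q * J * B * (b * s `^ alpha) + e * (Q * 2 ^+ n * S2)) * rnorm x).
  by rewrite /holder_const /Z -/J -/P -/b /Q; ring.
rewrite lerD2l lerD //.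
  by rewrite ler_wpM2l ?exprn_ge0 // ler_wpM2r // ler_wpM2l.
by rewrite ler_wpM2r // lerD2r.
Qed.

End OperatorDifferences.

(** * Operator norms and Zygmund seminorms as real numbers, and the conclusion *)

Section OperatorNorm.
Context {R : realType} {H : hilbertType R}.

Lemma bounded_operator_le (A : H -> H) : bounded_operator A ->
  exists2 M : R, 0 < M & forall x, rnorm (A x) <= M * rnorm x.
Proof.
move=> [lA cA]; pose g : {linear H -> H} :=
  HB.pack A (GRing.isLinear.Build _ _ _ _ A lA).
have /linear_bounded_continuous/linear_boundedP : continuous g by exact: cA.
move=> /pinfty_ex_gt0[_ /posC_Re[M M0 ->] hM]; exists M => // x.
by have := hM x; rewrite !rnormE -rmorphM lecR.
Qed.

Lemma opnorm_ge0 (A : H -> H) : (0 <= opnorm A)%E.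
Proof.
apply: (@le_trans _ _ (rnorm (A 0))%:E); first by rewrite lee_fin rnorm_ge0.
by apply: ereal_sup_ubound; exists 0 => //=; rewrite normr0 ler01.
Qed.

Lemma opnorm_fineK (A : H -> H) : bounded_operator A -> (fine (opnorm A))%:E = opnorm A.
Proof.
move=> bA; have [M M0 hM] := bounded_operator_le bA; apply: fineK.
rewrite ge0_fin_numE ?opnorm_ge0 //.
apply: le_lt_trans (ltry M); apply: ge_ereal_sup => _ [x /= x1 <-].
rewrite lee_fin; apply: le_trans (hM x) _; rewrite ler_piMr ?(ltW M0) //.
by rewrite -lecR -rnormE.
Qed.

Lemma le_opnorm (A : H -> H) x : bounded_operator A ->
  rnorm (A x) <= fine (opnorm A) * rnorm x.
Proof.
move=> bA; have lA := bA.1.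
have [->|x0] := eqVneq x 0; first by rewrite (linear_map0 lA) !rnorm0 mulr0.
have nx : 0 < rnorm x by rewrite lt_def rnorm_eq0 x0 rnorm_ge0.
have nr : rnorm ((rnorm x)%:C%C^-1 : R[i]) = (rnorm x)^-1.
  by rewrite rnormV rnorm_real gtr0_norm.
rewrite -ler_pdivrMr // mulrC -nr -rnormZ -(linear_mapZ _ _ lA) -lee_fin opnorm_fineK //.
apply: ereal_sup_ubound; exists ((rnorm x)%:C%C^-1 *: x) => //=.
by rewrite rnormE rnormZ nr mulVf ?gt_eqF.
Qed.

End OperatorNorm.

Section ZygmundNorm.
Context {R : realType} (alpha : R) (f : R[i] -> R[i]).
Hypothesis f_class : zygmund_class alpha f.

Lemma zygmund_norm_ge0 : (0 <= zygmund_norm alpha f)%E.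
Proof.
have N1 : circle R (-1) by apply/circleP; rewrite rnormN rnorm1.
set z := iter (zygmund_order alpha) (rot_diff (-1)) f 1.
apply: (@le_trans _ _ (rnorm z / rnorm (1 - (-1) : R[i]) `^ alpha)%:E).
  by rewrite lee_fin divr_ge0 ?rnorm_ge0 ?powR_ge0.
apply: ereal_sup_ubound; exists (-1), 1; split=> //; last exact: circle1.
by rewrite -subr_eq0 -opprD oppr_eq0 (_ : 1 + 1 = 2%:R) // pnatr_eq0.
Qed.

Lemma zygmund_norm_fineK : (fine (zygmund_norm alpha f))%:E = zygmund_norm alpha f.
Proof. by apply: fineK; rewrite ge0_fin_numE ?zygmund_norm_ge0 // f_class.2. Qed.

Lemma iter_rot_diff1 n z : iter n.+1 (rot_diff 1) f z = 0.
Proof. by rewrite /= /rot_diff mul1r subrr. Qed.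

(** The supremum omits [tau = 1], which is one of the nodes in Jackson's averages; there the
    difference vanishes, its order being positive. *)
Lemma le_zygmund_norm tau z : circle R tau -> circle R z ->
  rnorm (iter (zygmund_order alpha) (rot_diff tau) f z)
    <= fine (zygmund_norm alpha f) * rnorm (1 - tau) `^ alpha.
Proof.
move=> tc zc; have [->|tau1] := eqVneq tau 1.
  by rewrite iter_rot_diff1 rnorm0 mulr_ge0 ?powR_ge0 ?fine_ge0 ?zygmund_norm_ge0.
have t0 : 0 < rnorm (1 - tau).
  by rewrite lt_def rnorm_eq0 subr_eq0 eq_sym tau1 rnorm_ge0.
rewrite -ler_pdivrMr ?powR_gt0 // -lee_fin zygmund_norm_fineK.
by apply: ereal_sup_ubound; exists tau, z.
Qed.

End ZygmundNorm.

Theorem theorem5p4 (R : realType) (m : nat) (alpha : R)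
    (m_gt0 : (0 < m)%N) (alpha_gt0 : 0 < alpha) (alpha_ltm : alpha < m%:R) :
  exists2 c : R, 0 < c &
    forall (f : R[i] -> R[i]), zygmund_class alpha f ->
    forall (H : hilbertType R) (U A : H -> H), unitary U -> self_adjoint A ->
      (opnorm (fun x : H => \sum_(0 <= k < m.+1)
                 ((-1) ^+ k * 'C(m, k)%:R : R[i]) *:
                 fun_op f (op_exp (fun y : H => ('i * k%:R : R[i]) *: A y) \o U) x)%R
       <= c%:E * zygmund_norm alpha f * opnorm A `^ alpha)%E.
Proof.
exists (holder_const m alpha); first exact: holder_const_gt0.
move=> f fZ H U A unU [bA sa]; have [W uw] := unitary_has_pair unU.
have lA := bA.1; have nA x := le_opnorm x bA.
rewrite -(zygmund_norm_fineK fZ) -(opnorm_fineK bA) poweR_EFin -!EFinM.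
set B := fine (zygmund_norm alpha f); set s := fine (opnorm A).
have B0 : 0 <= B by exact/fine_ge0/zygmund_norm_ge0.
have s0 : 0 <= s by exact/fine_ge0/opnorm_ge0.
have C0 : 0 <= holder_const m alpha * B * s `^ alpha.
  by rewrite !mulr_ge0 ?powR_ge0 // ltW // holder_const_gt0.
apply: ge_ereal_sup => _ [x /= x1 <-]; rewrite lee_fin big_mkord.
have {x1}nx : rnorm x <= 1 by rewrite -lecR -rnormE.
(* The scale [2^I ~ 1 / s] presupposes [s > 0]. For [s = 0] the operator [A] vanishes, all terms
   involve the same operator, and the alternating binomial sum is 0. *)
have [s_eq0|s_neq0] := eqVneq s 0; last first.
  have s_gt0 : 0 < s by rewrite lt_def s_neq0.
  have := holder_estimate uw lA sa s_gt0 nA m_gt0 x alpha_gt0 alpha_ltm B0 fZ.1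
    (le_zygmund_norm fZ).
  by move=> h; apply: le_trans h _; rewrite ler_piMr.
have A0 y : A y = 0.
  apply/eqP; rewrite -rnorm_eq0 eq_le rnorm_ge0 andbT.
  by have := nA y; rewrite -/s s_eq0 mul0r.
have E k : op_exp (fun y : H => ('i * k%:R : R[i]) *: A y) = op_exp (fun=> 0).
  by congr op_exp; apply/funext => y; rewrite A0 scaler0.
under eq_bigr => k _ do rewrite E.
have S0 : \sum_(k < m.+1) (-1) ^+ k * 'C(m, k)%:R = 0 :> R[i].
  rewrite -[RHS](alternating_power_sum m_gt0); apply: eq_bigr => k _.
  by rewrite expr0 mulr1.
by rewrite -scaler_suml S0 scale0r rnorm0.
Qed.
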